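(* Let $n\ge 2$, let $k_1,\dots,k_n$ be nonnegative integers, $\lambda=\sum_{i=1}^nk_i\lambda_i$ and $|\lambda|=\sum_{i=1}^nk_i$. With the notation and the polynomial realizations $V_n(\lambda)=\overline{M}\subset\widehat{M}\subset\mathcal{C}_n$ described in the context, the following hold (a singular vector being identified with its nonzero constant multiples). (1) For $r\in\mathbb{N}$, the $\mathfrak{sl}(n)$ singular vectors in $\widehat{M}_r$ are $\{\xi(\beta)\mid\beta\in\widehat{\Omega}_r\}$, and they generate all the $\mathfrak{sl}(n)$ irreducible components in $$\widehat{M}_r=\mathcal{A}_r\otimes_{\mathbb{C}}V_{n-1}\Big(\sum_{i=1}^{n-1}k_{i+1}\lambda_i\Big).$$ Numerically, this implies the identity $$\sum_{\beta\in\widehat{\Omega}_r}d_{n-1}(\lambda(\beta))=\binom{n+r-1}{n-1}\,d_{n-1}\Big(\sum_{i=1}^{n-1}k_{i+1}\lambda_i\Big).$$ (2) For $0\le r\le|\lambda|$, the $\mathfrak{sl}(n)$ singular vectors in $(V_n(\lambda))_r=\overline{M}_r$ are $\{\xi(\beta)\mid\beta\in\Omega_r\}$. Moreover, $\{\xi(\beta)\mid\beta\in\Omega\}$ are the highest-weight vectors of all the $\mathfrak{sl}(n)$ irreducible components in $V_n(\lambda)=\overline{M}$, and consequently $$\sum_{\beta\in\Omega}d_{n-1}(\lambda(\beta))=d_n(\lambda).$$ (3) If $r\le k_1$, then $\widehat{\Omega}_r=\Omega_r$, and hence $(V_n(\lambda))_r=\widehat{M}_r$.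
   Context: $E_{i,j}$ denotes the matrix unit with $1$ in position $(i,j)$; the base field is $\mathbb{C}$; $\mathbb{N}=\{0,1,2,\dots\}$. For $\mathfrak{sl}(m+1)$ the Cartan subalgebra is spanned by $h_i=E_{m+2-i,m+2-i}-E_{m+1-i,m+1-i}$ ($1\le i\le m$), the positive root vectors are $E_{i,j}$ with $j<i$, and $\lambda_i(h_r)=\delta_{i,r}$ defines the fundamental weights; $V_m(\mu)$ is the irreducible $\mathfrak{sl}(m+1)$-module of highest weight $\mu$. A singular vector of an $\mathfrak{sl}(n)$-module is a (nonzero) weight vector annihilated by all positive root vectors $E_{s,t}$, $1\le t<s\le n$. $\mathfrak{sl}(n)\subset\mathfrak{sl}(n+1)$ is the upper left corner. For a dominant integral weight $\mu=\sum_{i=1}^m l_i\lambda_i$ of $\mathfrak{sl}(m+1)$, $d_m(\mu)=\dim V_m(\mu)=\prod_{1\le i<j\le m+1}\frac{\sum_{r=i}^{j-1}l_r+j-i}{j-i}$. Construction. For $1\le m\le n$ let $\mathcal{C}_m=\mathbb{C}[x_{i,j}\mid 1\le j\le i\le m]$ and $c_m=-\frac{1}{m+1}\sum_{i=0}^{m-1}(m-i)k_{n-m+1+i}$. $\mathfrak{sl}(m+1)$ acts on $\mathcal{C}_m$ inductively. For $m=1$: $E_{1,2}=x_{1,1}^2\partial_{x_{1,1}}-k_nx_{1,1}$, $E_{2,1}=-\partial_{x_{1,1}}$, $E_{1,1}-E_{2,2}=2x_{1,1}\partial_{x_{1,1}}-k_n$. For $2\le m\le n$: make $\mathcal{C}_{m-1}$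 a $\mathfrak{gl}(m)$-module by letting $\sum_{i=1}^mE_{i,i}$ act as the scalar $c_m$; view differential operators on $\mathcal{C}_{m-1}$ as operators on $\mathcal{C}_m$; put $\mathcal{D}_m=\sum_{s=1}^mx_{m,s}\partial_{x_{m,s}}$; and for $i\ne j$ in $\{1,\dots,m\}$ let $E_{i,j}|_{\mathcal{C}_m}=x_{m,i}\partial_{x_{m,j}}+E_{i,j}|_{\mathcal{C}_{m-1}}$, $(E_{i,i}-E_{j,j})|_{\mathcal{C}_m}=x_{m,i}\partial_{x_{m,i}}-x_{m,j}\partial_{x_{m,j}}+(E_{i,i}-E_{j,j})|_{\mathcal{C}_{m-1}}$, $E_{i,m+1}|_{\mathcal{C}_m}=x_{m,i}\mathcal{D}_m+c_mx_{m,i}+\sum_{r=1}^mx_{m,r}E_{i,r}|_{\mathcal{C}_{m-1}}$, $E_{m+1,i}|_{\mathcal{C}_m}=-\partial_{x_{m,i}}$, $(E_{m,m}-E_{m+1,m+1})|_{\mathcal{C}_m}=\mathcal{D}_m+x_{m,m}\partial_{x_{m,m}}+c_m+E_{m,m}|_{\mathcal{C}_{m-1}}$. Put $V^{(1)}=\mathrm{Span}\{x_{1,1}^i\mid 0\le i\le k_n\}\subset\mathcal{C}_1$ and $V^{(m)}=U(\mathfrak{sl}(m+1))\,(1\otimes V^{(m-1)})\subset\mathcal{C}_m=\mathbb{C}[x_{m,1},\dots,x_{m,m}]\otimes\mathcal{C}_{m-1}$ for $2\le m\le n$. Then $M=V^{(n-1)}$ is the irreducible $\mathfrak{sl}(n)$-module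 $V_{n-1}(\sum_{i=1}^{n-1}k_{i+1}\lambda_i)$, $\widehat{M}=\mathbb{C}[x_{n,1},\dots,x_{n,n}]\otimes M\subset\mathcal{C}_n$, and $V_n(\lambda)=\overline{M}=V^{(n)}\subset\widehat{M}$ is the irreducible $\mathfrak{sl}(n+1)$-module with highest weight $\lambda$. $\mathcal{A}_r$ is the space of homogeneous polynomials of degree $r$ in $\mathbb{C}[x_{n,1},\dots,x_{n,n}]$, $\widehat{M}_r=\mathcal{A}_r\otimes M$, and $(V_n(\lambda))_r=\overline{M}_r=\overline{M}\cap\widehat{M}_r$. Convention: $x_{i,j}$ is a variable if $1\le j\le i$, $x_{i,i+1}=-1$, and $x_{i,j}=0$ otherwise. $D_{n,i}(i)$ is the determinant of the matrix with rows $(x_{l,i},x_{l,i+1},\dots,x_{l,n})$, $l=i,i+1,\dots,n$. For $\beta=(\beta_1,\dots,\beta_n)\in\mathbb{N}^n$, $|\beta|=\sum_i\beta_i$ and $$\lambda(\beta)=\sum_{i=1}^{n-1}(k_{i+1}+\beta_i-\beta_{i+1})\lambda_i,\qquad \xi(\beta)=(D_{n,n}(n))^{\beta_1}(D_{n,n-1}(n-1))^{\beta_2}\cdots(D_{n,1}(1))^{\beta_n}.$$ $$\Omega_r=\{\beta\in\mathbb{N}^n\mid|\beta|=r,\ 0\le\beta_i\le k_i\text{ for }1\le i\le n\},\qquad\Omega=\bigcup_{r=0}^{|\lambda|}\Omega_r,$$ $$\widehat{\Omega}_r=\{\beta\in\mathbb{N}^n\mid|\beta|=r,\ 0\le\beta_i\le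 k_i\text{ for }2\le i\le n\}.$$ *)

(* Defs.v *)
From HB Require Import structures.
From mathcomp Require Import all_boot all_order all_algebra.
From mathcomp Require Import reals complex mpoly.

Set Implicit Arguments.
Unset Strict Implicit.
Unset Printing Implicit Defensive.

Import GRing.Theory.
Local Open Scope ring_scope.

(* Subspaces of a (possibly infinite-dimensional) vector space are predicates. *)
Section LinearAlgebra.
Variables (F : fieldType) (V : lmodType F).

Definition subspace (W : V -> Prop) : Prop :=
  W 0 /\ forall (a : F) (u v : V), W u -> W v -> W (a *: u + v).

Definition lspan (S : V -> Prop) (v : V) : Prop :=
  exists2 s : seq (F * V),
    (forall a, a \in s -> S a.2) & v = \sum_(a <- s) a.1 *: a.2.

(* W is the internal direct sum of the subspaces C i, for i in P. *)
Definition direct_sum (I : finType) (P : pred I) (C : I -> V -> Prop)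
    (W : V -> Prop) : Prop :=
  (forall v, W v <->
     exists2 w : I -> V, (forall i, P i -> C i (w i)) & v = \sum_(i | P i) w i)
  /\ (forall w : I -> V, (forall i, P i -> C i (w i)) ->
        \sum_(i | P i) w i = 0 -> forall i, P i -> w i = 0).

End LinearAlgebra.

(* All indices i, j, m, s, t, ... are 1-based natural numbers, as are those of
   [k : nat -> nat], of which only k 1, ..., k n are ever used.

   [RootE i j] stands for E_{i,j} (i <> j), [DiagH i j] for E_{i,i} - E_{j,j};
   [in_sl N] selects those lying in sl(N) (the upper left corner); they span it. *)
Inductive slgen := RootE of nat & nat | DiagH of nat & nat.

Definition in_sl (N : nat) (g : slgen) : bool :=
  match g with
  | RootE i j => [&& 1 <= i <= N, 1 <= j <= N & i != j]%N
  | DiagH i j => [&& 1 <= i <= N & 1 <= j <= N]%N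
  end.

Section Realization.
Variables (F : fieldType) (n : nat) (k : nat -> nat).

(* C_n = F[x_{i,j} | 1 <= j <= i <= n]; the variables are numbered row by row,
   so that those of C_m are the first 'C(m.+1, 2) ones. Each C_m (m <= n) is
   regarded as a subalgebra of C_n, and C[x_{m,1},...,x_{m,m}] (x) C_{m-1} is
   identified with C_m by multiplication. *)
Notation Cn := {mpoly F[ 'C(n.+1, 2)]}.

Definition var_idx (i j : nat) : option 'I_('C(n.+1, 2)) :=
  if (1 <= j <= i)%N then insub ('C(i, 2) + j.-1)%N else None.

(* x_{i,j}, including the convention x_{i,i+1} = -1 and x_{i,j} = 0 if j > i+1 *)
Definition x (i j : nat) : Cn :=
  if var_idx i j is Some v then 'X_v else if j == i.+1 then -1 else 0.

Definition dx (i j : nat) (p : Cn) : Cn :=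
  if var_idx i j is Some v then mderiv v p else 0.

Definition c (m : nat) : F :=
  - (m.+1%:R)^-1 * (\sum_(0 <= i < m) (m - i) * k (n - m + 1 + i))%N%:R.

Definition euler (m : nat) (p : Cn) : Cn :=
  \sum_(1 <= s < m.+1) x m s * dx m s p.

(* E_{i,j} in gl(m), from an action of sl(m) and the requirement that
   \sum_i E_{i,i} act as the scalar c m: E_{i,i} is then
   m^-1 (c m + \sum_l (E_{i,i} - E_{l,l})). *)
Definition gl_op (m : nat) (sl : slgen -> Cn -> Cn) (i j : nat) (p : Cn) : Cn :=
  if i == j then
    (m%:R)^-1 *: (c m *: p + \sum_(1 <= l < m.+1) sl (DiagH i l) p)
  else sl (RootE i j) p.

(* The action of sl(m+1) on C_m, given that of sl(m) on C_{m-1}. *)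
Section Step.
Variables (m : nat) (sl : slgen -> Cn -> Cn).

Definition step_root (i j : nat) (p : Cn) : Cn :=
  if j == m.+1 then
    x m i * euler m p + c m *: (x m i * p)
      + \sum_(1 <= r < m.+1) x m r * gl_op m sl i r p
  else if i == m.+1 then - dx m j p
  else x m i * dx m j p + sl (RootE i j) p.

Definition step_diag (i j : nat) (p : Cn) : Cn :=
  x m i * dx m i p - x m j * dx m j p + sl (DiagH i j) p.

(* E_{m,m} - E_{m+1,m+1} *)
Definition step_last (p : Cn) : Cn :=
  euler m p + x m m * dx m m p + c m *: p + gl_op m sl m m p.

Definition step_op (g : slgen) (p : Cn) : Cn :=
  match g with
  | RootE i j => step_root i j p
  | DiagH i j =>
      if (i <= m)%N then
        if (j <= m)%N then step_diag i j p else step_diag i m p + step_last p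
      else
        if (j <= m)%N then - (step_diag j m p + step_last p) else 0
  end.

End Step.

Definition base_op (g : slgen) (p : Cn) : Cn :=
  let h := (x 1 1 * dx 1 1 p) *+ 2 - (k n)%:R *: p in
  match g with
  | RootE 1 2 => x 1 1 ^+ 2 * dx 1 1 p - (k n)%:R *: (x 1 1 * p)
  | RootE 2 1 => - dx 1 1 p
  | DiagH 1 2 => h
  | DiagH 2 1 => - h
  | _ => 0
  end.

(* The action of sl(m+1) on C_m, for 1 <= m <= n. *)
Fixpoint sl_op (m : nat) : slgen -> Cn -> Cn :=
  match m with
  | 0 => fun _ _ => 0
  | m'.+1 => if m' is 0 then base_op else step_op m (sl_op m')
  end.

(* U(sl(N)) S, where sl(N) acts as a subalgebra of sl(m+1), N <= m+1:
   U(sl(N)) is spanned by the words in the generators. *)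
Definition U_span (m N : nat) (S : Cn -> Prop) : Cn -> Prop :=
  lspan (fun v => exists gs : seq slgen,
    all (in_sl N) gs /\ exists2 u, S u & v = foldr (sl_op m) u gs).

Fixpoint Vm (m : nat) : Cn -> Prop :=
  match m with
  | 0 => fun _ => False
  | m'.+1 => if m' is 0
             then lspan (fun p => exists2 i, (i <= k n)%N & p = x 1 1 ^+ i)
             else U_span m m.+1 (Vm m')
  end.

Definition M : Cn -> Prop := Vm n.-1.

(* V_n(lambda) *)
Definition Mbar : Cn -> Prop := Vm n.

Definition A (r : nat) (p : Cn) : Prop :=
  exists2 q : {mpoly F[n]}, q \is r.-homog
    & p = comp_mpoly [tuple x n s.+1 | s < n] q.

Definition Mhat (r : nat) : Cn -> Prop :=
  lspan (fun p => exists q v, [/\ A r q, M v & p = q * v]).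

Definition Mbar_r (r : nat) (v : Cn) : Prop := Mbar v /\ Mhat r v.

(* sl(n)-modules: subspaces of C_n stable under the action of
   sl(n), the upper left corner of sl(n+1). *)

(* h_i = E_{n+1-i,n+1-i} - E_{n-i,n-i}, 1 <= i <= n-1 *)
Definition weight_vector (v : Cn) : Prop :=
  exists mu : nat -> F, forall i, (1 <= i <= n.-1)%N ->
    sl_op n (DiagH (n + 1 - i) (n - i)) v = mu i *: v.

Definition singular (v : Cn) : Prop :=
  [/\ v != 0, weight_vector v
    & forall s t, (1 <= t < s)%N -> (s <= n)%N -> sl_op n (RootE s t) v = 0].

Definition submodule (W : Cn -> Prop) : Prop :=
  subspace W /\ forall g v, in_sl n g -> W v -> W (sl_op n g v).

Definition irreducible (W : Cn -> Prop) : Prop :=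
  [/\ submodule W, exists2 v, W v & v != 0
    & forall W', submodule W' -> (forall v, W' v -> W v) ->
        (forall v, W' v -> v = 0) \/ (forall v, W v -> W' v)].

Definition generated (v : Cn) : Cn -> Prop := U_span n n (eq v).

(* The xi i, for i in P, are singular vectors generating irreducible submodules
   of which W is the direct sum, i.e. they are the highest-weight vectors of
   all the irreducible components of W. *)
Definition generate_components (I : finType) (P : pred I) (xi : I -> Cn)
    (W : Cn -> Prop) : Prop :=
  (forall i, P i -> singular (xi i) /\ irreducible (generated (xi i)))
  /\ direct_sum P (fun i => generated (xi i)) W.

(* D_{n,i}(i), for 1 <= i <= n *)
Definition D (i : nat) : Cn :=
  \det (\matrix_(a < (n - i).+1, b < (n - i).+1) x (i + a) (i + b)).

(* The entry beta_{i+1} of beta is [beta i], for i : 'I_n. *)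
Definition xi (beta : 'X_{1..n}) : Cn := \prod_(i < n) D (n - i) ^+ beta i.

End Realization.

Section Combinatorics.
Variables (n : nat) (k : nat -> nat).

Definition abs_lambda : nat := \sum_(1 <= i < n.+1) k i.

Definition Omega_r (r : nat) (beta : 'X_{1..n}) : bool :=
  (mdeg beta == r) && [forall i : 'I_n, beta i <= k i.+1]%N.

Definition Omega (beta : 'X_{1..n}) : bool :=
  [exists r : 'I_abs_lambda.+1, Omega_r r beta].

Definition Omega_hat (r : nat) (beta : 'X_{1..n}) : bool :=
  (mdeg beta == r) && [forall i : 'I_n, (2 <= i.+1) ==> (beta i <= k i.+1)]%N.

(* The coefficients of lambda(beta) on lambda_1, ..., lambda_{n-1};
   [nth 0 beta i.-1] is beta_i. *)
Definition lambda_of (beta : 'X_{1..n}) (i : nat) : int :=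
  (k i.+1)%:Z + (nth 0 beta i.-1)%N%:Z - (nth 0 beta i)%N%:Z.

End Combinatorics.

(* Weyl's product formula for the dimension of V_m(\sum_{i=1}^m l i * lambda_i) *)
Definition d (m : nat) (l : nat -> int) : rat :=
  \prod_(1 <= i < m.+2) \prod_(i.+1 <= j < m.+2)
     (((\sum_(i <= r < j) l r)%:~R + (j - i)%N%:R) / (j - i)%N%:R).

Arguments Mhat : clear implicits.
Arguments Mbar : clear implicits.
Arguments Mbar_r : clear implicits.
Arguments singular : clear implicits.
Arguments generate_components F n k {I} P xi W.
Arguments xi : clear implicits.
Arguments Omega_r : clear implicits.
Arguments Omega : clear implicits.
Arguments Omega_hat : clear implicits.
Arguments lambda_of : clear implicits.

(* Main.v *)
Require Import Defs.
From HB Require Import structures.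
From mathcomp Require Import all_boot all_order all_algebra.
From mathcomp Require Import reals complex mpoly.
From mathcomp Require Import perm.
From mathcomp Require Import ring lra zify.
From Stdlib Require Import Classical ClassicalEpsilon.

(* Write kappa_l = k_{n+1-l} and R_l = \sum_j x_{l-1,j} d/dx_{l,j}. The operators R_l
   commute with the positive root vectors, and V^(m) turns out to be the common
   kernel of the powers R_l^{kappa_l+1}, 1 <= l <= m, in C_m. By induction on m these
   kernels carry positive definite contravariant forms, starting from the
   Fischer-Bargmann form: under gl(m), the polynomials of each level are an orthogonal
   sum of irreducible submodules generated by the monomials in the minors
   D_{m,i}(i), and the raising operators E_{i,m+1} are multiplications by x_{m,i}
   corrected by a Casimir element, so that between two such submodules E_{i,m+1} is a
   scalar multiple of the multiplication by x_{m,i}. That scalar vanishes exactly at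
   the boundary of the common kernel, and rescaling the form on each submodule makes
   E_{i,m+1} adjoint to E_{m+1,i}.

   The dimension identities follow from the expression of Weyl's formula as a
   determinant of binomial coefficients: a sum over the exponents is a determinant of
   sums, evaluated by row operations, telescoping and the Vandermonde convolution. *)

Set Implicit Arguments.
Unset Strict Implicit.
Unset Printing Implicit Defensive.

Import Order.TTheory GRing.Theory Num.Theory.
Local Open Scope ring_scope.

(** * Linear identities in abelian groups, by reflection *)

(** Positivity does the structural work: complete reducibility, orthogonality and irreducibility of
    the components all follow from a form for which E_{i,j} and E_{j,i} are adjoint, so each level
    has to supply such a form to the next. The obstacle is that gl(m) leaves the form free on every
    component, while the raising operators link components. The scalar between the components of
    exponents beta and beta + e_j is -(kappa_j + ... + kappa_m + m - j - beta_j); the constants c_m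
    produce these kappa's. It is nonzero as long as beta_j < kappa_j, and at beta_j = kappa_j it
    vanishes only for j = m; this suffices, because the bounds for j < m are inherited from the
    previous level. The form lives on polynomials in all rows, those not yet treated being
    spectators, so that the form of one level is the starting point of the next. The nonvanishing is
    used a second time, to show that 1 generates the kernel. The numerical identities are proved for
    Weyl's product itself and do not pass through dimensions of modules. *)

Inductive zexpr := ZAtom of nat | ZZero | ZAdd of zexpr & zexpr | ZOpp of zexpr.

Section ZModReflection.
Variable V : zmodType.

Fixpoint zeval (l : seq V) (t : zexpr) : V :=
  match t with
  | ZAtom i => nth 0 l i
  | ZZero => 0
  | ZAdd a b => zeval l a + zeval l b
  | ZOpp a => - zeval l a
  end.

Fixpoint zcoef (i : nat) (t : zexpr) : int :=
  match t with
  | ZAtom j => (i == j)%:Z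
  | ZZero => 0
  | ZAdd a b => zcoef i a + zcoef i b
  | ZOpp a => - zcoef i a
  end.

Lemma zeval_coef l t : zeval l t = \sum_(i < size l) nth 0 l i *~ zcoef i t.
Proof.
elim: t => [j||a iha b ihb|a iha] /=.
- have [ltj|gej] := ltnP j (size l).
    rewrite (bigD1 (Ordinal ltj)) //= eqxx mulr1z big1 ?addr0 // => i.
    by rewrite -val_eqE /= => /negbTE ->.
  rewrite nth_default // big1 // => i _; rewrite ltn_eqF //.
  exact: leq_trans (ltn_ord i) gej.
- by rewrite big1 // => i _; rewrite mulr0z.
- by rewrite iha ihb -big_split; apply: eq_bigr => i _; rewrite mulrzDr.
- by rewrite iha -sumrN; apply: eq_bigr => i _; rewrite mulrNz.
Qed.

(** The hypothesis is a boolean on integer coefficients, which [zmod] discharges by computation once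
    the atoms are listed. *)
Lemma zeval_eq l t u :
  all (fun i => zcoef i t == zcoef i u) (iota 0 (size l)) -> zeval l t = zeval l u.
Proof.
move=> /allP h; rewrite !zeval_coef; apply: eq_bigr => i _.
by rewrite (eqP (h i _)) // mem_iota /= add0n.
Qed.

End ZModReflection.

(* Atoms are compared up to conversion: the same term may be reached through
   different canonical structure paths. *)
Ltac zindex x l :=
  match l with
  | x :: _ => constr:(0%N)
  | ?y :: _ => let _ := constr:(erefl x : x = y) in constr:(0%N)
  | _ :: ?l' => let i := zindex x l' in constr:(i.+1)
  end.
Ltac zinsert x l :=
  match l with
  | _ => let _ := zindex x l in l
  | _ => constr:(x :: l)
  end.
Ltac zatoms t l :=
  lazymatch t with
  | 0 => l
  | ?a + ?b => let l' := zatoms a l in zatoms b l'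
  | - ?a => zatoms a l
  | _ => zinsert t l
  end.
Ltac zquote t l :=
  lazymatch t with
  | 0 => constr:(ZZero)
  | ?a + ?b => let a' := zquote a l in let b' := zquote b l in constr:(ZAdd a' b')
  | - ?a => let a' := zquote a l in constr:(ZOpp a')
  | _ => let i := zindex t l in constr:(ZAtom i)
  end.
Ltac zmod :=
  lazymatch goal with
  | |- @eq ?V ?a ?b =>
    let l0 := zatoms a (@nil V) in
    let l := zatoms b l0 in
    let t := zquote a l in let u := zquote b l in
    exact: (@zeval_eq _ l t u isT)
  end.

Lemma sum_delta (V : zmodType) (I : finType) (j : I) (f : I -> V) :
  \sum_i f i *+ (i == j) = f j.
Proof.
rewrite (bigD1 j) //= eqxx mulr1n big1 ?addr0 // => i /negbTE ->.
by rewrite mulr0n.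
Qed.

Lemma sum_delta_sym (V : zmodType) (I : finType) (j : I) (f : I -> V) :
  \sum_i f i *+ (j == i) = f j.
Proof. by rewrite -[RHS]sum_delta; apply: eq_bigr => i _; rewrite eq_sym. Qed.

(** * Polynomials with coefficients in a gl(m)-module, and their raising operators *)

Section WeylAlgebra.
Variables (F : fieldType) (V : lmodType F) (I : finType).
Variables (X Y : I -> {linear V -> V}) (e : I -> I -> {linear V -> V}) (c : F).
Hypotheses (XX : forall i j v, X i (X j v) = X j (X i v))
  (YY : forall i j v, Y i (Y j v) = Y j (Y i v))
  (YX : forall i j v, Y j (X i v) = X i (Y j v) + v *+ (i == j))
  (eX : forall i j a v, e i j (X a v) = X a (e i j v))
  (eY : forall i j a v, e i j (Y a v) = Y a (e i j v))
  (ee : forall i j a b v, e i j (e a b v)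
     = e a b (e i j v) + e i b v *+ (j == a) - e a j v *+ (i == b)).

(** In the application [X i] is multiplication by a variable of row m, [Y i] the corresponding
    derivative, and [e] the action of gl(m) on C_{m-1}. *)
Definition weyl_euler v := \sum_s X s (Y s v).
Definition weyl_gl i j v := X i (Y j v) + e i j v.
Definition weyl_raise i v := X i (weyl_euler v) + c *: X i v + \sum_r X r (e i r v).
(* Half of the mixed part of the Casimir element of gl acting on the tensor
   product of polynomials in the X i with the module given by e. *)
Definition weyl_casimir v := \sum_r \sum_s X r (Y s (e s r v)).

Local Notation D := weyl_euler.
Local Notation T := weyl_gl.
Local Notation E := weyl_raise.
Local Notation K := weyl_casimir.

Lemma weyl_euler_linear : linear D.
Proof.
move=> a u v; rewrite /D scaler_sumr -big_split; apply: eq_bigr => s _.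
by rewrite !linearP.
Qed.
HB.instance Definition _ := GRing.isLinear.Build F V V *:%R D weyl_euler_linear.

Lemma weyl_gl_linear i j : linear (T i j).
Proof. by move=> a u v; rewrite /T !linearP scalerDr addrACA. Qed.
HB.instance Definition _ i j :=
  GRing.isLinear.Build F V V *:%R (T i j) (weyl_gl_linear i j).

Lemma weyl_raise_linear i : linear (E i).
Proof.
move=> a u v; rewrite /E !linearP /= !scalerDr.
rewrite (eq_bigr (fun r => a *: X r (e i r u) + X r (e i r v))); last first.
  by move=> r _; rewrite !linearP.
rewrite big_split -scaler_sumr /= !scalerA; zmod.
Qed.
HB.instance Definition _ i :=
  GRing.isLinear.Build F V V *:%R (E i) (weyl_raise_linear i).

Lemma weyl_casimir_linear : linear K.
Proof.
move=> a u v; rewrite /K scaler_sumr -big_split; apply: eq_bigr => r _ /=.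
by rewrite scaler_sumr -big_split; apply: eq_bigr => s _; rewrite !linearP.
Qed.
HB.instance Definition _ :=
  GRing.isLinear.Build F V V *:%R K weyl_casimir_linear.

Lemma weyl_eulerX i v : D (X i v) = X i (D v) + X i v.
Proof.
rewrite /D raddf_sum -[X in _ = _ + X](sum_delta_sym i (fun s => X s v)) -big_split /=.
by apply: eq_bigr => s _; rewrite YX linearD XX raddfMn.
Qed.

Lemma weyl_eulerY j v : Y j (D v) = D (Y j v) + Y j v.
Proof.
rewrite /D raddf_sum -[X in _ = _ + X](sum_delta j (fun s => Y s v)) -big_split /=.
by apply: eq_bigr => s _; rewrite YX YY.
Qed.

Lemma weyl_euler_e i j v : e i j (D v) = D (e i j v).
Proof. by rewrite /D raddf_sum; apply: eq_bigr => s _ /=; rewrite eX eY. Qed.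

Lemma weyl_glX i j a v : T i j (X a v) = X a (T i j v) + X i v *+ (j == a).
Proof.
by rewrite /T YX eX !linearD raddfMn XX [a == j]eq_sym addrAC.
Qed.

Lemma weyl_glY i j a v : Y a (T i j v) = T i j (Y a v) + Y j v *+ (a == i).
Proof. by rewrite /T linearD YX YY eY addrAC [i == a]eq_sym. Qed.

Lemma weyl_gl_euler i j v : T i j (D v) = D (T i j v).
Proof.
rewrite /T linearD /= weyl_euler_e weyl_eulerX weyl_eulerY !linearD; zmod.
Qed.

Lemma weyl_gl_gl i j a b v :
  T i j (T a b v) = T a b (T i j v) + T i b v *+ (j == a) - T a j v *+ (i == b).
Proof.
rewrite [T a b v]/T linearD /= weyl_glX [T i j (e a b v)]/T ee.
rewrite [T a b (T i j v)]/T weyl_glY /T !(linearD, raddfMn) /= eX eY.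
rewrite !(mulrnDl, mulNrn) [b == i]eq_sym !eY; zmod.
Qed.

(** Moving [X i] through the double sum [K] leaves the terms with s = i. The correction term of the
    raising operator is thus a commutator with an operator that will act by a scalar on each
    irreducible component. *)
Lemma weyl_raise_e i v : \sum_r X r (e i r v) = K (X i v) - X i (K v).
Proof.
rewrite /K raddf_sum -sumrB; apply: eq_bigr => r _.
rewrite raddf_sum -sumrB -[LHS](sum_delta_sym i (fun s => X r (e s r v))) /=.
by apply: eq_bigr => s _; rewrite eX YX linearD XX raddfMn addrAC subrr add0r.
Qed.

(** The commutator with one term of [K] has four parts; after summation over r and s they cancel in
    pairs, the first with the fourth and the second with the third. *)
Lemma weyl_gl_casimir i j v : T i j (K v) = K (T i j v).
Proof.
have h r s : T i j (X r (Y s (e s r v))) = X r (Y s (e s r (T i j v)))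
    + X r (Y s (e i r v)) *+ (j == s) - X r (Y s (e s j v)) *+ (i == r)
    + X i (Y s (e s r v)) *+ (j == r) - X r (Y j (e s r v)) *+ (s == i).
  have hY u : T i j (Y s u) = Y s (T i j u) - Y j u *+ (s == i).
    by rewrite weyl_glY addrK.
  have he : T i j (e s r v)
      = e s r (T i j v) + e i r v *+ (j == s) - e s j v *+ (i == r).
    rewrite /T ee linearD eX eY; zmod.
  by rewrite weyl_glX hY he !(linearD, linearN, linearB, raddfMn) /=; zmod.
rewrite /K raddf_sum.
under eq_bigr => r _.
  rewrite /= raddf_sum /=; under eq_bigr => s _ do rewrite /= h.
  rewrite !(big_split, sumrN) /= sum_delta_sym.
  rewrite (sum_delta i (fun s => X r (Y j (e s r v)))) !sumrMnl.
  over.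
rewrite !(big_split, sumrN) /=.
rewrite (sum_delta_sym i (fun r => \sum_s X r (Y s (e s j v)))).
rewrite (sum_delta_sym j (fun r => \sum_s X i (Y s (e s r v)))).
zmod.
Qed.

Lemma weyl_raiseE i v : E i v = X i (D v) + c *: X i v + (K (X i v) - X i (K v)).
Proof. by rewrite /E weyl_raise_e. Qed.

Lemma weyl_gl_raise i j a v : T i j (E a v) = E a (T i j v) + E i v *+ (j == a).
Proof.
have TD u w : T i j (u + w) = T i j u + T i j w by exact: linearD.
have TN u : T i j (- u) = - T i j u by exact: linearN.
have TZ t u : T i j (t *: u) = t *: T i j u by exact: linearZ.
have KD u w : K (u + w) = K u + K w by exact: linearD.
have KM u k : K (u *+ k) = K u *+ k by exact: raddfMn.
rewrite !weyl_raiseE !(TD, TN, TZ) weyl_gl_casimir !weyl_glX weyl_gl_casimir.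
rewrite weyl_gl_euler KD KM !scalerDr !(mulrnDl, mulNrn, scalerMnr); zmod.
Qed.

Lemma weyl_raiseY i j v :
  Y j (E i v) = E i (Y j v) + (D v + c *: v) *+ (i == j) + T i j v.
Proof.
have YD u w : Y j (u + w) = Y j u + Y j w by exact: linearD.
have XD u w : X i (u + w) = X i u + X i w by exact: linearD.
have -> : Y j (E i v) = Y j (X i (D v)) + c *: Y j (X i v) + \sum_r Y j (X r (e i r v)).
  by rewrite /E !YD [Y j (\sum_r _)]raddf_sum linearZ.
rewrite !YX weyl_eulerY XD /E.
have -> : \sum_r Y j (X r (e i r v)) = \sum_r X r (e i r (Y j v)) + e i j v.
  rewrite -[X in _ = _ + X](sum_delta j (fun r => e i r v)) -big_split; apply: eq_bigr => r _.
  by rewrite YX eY.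
rewrite /T scalerDr !mulrnDl scalerMnr; zmod.
Qed.

Lemma weyl_raiseX_euler i v : D (E i v) = E i (D v) + E i v.
Proof.
have DD u w : D (u + w) = D u + D w by exact: linearD.
have DZ t u : D (t *: u) = t *: D u by exact: linearZ.
have DG : D (\sum_r X r (e i r v)) = \sum_r X r (e i r (D v)) + \sum_r X r (e i r v).
  rewrite -big_split [LHS]raddf_sum; apply: eq_bigr => r _ /=.
  by rewrite weyl_eulerX weyl_euler_e.
have XD u w : X i (u + w) = X i u + X i w by exact: linearD.
rewrite /E !DD DZ !weyl_eulerX DG !(XD, scalerDr); zmod.
Qed.

(** With [G i] the last sum of [E i], the commutator of [G i] and [G j] is X_j G_i - X_i G_j. It is
    cancelled by the commutators of the Euler parts with [G j] and [G i], since [G] raises the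
    degree by one. *)
Lemma weyl_raise_raise i j v : E i (E j v) = E j (E i v).
Proof.
pose G i v := \sum_r X r (e i r v).
have GX a b u : G a (X b u) = X b (G a u).
  by rewrite /G raddf_sum; apply: eq_bigr => r _; rewrite eX XX.
have DG a u : D (G a u) = G a (D u) + G a u.
  rewrite /G raddf_sum -big_split; apply: eq_bigr => r _ /=.
  by rewrite weyl_eulerX weyl_euler_e.
have Glin a : linear (G a).
  move=> t u w; rewrite /G scaler_sumr -big_split; apply: eq_bigr => r _.
  by rewrite !linearP.
have GD a u w : G a (u + w) = G a u + G a w.
  by have := Glin a 1 u w; rewrite !scale1r.
have GZ a t u : G a (t *: u) = t *: G a u.
  have := Glin a t u 0; rewrite !addr0 => ->.
  have := Glin a (- 1) u u; rewrite !scaleN1r !addNr => ->; rewrite addr0 //.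
have GG a b u : G a (G b u) = G b (G a u) + X b (G a u) - X a (G b u).
  have h r s : X r (e a r (X s (e b s u))) = X r (X s (e b s (e a r u)))
      + X r (X s (e a s u)) *+ (r == b) - X r (X s (e b r u)) *+ (a == s).
    by rewrite eX ee !(linearD, linearN, raddfMn).
  rewrite /G; under eq_bigr => r _.
    rewrite !raddf_sum; under eq_bigr => s _ do rewrite /= h.
    rewrite !(big_split, sumrN) /= sumrMnl.
    rewrite (sum_delta_sym a (fun s => X r (X s (e b r u)))).
    over.
  rewrite !(big_split, sumrN) /=.
  rewrite (sum_delta b (fun r => \sum_s X r (X s (e a s u)))).
  rewrite exchange_big !raddf_sum !sumrN /=; congr (_ + _ - _).
    by apply: eq_bigr => s _; rewrite !raddf_sum; apply: eq_bigr => r _ /=; rewrite eX XX.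
  by apply: eq_bigr => r _; rewrite XX.
have EE a u : E a u = X a (D u) + c *: X a u + G a u by [].
have DD u w : D (u + w) = D u + D w by exact: linearD.
have DZ t u : D (t *: u) = t *: D u by exact: linearZ.
have XD a u w : X a (u + w) = X a u + X a w by exact: linearD.
have XZ a t u : X a (t *: u) = t *: X a u by exact: linearZ.
rewrite !EE !(DD, DZ, GD, GZ, XD, XZ) !weyl_eulerX !DG !GX.
rewrite (GG i j) !(DD, DZ, GD, GZ, XD, XZ, scalerDr) ![X i (X j _)]XX; zmod.
Qed.

End WeylAlgebra.

(** * From gl(m) to gl(m+1) *)

Section Extension.
Variables (F : fieldType) (V : lmodType F) (I : finType).
Variables (T : I -> I -> {linear V -> V}) (E Y : I -> {linear V -> V}).
Variables (D : {linear V -> V}) (c s : F).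
Hypotheses
  (TT : forall i j a b v,
     T i j (T a b v) = T a b (T i j v) + T i b v *+ (j == a) - T a j v *+ (i == b))
  (TE : forall i j a v, T i j (E a v) = E a (T i j v) + E i v *+ (j == a))
  (TY : forall i j a v, Y a (T i j v) = T i j (Y a v) + Y j v *+ (a == i))
  (TD : forall i j v, T i j (D v) = D (T i j v))
  (EE : forall i j v, E i (E j v) = E j (E i v))
  (EY : forall i j v, Y j (E i v) = E i (Y j v) + (D v + c *: v) *+ (i == j) + T i j v)
  (ED : forall i v, D (E i v) = E i (D v) + E i v)
  (YY : forall i j v, Y i (Y j v) = Y j (Y i v))
  (YD : forall j v, Y j (D v) = D (Y j v) + Y j v).

(* The gl action extended by one index, [None], as in the inductive step of the
   polynomial realization; s is the scalar fixing the trace. *)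
Definition gl_ext (a b : option I) (v : V) : V :=
  match a, b with
  | Some i, Some j => T i j v + (s *: v) *+ (i == j)
  | Some i, None => E i v
  | None, Some j => - Y j v
  | None, None => (s - c) *: v - D v
  end.

(** The new index makes the raising operators a column and the lowering operators a row of the
    larger matrix, so the sixteen cases are the assumed relations, up to antisymmetry of the
    bracket. *)
Lemma gl_ext_rel a b a' b' v : gl_ext a b (gl_ext a' b' v)
  = gl_ext a' b' (gl_ext a b v) + gl_ext a b' v *+ (b == a')
    - gl_ext a' b v *+ (a == b').
Proof.
have Tz i j t u : T i j (t *: u) = t *: T i j u by exact: linearZ.
have Ez i t u : E i (t *: u) = t *: E i u by exact: linearZ.
have Yz i t u : Y i (t *: u) = t *: Y i u by exact: linearZ.
have Dz t u : D (t *: u) = t *: D u by exact: linearZ.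
have hTT i j k l : gl_ext (Some i) (Some j) (gl_ext (Some k) (Some l) v)
  = gl_ext (Some k) (Some l) (gl_ext (Some i) (Some j) v)
    + gl_ext (Some i) (Some l) v *+ (j == k) - gl_ext (Some k) (Some j) v *+ (i == l).
  rewrite /= !(linearD, raddfMn) /= ?(Tz, Ez, Yz, Dz) TT.
  rewrite !(scalerDr, mulrnDl, scalerMnr, mulNrn).
  rewrite ![_ *+ (i == l) *+ (j == k)]mulrnAC ![k == j]eq_sym.
  rewrite ![_ *+ (i == j) *+ (k == l)]mulrnAC; zmod.
have hTE i j k : gl_ext (Some i) (Some j) (gl_ext (Some k) None v)
  = gl_ext (Some k) None (gl_ext (Some i) (Some j) v) + E i v *+ (j == k).
  by rewrite /= !(linearD, raddfMn) /= ?(Tz, Ez, Yz, Dz) TE; zmod.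
have hTY i j l : gl_ext (Some i) (Some j) (gl_ext None (Some l) v)
  = gl_ext None (Some l) (gl_ext (Some i) (Some j) v) + Y j v *+ (i == l).
  by rewrite /= !(linearD, linearN, raddfMn) /= ?(Tz, Ez, Yz, Dz) TY !mulNrn [l == i]eq_sym; zmod.
have hTD i j : gl_ext (Some i) (Some j) (gl_ext None None v)
  = gl_ext None None (gl_ext (Some i) (Some j) v).
  rewrite /= !(linearD, linearN, raddfMn) /= ?(Tz, Ez, Yz, Dz) TD.
  rewrite !(mulrnDl, mulNrn, scalerMnr) !scalerA [s * _]mulrC; zmod.
have hEY i l : E i (- Y l v) = - Y l (E i v) + gl_ext (Some i) (Some l) v
    - gl_ext None None v *+ (i == l).
  rewrite /= linearN /= EY scalerBl !(mulrnDl, mulNrn).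
  by rewrite !opprD !opprK; zmod.
have hED i : E i (gl_ext None None v) = gl_ext None None (E i v) + E i v.
  by rewrite /= !(linearD, linearN) /= ?(Tz, Ez, Yz, Dz) ED; zmod.
have hYD j : - Y j (gl_ext None None v) = gl_ext None None (- Y j v) + Y j v.
  by rewrite /= !(linearD, linearN) /= ?(Tz, Ez, Yz, Dz) YD; zmod.
have SS (p q : I) : (Some p == Some q) = (p == q) by [].
have SN (p : I) : (Some p == None) = false by [].
have NS (p : I) : (None == Some p) = false by [].
have NN : (None == None :> option I) = true by [].
case: a b a' b' => [i|] [j|] [k|] [l|].
all: rewrite ?SS ?SN ?NS ?NN ?mulr0n ?mulr1n ?subr0 ?addr0.
- exact: hTT.
- by rewrite hTE.
- rewrite hTY /= mulNrn; zmod.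
- by rewrite hTD.
- rewrite hTE /= [l == i]eq_sym; zmod.
- by rewrite /= EE.
- exact: hEY.
- exact: hED.
- rewrite hTY /= mulNrn [k == j]eq_sym; zmod.
- rewrite [X in _ = X + _ - _]hEY /= [j == k]eq_sym; zmod.
- by rewrite /= !linearN /= YY.
- by rewrite [LHS]hYD /=; zmod.
- by rewrite hTD.
- rewrite [X in _ = X - _]hED /=; zmod.
- rewrite [X in _ = X - _]hYD /=; zmod.
- by rewrite addrK.
Qed.
End Extension.

(** * Subspaces and positive definite forms *)

Section Subspaces.
Variables (F : fieldType) (V : lmodType F).
Implicit Types (W S : V -> Prop).

Lemma subspaceD W u v : subspace W -> W u -> W v -> W (u + v).
Proof. by case=> _ h Wu Wv; rewrite -[u]scale1r; apply: h. Qed.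

Lemma subspaceL W a u v : subspace W -> W u -> W v -> W (a *: u + v).
Proof. by case=> _; apply. Qed.

Lemma subspaceZ W a u : subspace W -> W u -> W (a *: u).
Proof. by case=> h0 h Wu; rewrite -[_ *: _]addr0; apply: h. Qed.

Lemma subspaceN W u : subspace W -> W u -> W (- u).
Proof. by move=> h Wu; rewrite -scaleN1r; apply: subspaceZ. Qed.

Lemma subspaceB W u v : subspace W -> W u -> W v -> W (u - v).
Proof. by move=> h Wu Wv; apply: subspaceD => //; apply: subspaceN. Qed.

Lemma subspaceMn W u k : subspace W -> W u -> W (u *+ k).
Proof. by move=> h Wu; rewrite -scaler_nat; apply: subspaceZ. Qed.

Lemma subspace_sum W (I : eqType) (s : seq I) (P : pred I) (f : I -> V) :
  subspace W -> (forall i, i \in s -> P i -> W (f i)) -> W (\sum_(i <- s | P i) f i).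
Proof.
move=> hW h; rewrite big_seq_cond; apply: big_ind; first by case: hW.
  by move=> u v; apply: subspaceD.
by move=> i /andP[]; apply: h.
Qed.

Lemma lspan_subspace S : subspace (lspan S).
Proof.
split; first by exists [::] => //; rewrite big_nil.
move=> a _ _ [s hs ->] [t ht ->].
exists ([seq (a * x.1, x.2) | x <- s] ++ t).
  move=> x; rewrite mem_cat => /orP[/mapP[y ys ->]|/ht //]; exact: (hs y ys).
rewrite big_cat big_map scaler_sumr; congr (_ + _).
by apply: eq_bigr => x _; rewrite scalerA.
Qed.

Lemma lspan_in S v : S v -> lspan S v.
Proof.
by move=> Sv; exists [:: (1, v)]; [move=> x /[!inE] /eqP-> | rewrite big_seq1 /= scale1r].
Qed.

Lemma lspan_min S W : subspace W -> (forall v, S v -> W v) -> forall v, lspan S v -> W v.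
Proof.
move=> hW h _ [s hs ->]; apply: subspace_sum => // x xs _.
by apply: subspaceZ => //; apply: h; apply: hs.
Qed.

Lemma lspan_indexed (I : eqType) (Q : I -> Prop) (C : I -> V -> Prop) v :
  (forall i, subspace (C i)) -> lspan (fun u => exists2 i, Q i & C i u) v ->
  exists2 s : seq (I * V), (forall a, a \in s -> Q a.1 /\ C a.1 a.2) & v = \sum_(a <- s) a.2.
Proof.
move=> sC; apply: (lspan_min (W := fun v => exists2 s : seq (I * V),
  (forall a, a \in s -> Q a.1 /\ C a.1 a.2) & v = \sum_(a <- s) a.2)).
  split; first by exists [::] => //; rewrite big_nil.
  move=> c _ _ [s hs ->] [t ht ->].
  exists ([seq (a.1, c *: a.2) | a <- s] ++ t).
    move=> a; rewrite mem_cat => /orP[/mapP[b /hs[Pb Lb] ->]|/ht //].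
    by split=> //; apply: (subspaceZ _ (sC _)).
  by rewrite big_cat big_map /= scaler_sumr.
move=> u [i Pi Lu]; exists [:: (i, u)]; last by rewrite big_seq1.
by move=> a /[!inE] /eqP ->.
Qed.

(** Summands with the same index are collected, which turns a list of vectors into a family with one
    vector per index. *)
Lemma lspan_components (I : eqType) (J : finType) (idx : J -> I) (Q : I -> Prop) (R : pred J)
    (C : I -> V -> Prop) v : (forall i, subspace (C i)) -> injective idx ->
  (forall i, Q i -> exists2 j, R j & i = idx j) ->
  lspan (fun u => exists2 i, Q i & C i u) v ->
  exists2 u : J -> V, (forall j, R j -> C (idx j) (u j)) & v = \sum_(j | R j) u j.
Proof.
move=> sC inj hidx /(lspan_indexed sC)[s hs ->].
exists (fun j => \sum_(a <- s | a.1 == idx j) a.2) => [j Qj|].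
  apply: (subspace_sum (sC _)) => a /hs[_ La] /eqP <- //.
rewrite (eq_bigr (fun j => \sum_(a <- s) if a.1 == idx j then a.2 else 0)); last first.
  by move=> j _; rewrite big_mkcond.
rewrite exchange_big; apply: eq_big_seq => a /hs[/hidx[j Qj ea] _] /=.
rewrite (bigD1 j) //= ea eqxx big1 ?addr0 // => j' /andP[_ njj'].
by rewrite (inj_eq inj) eq_sym (negbTE njj').
Qed.

(** Finite dimension of a subspace is expressed by its inclusion in some [fspan L]. The recursion
    peels off one generator at a time, which is the induction behind the orthogonal projection. *)
Fixpoint fspan (L : seq V) (v : V) : Prop :=
  if L is t :: L' then exists a, fspan L' (v - a *: t) else v = 0.

Lemma fspan_subspace L : subspace (fspan L).
Proof.
elim: L => [|t L [ih0 ih]] /=.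
  by split=> // a u v -> ->; rewrite scaler0 addr0.
split; first by exists 0; rewrite scale0r subr0.
move=> a u v [b hb] [c hc]; exists (a * b + c).
have -> : a *: u + v - (a * b + c) *: t = a *: (u - b *: t) + (v - c *: t).
  by rewrite scalerDl scalerBr scalerA; zmod.
exact: ih.
Qed.

End Subspaces.

Section Forms.
Variables (F : numClosedFieldType) (V : lmodType F).

(** A hermitian form, linear in the first argument and positive definite. All conditions are
    relative to [W], because the rescaled forms below are controlled on a subspace only. *)
Record pos_form (W : V -> Prop) (B : V -> V -> F) := PosForm {
  pos_formP : forall a u u' v, W u -> W u' -> W v ->
    B (a *: u + u') v = a * B u v + B u' v;
  pos_formC : forall u v, W u -> W v -> B v u = (B u v)^*;
  pos_form_gt0 : forall v, W v -> v != 0 -> 0 < B v v }.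

Section Theory.
Variables (W : V -> Prop) (B : V -> V -> F).
Hypotheses (sW : subspace W) (fB : pos_form W B).

Let W0 : W 0. Proof. by case: sW. Qed.

Lemma pformDl u u' v : W u -> W u' -> W v -> B (u + u') v = B u v + B u' v.
Proof. by move=> *; rewrite -[u]scale1r (pos_formP fB) // mul1r scale1r. Qed.

Lemma pform0l v : W v -> B 0 v = 0.
Proof.
by move=> Wv; apply: (addrI (B 0 v)); rewrite -pformDl // !addr0.
Qed.

Lemma pformZl a u v : W u -> W v -> B (a *: u) v = a * B u v.
Proof.
by move=> Wu Wv; rewrite -[a *: u]addr0 (pos_formP fB) // pform0l // addr0.
Qed.

Lemma pformNl u v : W u -> W v -> B (- u) v = - B u v.
Proof. by move=> *; rewrite -scaleN1r pformZl // mulN1r. Qed.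

Lemma pformBl u u' v : W u -> W u' -> W v -> B (u - u') v = B u v - B u' v.
Proof. by move=> *; rewrite pformDl ?pformNl //; apply: subspaceN. Qed.

Lemma pformMnl u k v : W u -> W v -> B (u *+ k) v = B u v *+ k.
Proof. by move=> *; rewrite -scaler_nat pformZl // mulr_natl. Qed.

Lemma pformDr u v v' : W u -> W v -> W v' -> B u (v + v') = B u v + B u v'.
Proof.
move=> *; rewrite (pos_formC fB) ?pformDl ?rmorphD //=; last exact: subspaceD.
by congr (_ + _); rewrite -(pos_formC fB).
Qed.

Lemma pformZr a u v : W u -> W v -> B u (a *: v) = a^* * B u v.
Proof.
move=> *; rewrite (pos_formC fB) ?pformZl ?rmorphM //=; last exact: subspaceZ.
by rewrite -(pos_formC fB).
Qed.

Lemma pform0r u : W u -> B u 0 = 0.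
Proof. by move=> *; rewrite (pos_formC fB) // pform0l // conjC0. Qed.

Lemma pformNr u v : W u -> W v -> B u (- v) = - B u v.
Proof. by move=> *; rewrite -scaleN1r pformZr // rmorphN1 mulN1r. Qed.

Lemma pformBr u v v' : W u -> W v -> W v' -> B u (v - v') = B u v - B u v'.
Proof. by move=> *; rewrite pformDr ?pformNr //; apply: subspaceN. Qed.

Lemma pformMnr u v k : W u -> W v -> B u (v *+ k) = B u v *+ k.
Proof. by move=> *; rewrite -scaler_nat pformZr // rmorph_nat mulr_natl. Qed.

Lemma pform_suml (I : eqType) (s : seq I) (P : pred I) (f : I -> V) v :
  (forall i, i \in s -> P i -> W (f i)) -> W v ->
  B (\sum_(i <- s | P i) f i) v = \sum_(i <- s | P i) B (f i) v.
Proof.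
move=> + Wv; elim: s => [|i s ih] h; first by rewrite !big_nil pform0l.
have hs j : j \in s -> P j -> W (f j) by move=> js; apply: h; rewrite inE js orbT.
rewrite !big_cons; case: ifP => // Pi; last exact: ih.
rewrite pformDl ?ih //; first by apply: h; rewrite ?mem_head.
exact: subspace_sum.
Qed.

Lemma pform_sumr (I : eqType) (s : seq I) (P : pred I) (f : I -> V) u :
  (forall i, i \in s -> P i -> W (f i)) -> W u ->
  B u (\sum_(i <- s | P i) f i) = \sum_(i <- s | P i) B u (f i).
Proof.
move=> h Wu; rewrite (pos_formC fB) ?pform_suml ?rmorph_sum //=; last exact: subspace_sum.
rewrite [LHS]big_seq_cond [RHS]big_seq_cond; apply: eq_bigr => i /andP[js Pi].
by rewrite -(pos_formC fB) //; apply: h.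
Qed.

Lemma pform_orthC u v : W u -> W v -> B u v = 0 -> B v u = 0.
Proof. by move=> Wu Wv h; rewrite (pos_formC fB) // h conjC0. Qed.

Lemma pform_eq0 v : W v -> B v v = 0 -> v = 0.
Proof.
move=> Wv h; apply/eqP; apply: contraT => /(pos_form_gt0 fB Wv).
by rewrite h ltxx.
Qed.

(* Gram-Schmidt. *)
Lemma orth_projection (L : seq V) (S : V -> Prop) : subspace S ->
  (forall v, S v -> W v) -> (forall v, S v -> fspan L v) ->
  forall v, W v -> exists2 u, S u & forall s, S s -> B (v - u) s = 0.
Proof.
elim: L S => [|t L ih] S sS SW SL v Wv /=.
  exists 0 => [|s /SL /= ->]; first by case: sS.
  by rewrite pform0r ?subr0.
have sL := fspan_subspace L.
pose S0 u := S u /\ fspan L u.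
have sS0 : subspace S0.
  split; first by split; [case: sS | case: sL].
  by move=> a u w [? ?] [? ?]; split; [case: sS | case: sL] => _; apply.
have S0W u : S0 u -> W u by case=> /SW.
have S0L u : S0 u -> fspan L u by case.
case: (classic (forall u, S u -> fspan L u)) => [h|]; first exact: (ih S).
move=> h; have [s0 h0] := not_all_ex_not _ _ h.
have [Ss0 nLs0] := imply_to_and _ _ h0.
have [u0 S0u0 orth0] := ih S0 sS0 S0W S0L s0 (SW _ Ss0).
pose s1 := s0 - u0.
have Ss1 : S s1 by apply: subspaceB => //; case: S0u0.
have Ws1 := SW _ Ss1.
have s1n0 : s1 != 0.
  by apply/eqP => /eqP; rewrite subr_eq0 => /eqP e; apply: nLs0; rewrite e; case: S0u0.
have Bs1 : B s1 s1 != 0 by rewrite gt_eqF // (pos_form_gt0 fB).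
have [a La] := SL _ Ss0.
have a0 : a != 0.
  by apply/eqP => a0; apply: nLs0; move: La; rewrite a0 scale0r subr0.
have decS s : S s -> exists c, S0 (s - c *: s1).
  move=> Ss; have [b Lb] := SL _ Ss; exists (b / a).
  have Sc : S (s - (b / a) *: s1) by apply: subspaceB => //; apply: subspaceZ.
  split=> //.
  have -> : s - (b / a) *: s1
      = (s - b *: t) - (b / a) *: (s0 - a *: t) + (b / a) *: u0.
    rewrite /s1 !scalerBr scalerA mulfVK //; zmod.
  apply: subspaceD => //; last by apply: subspaceZ => //; case: S0u0.
  by apply: subspaceB => //; apply: subspaceZ.
have [u1 S0u1 orth1] := ih S0 sS0 S0W S0L v Wv.
have Wu1 := S0W _ S0u1.
pose c := B v s1 / B s1 s1.
have Wc : W (c *: s1) by apply: subspaceZ.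
have Wvu : W (v - u1) by apply: subspaceB.
exists (u1 + c *: s1).
  by apply: subspaceD => //; [case: S0u1 | apply: subspaceZ].
have o0 s : S0 s -> B (v - (u1 + c *: s1)) s = 0.
  move=> Ss; have Ws := S0W _ Ss.
  by rewrite opprD addrA pformBl // orth1 // pformZl // orth0 // mulr0 subrr.
have o1 : B (v - (u1 + c *: s1)) s1 = 0.
  rewrite opprD addrA pformBl // pformZl // mulfVK // pformBl //.
  by rewrite (pform_orthC Ws1 Wu1 (orth0 _ S0u1)) // subr0 subrr.
move=> s Ss; have [d S0d] := decS s Ss.
have -> : s = (s - d *: s1) + d *: s1 by rewrite subrK.
have Wd : W (v - (u1 + c *: s1)) by apply: subspaceB => //; apply: subspaceD.
have Ws1d : W (d *: s1) by apply: subspaceZ.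
by rewrite (pformDr Wd (S0W _ S0d) Ws1d) o0 // pformZr // o1 mulr0 addr0.
Qed.

End Theory.

Lemma pos_form_sub (W W' : V -> Prop) B : (forall v, W' v -> W v) ->
  pos_form W B -> pos_form W' B.
Proof. by move=> h [p c g]; split; auto. Qed.

End Forms.

(** * Modules over gl with a contravariant form *)

Section ContravariantModule.
Variables (F : numClosedFieldType) (V : lmodType F) (m : nat).
Variable T : 'I_m -> 'I_m -> {linear V -> V}.
Hypothesis TT : forall i j a b v,
  T i j (T a b v) = T a b (T i j v) + T i b v *+ (j == a) - T a j v *+ (i == b).

Definition gl_inv (v : V) := forall s t : 'I_m, (t < s)%N -> T s t v = 0.

(** The module spanned from [xi] by lowering operators, given as an intersection of subspaces so
    that an induction on its elements is an application of the hypothesis. *)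
Definition low (xi v : V) := forall S : V -> Prop, subspace S -> S xi ->
  (forall (i j : 'I_m) u, (i < j)%N -> S u -> S (T i j u)) -> S v.

Lemma low_in xi : low xi xi. Proof. by []. Qed.

Lemma low_subspace xi : subspace (low xi).
Proof.
split; first by move=> S [].
by move=> a u v hu hv S hS *; apply: (subspaceL _ hS); [apply: hu | apply: hv].
Qed.

Lemma low_neg xi (i j : 'I_m) v : (i < j)%N -> low xi v -> low xi (T i j v).
Proof. by move=> ltij hv S sS Sxi hS; apply: (hS) => //; apply: hv. Qed.

(** The relations move any [T i j] past a lowering operator at the cost of other operators [T], so
    the induction carries the claim for all pairs of indices at once. It starts because [xi] is a
    highest weight vector. *)
Lemma low_stable xi i j v : gl_inv xi -> (forall a, exists w, T a a xi = w *: xi) ->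
  low xi v -> low xi (T i j v).
Proof.
move=> ixi wxi hv; have sL := low_subspace xi.
suff: low xi v /\ forall i j, low xi (T i j v) by case.
apply: (hv (fun v => low xi v /\ forall i j, low xi (T i j v))).
- split; first by split=> [|a b]; rewrite ?linear0; case: sL.
  move=> a u w [hu hu'] [hw hw']; split; first by apply: (subspaceL _ sL).
  by move=> b d; rewrite linearP; apply: (subspaceL _ sL).
- split=> // a b; have [ltab|ltba|/val_inj->] := ltngtP a b.
  + exact: low_neg.
  + by rewrite ixi //; case: sL.
  + by have [w ->] := wxi b; apply: (subspaceZ _ sL).
move=> a b u ltab [hu hu']; split; first exact: low_neg.
move=> c d; rewrite TT; apply: (subspaceB sL); last exact: (subspaceMn _ sL).
by apply: (subspaceD sL); [apply: low_neg | apply: (subspaceMn _ sL)].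
Qed.

Lemma low_map (A : {linear V -> V}) xi eta v : (exists c, A xi = c *: eta) ->
  (forall i j u, A (T i j u) = T i j (A u)) -> low xi v -> low eta (A v).
Proof.
move=> [c hA] AT hv; apply: (hv (fun v => low eta (A v))).
- split; first by rewrite linear0; case: (low_subspace eta).
  by move=> a u w hu hw; rewrite linearP; apply: (subspaceL _ (low_subspace eta)).
- by rewrite hA; apply: (subspaceZ _ (low_subspace eta)); apply: low_in.
by move=> i j u ltij hu; rewrite AT; apply: low_neg.
Qed.

(** Schur's lemma for a module generated by an eigenvector of [A]. *)
Lemma low_scalar (A : {linear V -> V}) xi c v : A xi = c *: xi ->
  (forall i j u, A (T i j u) = T i j (A u)) -> low xi v -> A v = c *: v.
Proof.
move=> hA AT hv; apply: (hv (fun v => A v = c *: v)) => //.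
- split; first by rewrite linear0 scaler0.
  by move=> a u w hu hw; rewrite linearP hu hw scalerDr !scalerA [a * c]mulrC.
by move=> i j u _ hu; rewrite AT hu linearZ.
Qed.

Variables (Fl : nat -> V -> Prop).
Hypotheses (FlE : forall v, exists d, Fl d v) (Fl0 : forall v, Fl 0 v -> v = 0)
  (FlT : forall d (s t : 'I_m) v, (t < s)%N -> Fl d.+1 v -> Fl d (T s t v)).

(** Every positive root vector lowers the filtration [Fl], so applying those that do not kill the
    vector must stop, and it stops at a singular vector. *)
Lemma exists_gl_inv (S : V -> Prop) :
  (forall (s t : 'I_m) v, (t < s)%N -> S v -> S (T s t v)) ->
  forall v, S v -> v != 0 -> exists f, [/\ S f, f != 0 & gl_inv f].
Proof.
move=> hS v Sv vn0; have [d hd] := FlE v.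
elim: d => [|d ih] in v Sv vn0 hd *; first by rewrite (Fl0 hd) eqxx in vn0.
case: (classic (gl_inv v)) => [|nv]; first by exists v.
have [s h1] := not_all_ex_not _ _ nv; have [t h2] := not_all_ex_not _ _ h1.
have [lts /eqP h3] := imply_to_and _ _ h2.
by apply: (ih (T s t v)) => //; [apply: hS | apply: FlT].
Qed.

Variables (W : V -> Prop) (B : V -> V -> F).
Hypotheses (sW : subspace W) (fB : pos_form W B)
  (TW : forall i j v, W v -> W (T i j v))
  (TB : forall i j u v, W u -> W v -> B (T i j u) v = B u (T j i v))
  (fdW : forall v, W v -> exists (N : V -> Prop) (L : seq V),
     [/\ subspace N, forall i j u, N u -> N (T i j u), N v,
         forall u, N u -> W u & forall u, N u -> fspan L u]).

Variables (I : eqType) (P : I -> Prop) (xi : I -> V) (w : I -> 'I_m -> F).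
Hypotheses (xiW : forall i, P i -> W (xi i))
  (xi_inv : forall i, P i -> gl_inv (xi i))
  (xi_n0 : forall i, P i -> xi i != 0)
  (xi_wt : forall i a, P i -> T a a (xi i) = w i a *: xi i)
  (xi_orth : forall i j, P i -> P j -> i != j -> B (xi i) (xi j) = 0)
  (inv_span : forall f, W f -> gl_inv f ->
     lspan (fun u => exists2 i, P i & u = xi i) f).

Local Notation Low i := (low (xi i)).

Lemma lowT i a b v : P i -> Low i v -> Low i (T a b v).
Proof.
move=> Pi; apply: low_stable; first exact: xi_inv.
by move=> c; exists (w i c); apply: xi_wt.
Qed.

Lemma lowW i v : P i -> Low i v -> W v.
Proof. by move=> Pi; apply=> //; [apply: xiW | move=> *; apply: TW]. Qed.

(** A lowering operator on the right becomes, on the left, a positive root vector that kills [xi i];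
    one on the left moves to the right, where the component is stable. Only the pairing of the two
    generators remains. *)
Lemma low_orth i j u v : P i -> P j -> i != j -> Low i u -> Low j v -> B u v = 0.
Proof.
move=> Pi Pj nij hu hv; have Wxi := xiW Pi.
have h1 v' : Low j v' -> B (xi i) v' = 0.
  move=> hv'; suff [] : W v' /\ B (xi i) v' = 0 by [].
  apply: (hv' (fun v => W v /\ B (xi i) v = 0)).
  - split; first by split; [case: sW | apply: (pform0r sW fB)].
    move=> a y z [Wy y0] [Wz z0]; split; first by apply: (subspaceL _ sW).
    rewrite (pformDr sW fB) ?(pformZr sW fB) ?y0 ?z0 ?mulr0 ?addr0 //.
    exact: subspaceZ.
  - by split; [apply: xiW | apply: xi_orth].
  move=> a b y ltab [Wy y0]; split; first exact: TW.
  by rewrite -TB // xi_inv // (pform0l sW fB).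
suff [] : W u /\ forall v', Low j v' -> B u v' = 0 by move=> _; apply.
apply: (hu (fun u => W u /\ forall v', Low j v' -> B u v' = 0)) => //.
- split; first by split=> [|v' /(lowW Pj) Wv']; [case: sW | rewrite (pform0l sW fB)].
  move=> a y z [Wy y0] [Wz z0]; split; first by apply: (subspaceL _ sW).
  move=> v' hv'; have Wv' := lowW Pj hv'.
  by rewrite (pos_formP fB) // y0 // z0 // mulr0 addr0.
move=> a b y _ [Wy y0]; split; first exact: TW.
by move=> v' hv'; rewrite TB ?y0 //; [apply: lowT | apply: (lowW Pj)].
Qed.

(** Subtract from [f] its projection on [xi i]. The difference is orthogonal to [xi i], and to the
    image of every lowering operator because the adjoint kills it. It lies in the component, so it
    is orthogonal to itself. *)
Lemma low_inv i f : P i -> Low i f -> gl_inv f -> exists c, f = c *: xi i.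
Proof.
move=> Pi hf invf; have Wxi := xiW Pi; have Wf := lowW Pi hf.
pose c := B f (xi i) / B (xi i) (xi i); exists c.
have Bxi : B (xi i) (xi i) != 0 by rewrite gt_eqF // (pos_form_gt0 fB) // xi_n0.
have Lg : Low i (f - c *: xi i).
  by apply: (subspaceB (low_subspace _)) => //; apply: (subspaceZ _ (low_subspace _)).
have Wg := lowW Pi Lg.
suff /(pform_eq0 fB Wg)/eqP : B (f - c *: xi i) (f - c *: xi i) = 0.
  by rewrite subr_eq0 => /eqP.
suff h v : Low i v -> W v /\ B (f - c *: xi i) v = 0 by case: (h _ Lg).
move=> hv; apply: (hv (fun v => W v /\ B (f - c *: xi i) v = 0)).
- split; first by split; [case: sW | apply: (pform0r sW fB)].
  move=> a y z [Wy y0] [Wz z0]; split; first by apply: (subspaceL _ sW).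
  rewrite (pformDr sW fB) ?(pformZr sW fB) ?y0 ?z0 ?mulr0 ?addr0 //.
  exact: subspaceZ.
- split=> //; rewrite (pformBl sW fB) ?(pformZl sW fB) ?mulfVK ?subrr //.
  exact: subspaceZ.
move=> a b y ltab [Wy y0]; split; first exact: TW.
rewrite -TB // linearB linearZ /= invf // xi_inv //.
by rewrite scaler0 subr0 (pform0l sW fB).
Qed.

(** A nonzero submodule contains a singular vector, which is a multiple of [xi i]. Stability is
    asked for [a != b], which is what an sl-submodule provides directly. *)
Lemma low_irreducible i (S : V -> Prop) v : P i -> subspace S ->
  (forall a b u, a != b -> S u -> S (T a b u)) -> (forall u, S u -> Low i u) ->
  S v -> v != 0 -> forall u, Low i u -> S u.
Proof.
move=> Pi sS TS SL Sv vn0 u hu.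
have [|f [Sf fn0 invf]] := @exists_gl_inv S _ v Sv vn0.
  by move=> s t y lts; apply: TS; rewrite -val_eqE /= gtn_eqF.
have [c hc] := low_inv Pi (SL f Sf) invf.
apply: hu => //; last first.
  by move=> a b y ltab; apply: TS; rewrite -val_eqE /= ltn_eqF.
have c0 : c != 0 by apply: contraNneq fn0 => c0; rewrite hc c0 scale0r.
by rewrite -[xi i]scale1r -(mulVf c0) -scalerA -hc; apply: subspaceZ.
Qed.

Definition low_sum := lspan (fun u => exists2 i, P i & Low i u).

Lemma low_sum_subspace : subspace low_sum. Proof. exact: lspan_subspace. Qed.

Lemma low_sumT a b v : low_sum v -> low_sum (T a b v).
Proof.
have sL := low_sum_subspace.
apply: (lspan_min (W := fun v => low_sum (T a b v))).
  split; first by rewrite linear0; case: sL.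
  by move=> c y z hy hz; rewrite linearP; apply: (subspaceL _ sL).
by move=> u [i Pi hu]; apply: lspan_in; exists i => //; apply: lowT.
Qed.

(** Inside a finite-dimensional submodule, remove from [v] its projection on the sum of the
    components. If something remained, the orthogonal complement, stable by adjunction, would
    contain a singular vector; by [inv_span] that vector also lies in the sum, hence is orthogonal
    to itself. *)
Theorem low_decomposition v : W v -> low_sum v.
Proof.
move=> Wv; have [N [L [sN TN Nv NW NL]]] := fdW Wv.
have sL := low_sum_subspace.
pose S u := N u /\ low_sum u.
have sS : subspace S.
  split; first by split; [case: sN | case: sL].
  by move=> a y z [? ?] [? ?]; split; [apply: (subspaceL _ sN) | apply: (subspaceL _ sL)].
have TS a b u : S u -> S (T a b u).
  by case=> Nu Lu; split; [apply: TN | apply: low_sumT].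
have [||u [Nu Lu] hu] := orth_projection sW fB (L := L) sS _ _ Wv.
- by move=> u [/NW].
- by move=> u [/NL].
case: (eqVneq (v - u) 0) => [/eqP|n0].
  by rewrite subr_eq0 => /eqP ->.
pose S' y := N y /\ forall s, S s -> B y s = 0.
have [||f [[Nf Of] fn0 invf]] := @exists_gl_inv S' _ (v - u) _ n0.
- move=> a b y _ [Ny Oy]; split; first exact: TN.
  move=> s Ss; rewrite TB ?Oy //; [exact: TS | exact: NW | by case: Ss => /NW].
- by split=> //; apply: subspaceB.
have Lf : low_sum f.
  apply: (lspan_min low_sum_subspace) (inv_span (NW _ Nf) invf).
  by move=> _ [i Pi ->]; apply: lspan_in; exists i => //; apply: low_in.
by rewrite (pform_eq0 fB (NW _ Nf) (Of f (conj Nf Lf))) eqxx in fn0.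
Qed.

Lemma low_decomposition_seq v : W v -> exists2 s : seq (I * V),
  (forall a, a \in s -> P a.1 /\ Low a.1 a.2) & v = \sum_(a <- s) a.2.
Proof.
by move=> /low_decomposition; apply: lspan_indexed => i; apply: low_subspace.
Qed.

Lemma low_sep u v : W u -> W v ->
  (forall i y, P i -> Low i y -> B y u = B y v) -> u = v.
Proof.
move=> Wu Wv h; have Wd : W (u - v) by apply: subspaceB.
apply/eqP; rewrite -subr_eq0; apply/eqP/(pform_eq0 fB Wd).
suff [] : W (u - v) /\ B (u - v) (u - v) = 0 by [].
apply: (lspan_min (W := fun y => W y /\ B y (u - v) = 0)) (low_decomposition Wd).
  split; first by split; [case: sW | rewrite (pform0l sW fB)].
  move=> a y z [Wy y0] [Wz z0]; split; first by apply: (subspaceL _ sW).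
  by rewrite (pos_formP fB) // y0 z0 mulr0 addr0.
move=> y [i Pi Ly]; have Wy := lowW Pi Ly; split=> //.
by rewrite (pformBr sW fB) // (h i) // subrr.
Qed.

Section Rescale.
Variable delta : I -> F.
Hypothesis delta_gt0 : forall i, P i -> 0 < delta i.

(** The vector sought multiplies the part of [v] of index i by [delta i]. It is characterised by
    pairings, which do not depend on the chosen decomposition of [v]. *)
Lemma rescale_ex v : exists v', W v -> W v' /\
  forall i u, P i -> Low i u -> B u v' = delta i * B u v.
Proof.
case: (classic (W v)) => [Wv|]; last by exists 0.
have [s hs ->] := low_decomposition_seq Wv.
have Ws a : a \in s -> W a.2 by move=> /hs[Pa]; apply: lowW.
exists (\sum_(a <- s) delta a.1 *: a.2) => _; split.
  by apply: subspace_sum => // a /Ws Wa _; apply: subspaceZ.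
move=> i u Pi Lu; have Wu := lowW Pi Lu.
have Wd a : a \in s -> true -> W (delta a.1 *: a.2).
  by move=> /Ws Wa _; apply: subspaceZ.
have Ws' a : a \in s -> true -> W a.2 by move=> /Ws.
rewrite (pform_sumr sW fB Wd Wu) (pform_sumr sW fB Ws' Wu) mulr_sumr.
apply: eq_big_seq => a sa; have [Pa La] := hs a sa.
rewrite (pformZr sW fB _ Wu (Ws a sa)); have [->|nai] := eqVneq i a.1.
  by rewrite geC0_conj // ltW // delta_gt0.
by rewrite (low_orth Pi Pa) // !mulr0.
Qed.

Definition rescale v := proj1_sig (constructive_indefinite_description _ (rescale_ex v)).

Lemma rescaleW v : W v -> W (rescale v).
Proof. by rewrite /rescale; case: constructive_indefinite_description => /= x h /h[]. Qed.

Lemma rescaleP i u v : W v -> P i -> Low i u -> B u (rescale v) = delta i * B u v.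
Proof.
by rewrite /rescale; case: constructive_indefinite_description => /= x h /h[_]; apply.
Qed.

Lemma rescale_linear a u v : W u -> W v -> rescale (a *: u + v) = a *: rescale u + rescale v.
Proof.
move=> Wu Wv; have Wuv : W (a *: u + v) by apply: (subspaceL _ sW).
have Wr := rescaleW; apply: low_sep; [exact: Wr| |].
  by apply: (subspaceL _ sW); apply: Wr.
move=> i y Pi Ly; have Wy := lowW Pi Ly; rewrite (rescaleP (i := i)) //.
rewrite !(pformDr sW fB) ?(pformZr sW fB) ?(rescaleP (i := i)) //; try exact: Wr.
- by rewrite mulrDr mulrCA.
- by apply: subspaceZ => //; apply: Wr.
- exact: subspaceZ.
Qed.

Lemma rescale_low i v : P i -> Low i v -> rescale v = delta i *: v.
Proof.
move=> Pi Lv; have Wv := lowW Pi Lv; apply: low_sep; [exact: rescaleW| |].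
  exact: subspaceZ.
move=> j y Pj Ly; have Wy := lowW Pj Ly; rewrite (rescaleP (i := j)) //.
rewrite (pformZr sW fB) // geC0_conj; last by rewrite ltW // delta_gt0.
by have [->//|nij] := eqVneq i j; rewrite (low_orth Pj Pi) ?mulr0 // eq_sym.
Qed.

(** Rescaling both arguments keeps positivity evident and multiplies the form by [delta i ^+ 2] on
    the component of index i; the factors used later are therefore square roots. *)
Definition rescaled_form u v := B (rescale u) (rescale v).

Lemma rescaled_pos_form : pos_form W rescaled_form.
Proof.
have Wr := rescaleW; split.
- move=> a u u' v Wu Wu' Wv.
  by rewrite /rescaled_form rescale_linear // (pos_formP fB) //; apply: Wr.
- by move=> u v Wu Wv; apply: (pos_formC fB); apply: Wr.
move=> v Wv vn0; apply: (pos_form_gt0 fB); first exact: Wr.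
apply: contraNneq vn0 => r0; apply/eqP; apply: low_sep => //; first by case: sW.
move=> i y Pi Ly; have Wy := lowW Pi Ly; rewrite (pform0r sW fB) //.
have := rescaleP Wv Pi Ly; rewrite r0 (pform0r sW fB) // => /esym/eqP.
by rewrite mulf_eq0 gt_eqF ?delta_gt0 //= => /eqP.
Qed.

(** By sesquilinearity both arguments may be taken in single components. There one rescaling is a
    scalar and the other passes through the pairing with the same scalar, whence the two squares. *)
Lemma rescaled_adjoint (A A' : {linear V -> V}) :
  (forall v, W v -> W (A v)) -> (forall v, W v -> W (A' v)) ->
  (forall i j u v, P i -> P j -> Low i u -> Low j v ->
     delta j ^+ 2 * B (A u) v = delta i ^+ 2 * B u (A' v)) ->
  forall u v, W u -> W v -> rescaled_form (A u) v = rescaled_form u (A' v).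
Proof.
move=> AW AW' h u v Wu Wv; have fR := rescaled_pos_form.
have low_case i j y z : P i -> P j -> Low i y -> Low j z ->
    rescaled_form (A y) z = rescaled_form y (A' z).
  move=> Pi Pj Ly Lz; have Wy := lowW Pi Ly; have Wz := lowW Pj Lz.
  have di : (delta i)^* = delta i by rewrite geC0_conj // ltW // delta_gt0.
  have dj : (delta j)^* = delta j by rewrite geC0_conj // ltW // delta_gt0.
  have WAy := AW _ Wy; have WAz := AW' _ Wz.
  rewrite /rescaled_form (rescale_low Pj Lz) (rescale_low Pi Ly).
  rewrite (pformZr sW fB) ?(pformZl sW fB) //; try exact: rescaleW.
  rewrite (rescaleP (i := i)) // (pos_formC fB) ?(rescaleP (i := j)) //; last exact: rescaleW.
  rewrite rmorphM /= -(pos_formC fB) // dj !mulrA -!expr2; exact: h Ly Lz.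
have sub1 z : W z -> subspace (fun y => W y /\ rescaled_form (A y) z = rescaled_form y (A' z)).
  move=> Wz; split.
    by split; [case: sW | rewrite linear0 !(pform0l sW fR) //; apply: AW'].
  move=> a y y' [Wy ey] [Wy' ey']; split; first by apply: (subspaceL _ sW).
  rewrite linearP !(pos_formP fR) ?ey ?ey' //; by [apply: AW'|apply: AW|apply: AW].
have sub2 y : W y -> subspace (fun z => W z /\ rescaled_form (A y) z = rescaled_form y (A' z)).
  move=> Wy; have WAy := AW _ Wy; split.
    by split; [case: sW | rewrite linear0 !(pform0r sW fR)].
  move=> a z z' [Wz ez] [Wz' ez']; split; first by apply: (subspaceL _ sW).
  have WAz := AW' _ Wz; have WAz' := AW' _ Wz'.
  rewrite linearP !(pformDr sW fR) ?(pformZr sW fR) ?ez ?ez' //; exact: subspaceZ.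
suff [] : W u /\ rescaled_form (A u) v = rescaled_form u (A' v) by [].
apply: (lspan_min (sub1 v Wv)) (low_decomposition Wu) => y [i Pi Ly].
have Wy := lowW Pi Ly; split=> //.
suff [] : W v /\ rescaled_form (A y) v = rescaled_form y (A' v) by [].
apply: (lspan_min (sub2 y Wy)) (low_decomposition Wv) => z [j Pj Lz].
by split; [apply: (lowW Pj) | apply: (low_case i j)].
Qed.

End Rescale.

End ContravariantModule.

(** * The variables and their exponents *)

Section Vars.
Variables (F : numClosedFieldType) (n : nat).
Local Notation N := 'C(n.+1, 2).
Local Notation P := {mpoly F[N]}.
Local Notation x := (@x F n).
Local Notation dx := (@dx F n).

Definition valid i j := [&& 1 <= j, j <= i & i <= n]%N.

Lemma binS2 i : 'C(i.+1, 2) = ('C(i, 2) + i)%N.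
Proof. by rewrite binS bin1 addnC. Qed.

Lemma leq_bin2 i j : (i <= j)%N -> ('C(i, 2) <= 'C(j, 2))%N.
Proof.
move=> /subnKC <-; elim: (j - i)%N => [|d ih]; first by rewrite addn0.
by rewrite addnS binS2 (leq_trans ih) ?leq_addr.
Qed.

Lemma var_idxP i j : valid i j -> exists v, var_idx n i j = Some v.
Proof.
case/and3P=> j1 ji iN; rewrite /var_idx j1 ji /=.
have lt : ('C(i, 2) + j.-1 < N)%N.
  by apply: leq_trans (leq_bin2 (i := i.+1) (j := n.+1) iN); rewrite binS2; lia.
by exists (Ordinal lt); rewrite insubT.
Qed.

Lemma var_idx_val i j v : var_idx n i j = Some v ->
  valid i j /\ val v = ('C(i, 2) + j.-1)%N.
Proof.
rewrite /var_idx; case: ifP => // /andP[j1 ji].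
case: insubP => // u _ hu [<-]; split=> //; rewrite /valid j1 ji /= leqNgt.
apply/negP => ni; have := leq_trans (ltn_ord u) (leq_bin2 ni); rewrite hu; lia.
Qed.

Lemma var_idx_inj i j i' j' v : var_idx n i j = Some v ->
  var_idx n i' j' = Some v -> i = i' /\ j = j'.
Proof.
move=> /var_idx_val[/and3P[j1 ji iN] e'] /var_idx_val[/and3P[j1' ji' iN']].
rewrite e' => {e'} e.
have ii : i = i'.
  case: (ltngtP i i') => // lt.
    by have := leq_bin2 lt; rewrite binS2 => ?; lia.
  by have := leq_bin2 lt; rewrite binS2 => ?; lia.
by split=> //; move: e; rewrite ii; lia.
Qed.

Lemma var_idx_surj v : exists i j, var_idx n i j = Some v.
Proof.
have [i /andP[iN lo]] : exists i, (1 <= i <= n)%N && ('C(i, 2) <= v < 'C(i.+1, 2))%N.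
  have := ltn_ord v; move: (val v) => {}v.
  elim: (n) => [|q ih] // lt.
  case: (ltnP v 'C(q.+1, 2)) => [/ih[i /andP[/andP[i1 iq] h]]|ge].
    by exists i; rewrite i1 h (leqW iq).
  by exists q.+1; rewrite ge lt leqnn.
exists i, (v - 'C(i, 2)).+1%N.
have [w hw] : exists w, var_idx n i (v - 'C(i, 2)).+1 = Some w.
  apply: var_idxP; move: iN lo; rewrite /valid; move: (nat_of_ord v) => u.
  by rewrite binS2; lia.
rewrite hw; congr Some; apply: val_inj; have [_ ->] := var_idx_val hw.
by case/andP: lo => lo _; rewrite /= subnKC.
Qed.

(** The default value is never reached, since every variable has a position in the triangle. *)
Definition rowcol (v : 'I_N) : nat * nat :=
  if [pick p : 'I_n.+1 * 'I_n.+1 | var_idx n p.1 p.2 == Some v] is Some p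
  then (val p.1, val p.2) else (0, 0)%N.
Definition row v := (rowcol v).1.
Definition col v := (rowcol v).2.

Lemma rowcolP v : var_idx n (row v) (col v) = Some v.
Proof.
rewrite /row /col /rowcol; case: pickP => [p /eqP //|h].
have [i [j hij]] := var_idx_surj v.
have [/and3P[j1 ji iN] _] := var_idx_val hij.
have lti : (i < n.+1)%N by [].
have ltj : (j < n.+1)%N by apply: leq_ltn_trans lti.
by have /= := h (Ordinal lti, Ordinal ltj); rewrite hij eqxx.
Qed.

Lemma rowcol_valid v : valid (row v) (col v).
Proof. by case: (var_idx_val (rowcolP v)). Qed.

Lemma rowcolE i j v : var_idx n i j = Some v -> row v = i /\ col v = j.
Proof. by move=> h; have [-> ->] := var_idx_inj (rowcolP v) h. Qed.

Definition expo (mu : 'X_{1..N}) i j : nat := if var_idx n i j is Some v then mu v else 0.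
Definition uexp i j : 'X_{1..N} := if var_idx n i j is Some v then U_(v)%MM else 0%MM.

Lemma expo_rowcol mu v : expo mu (row v) (col v) = mu v.
Proof. by rewrite /expo rowcolP. Qed.

Lemma expoP mu nu : (forall i j, valid i j -> expo mu i j = expo nu i j) -> mu = nu.
Proof.
by move=> h; apply/mnmP => v; rewrite -!expo_rowcol h // rowcol_valid.
Qed.

Lemma expo_invalid mu i j : ~~ valid i j -> expo mu i j = 0%N.
Proof.
by rewrite /expo; case E: var_idx => [v|] //; have [-> ] := var_idx_val E.
Qed.

Lemma expoD mu nu i j : expo (mu + nu)%MM i j = (expo mu i j + expo nu i j)%N.
Proof. by rewrite /expo; case: var_idx => [v|] //; rewrite mnmDE. Qed.

Lemma expo0 i j : expo 0%MM i j = 0%N.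
Proof. by rewrite /expo; case: var_idx => [v|] //; rewrite mnm0E. Qed.

Lemma expo_uexp i j a b : expo (uexp i j) a b = [&& valid i j, i == a & j == b].
Proof.
rewrite /expo /uexp; case Ei: (var_idx n i j) => [v|]; last first.
  case: (boolP (valid i j)) => [/var_idxP[v]|_]; first by rewrite Ei.
  by case: var_idx => // w; rewrite mnm0E.
have [-> _] := var_idx_val Ei.
case Ea: (var_idx n a b) => [w|] /=.
  rewrite mnm1E; congr nat_of_bool; apply/eqP/andP => [e|[/eqP ei /eqP ej]].
    by move: Ei; rewrite e => Ei; have [-> ->] := var_idx_inj Ei Ea.
  by move: Ei; rewrite ei ej Ea => -[].
case: (boolP ((i == a) && (j == b))) => // /andP[/eqP ei /eqP ej].
by move: Ei; rewrite ei ej Ea.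
Qed.

Lemma dx_linear i j : linear (dx i j).
Proof.
rewrite /Defs.dx; case: var_idx => [v|] a p q; first by rewrite linearP.
by rewrite scaler0 addr0.
Qed.
HB.instance Definition _ i j := GRing.isLinear.Build F P P *:%R (dx i j) (dx_linear i j).

Lemma dxD i j p q : dx i j (p + q) = dx i j p + dx i j q. Proof. exact: linearD. Qed.
Lemma dxB i j p q : dx i j (p - q) = dx i j p - dx i j q. Proof. exact: linearB. Qed.
Lemma dxN i j p : dx i j (- p) = - dx i j p. Proof. exact: linearN. Qed.
Lemma dxZ i j a p : dx i j (a *: p) = a *: dx i j p. Proof. exact: linearZ. Qed.

Definition mulx i j (p : P) := x i j * p.
Lemma mulx_linear i j : linear (mulx i j).
Proof. by move=> a p q; rewrite /mulx mulrDr scalerAr. Qed.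
HB.instance Definition _ i j := GRing.isLinear.Build F P P *:%R (mulx i j) (mulx_linear i j).

Lemma dxM i j p q : dx i j (p * q) = dx i j p * q + p * dx i j q.
Proof.
rewrite /Defs.dx; case: var_idx => [v|]; first exact: mderivM.
by rewrite mul0r mulr0 addr0.
Qed.

Lemma dxC i j c : dx i j c%:MP = 0.
Proof. by rewrite /Defs.dx; case: var_idx => // v; exact: mderivC. Qed.

Lemma dx1 i j : dx i j 1 = 0.
Proof. by rewrite -mpolyC1 dxC. Qed.

Lemma dx_comm i j a b p : dx i j (dx a b p) = dx a b (dx i j p).
Proof.
rewrite /Defs.dx; case: (var_idx n i j) => [v|]; case: (var_idx n a b) => [w|] //.
- exact: mderiv_comm.
- exact: mderiv0.
by rewrite mderiv0.
Qed.

Lemma dx_invalid i j p : ~~ valid i j -> dx i j p = 0.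
Proof.
by rewrite /Defs.dx; case E: var_idx => [v|] //; have [-> ] := var_idx_val E.
Qed.

Lemma x_validE i j : valid i j -> x i j = 'X_[uexp i j].
Proof. by move=> /var_idxP[v e]; rewrite /Defs.x /uexp e. Qed.

Lemma x_sup i : x i i.+1 = -1.
Proof.
rewrite /Defs.x; case E: var_idx => [v|]; last by rewrite eqxx.
by have [/and3P[_]] := var_idx_val E; rewrite ltnn.
Qed.

Lemma x_sup_pred j : (0 < j)%N -> x j.-1 j = -1.
Proof. by case: j => // j _; apply: x_sup. Qed.

Lemma x_zero i j : (i.+1 < j)%N -> x i j = 0.
Proof.
move=> lt; rewrite /Defs.x; case E: var_idx => [v|]; last by rewrite gtn_eqF.
by have [/and3P[_ ? _]] := var_idx_val E; lia.
Qed.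

Lemma mcoeff_dx i j p mu : valid i j ->
  (dx i j p)@_mu = p@_(mu + uexp i j) *+ (expo mu i j).+1.
Proof.
by move=> /var_idxP[v e]; rewrite /Defs.dx /uexp /expo e mcoeff_deriv.
Qed.

Lemma dx_x i j a b : dx i j (x a b) = [&& valid i j, i == a & j == b]%:R.
Proof.
case: (boolP (valid i j)) => [vij|/dx_invalid -> //].
case: (boolP (valid a b)) => vab; last first.
  have -> : [&& true, i == a & j == b] = false.
    apply/negbTE; apply: contra vab => /and3P[_ /eqP <- /eqP <-] //.
  rewrite /Defs.x; case E: var_idx => [v|].
    by case/negP: vab; case: (var_idx_val E).
  by case: ifP => _; [rewrite linearN /= dx1 oppr0 | rewrite linear0].
apply/mpolyP => mu; rewrite mcoeff_dx // x_validE // mcoeffX.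
case: (boolP ((i == a) && (j == b))) => [/andP[/eqP -> /eqP ->]|nij] /=.
  rewrite mulr1n mcoeff1; have -> : (uexp a b == (mu + uexp a b)%MM) = (mu == 0%MM).
    by rewrite -{1}[uexp a b]add0m eqm_add2r eq_sym.
  by case: eqP => [->|_]; rewrite ?expo0 ?mul0rn.
rewrite mcoeff0 (_ : _ == _ = false) ?mul0rn //; apply/eqP => e.
have := congr1 (fun m => expo m i j) e; rewrite expoD !expo_uexp vij !eqxx vab /=.
by rewrite [a == i]eq_sym [b == j]eq_sym (negbTE nij) addn1.
Qed.

Lemma dx_xM i j a b p : dx i j (x a b * p)
  = x a b * dx i j p + p *+ [&& valid i j, i == a & j == b].
Proof. by rewrite dxM dx_x mulr_natl addrC. Qed.

Lemma mcoeff_xM i j p mu : valid i j ->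
  (x i j * p)@_(mu + uexp i j) = p@_mu.
Proof. by move=> v; rewrite x_validE // mulrC addmC mcoeffMX. Qed.

Lemma mcoeff_xM0 i j p mu : valid i j -> expo mu i j = 0%N -> (x i j * p)@_mu = 0.
Proof.
move=> v e0; apply: memN_msupp_eq0; rewrite x_validE // mulrC.
apply/negP; rewrite (perm_mem (msuppMX _ _)) => /mapP[nu _ emu].
by move: e0; rewrite emu expoD expo_uexp v !eqxx.
Qed.

Lemma expo_split i j mu : valid i j -> (0 < expo mu i j)%N ->
  exists nu, mu = (nu + uexp i j)%MM.
Proof.
move=> /var_idxP[v e]; rewrite /expo /uexp e => gt0.
by exists (mu - U_(v))%MM; rewrite submK // lep1mP -lt0n.
Qed.

Lemma dx_mpolyX i j mu : valid i j -> dx i j 'X_[mu + uexp i j]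
  = (expo mu i j).+1%:R *: 'X_[mu].
Proof.
move=> /var_idxP[v e]; rewrite /Defs.dx /uexp /expo e mderivX addmK.
by rewrite mnmDE mnm1E eqxx addn1.
Qed.

Lemma dx_mpolyX0 i j mu : expo mu i j = 0%N -> dx i j 'X_[mu] = 0.
Proof.
rewrite /Defs.dx /expo; case: var_idx => [v|] // e.
by rewrite mderivX e scale0r.
Qed.

Lemma xdx_mpolyX i j mu : x i j * dx i j 'X_[mu] = (expo mu i j)%:R *: 'X_[mu].
Proof.
case: (boolP (valid i j)) => v; last first.
  by rewrite dx_invalid // mulr0 expo_invalid // scale0r.
case: (posnP (expo mu i j)) => [e|/(expo_split v)[nu ->]].
  by rewrite dx_mpolyX0 // e mulr0 scale0r.
rewrite dx_mpolyX // expoD expo_uexp v !eqxx addn1 -scalerAr x_validE // mulrC.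
by rewrite -mpolyXD.
Qed.

Lemma linear_ext (f g : {linear P -> P}) : (forall mu, f 'X_[mu] = g 'X_[mu]) -> f =1 g.
Proof.
move=> h p; rewrite [p]mpolyE !linear_sum; apply: eq_bigr => mu _.
by rewrite !linearZ /= h.
Qed.

End Vars.

(** * The action of gl and the row operations *)

Section Ops.
Variables (F : numClosedFieldType) (n : nat) (k : nat -> nat).
Local Notation N := 'C(n.+1, 2).
Local Notation P := {mpoly F[N]}.
Local Notation x := (@x F n).
Local Notation dx := (@dx F n).
Local Notation euler := (@euler F n).
Local Notation c := (@c F n k).

Lemma big_ord1 (V : zmodType) m (f : nat -> V) :
  \sum_(1 <= r < m.+1) f r = \sum_(r < m) f r.+1.
Proof. by rewrite big_add1 big_mkord. Qed.

Lemma eulerE m p : euler m p = \sum_(s < m) x m s.+1 * dx m s.+1 p.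
Proof. exact: big_ord1. Qed.

Lemma euler_linear m : linear (euler m).
Proof.
move=> a p q; rewrite !eulerE scaler_sumr -big_split; apply: eq_bigr => s _ /=.
by rewrite linearP mulrDr scalerAr.
Qed.
HB.instance Definition _ m := GRing.isLinear.Build F P P *:%R (euler m) (euler_linear m).

(* The action of E_{i,j} of gl(m) on C_{m-1} *)
Fixpoint glact m i j (p : P) : P :=
  if m is m'.+1 then
    if (i <= m')%N then
      if (j <= m')%N then
        x m' i * dx m' j p + glact m' i j p + ((c m / m%:R) *: p) *+ (i == j)
      else x m' i * euler m' p + c m' *: (x m' i * p)
           + \sum_(1 <= r < m'.+1) x m' r * glact m' i r p
    else if (j <= m')%N then - dx m' j p
    else (c m / m%:R - c m') *: p - euler m' p
  else 0.

Lemma glact_linear m i j : linear (glact m i j).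
Proof.
elim: m i j => [|m ih] i j a p q /=; first by rewrite scaler0 addr0.
case: ifP => _; case: ifP => _.
- rewrite linearP /= ih !(mulrDr, scalerDr, mulrnDl, scalerMnr) !scalerA.
  by rewrite [a * (c _ / _)]mulrC !scalerAr; zmod.
- rewrite [euler m _]linearP /= !big_ord1.
  have -> : \sum_(r < m) x m r.+1 * glact m i r.+1 (a *: p + q)
    = a *: (\sum_(r < m) x m r.+1 * glact m i r.+1 p)
      + \sum_(r < m) x m r.+1 * glact m i r.+1 q.
    rewrite scaler_sumr -big_split; apply: eq_bigr => r _ /=.
    by rewrite ih mulrDr scalerAr.
  rewrite !(mulrDr, scalerDr) -!scalerAr !scalerA [a * c m]mulrC; zmod.
- by rewrite linearP opprD scalerN.
rewrite [euler m _]linearP /= !scalerDr !scalerN !scalerA [a * (_ - _)]mulrC; zmod.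
Qed.
HB.instance Definition _ m i j :=
  GRing.isLinear.Build F P P *:%R (glact m i j) (glact_linear m i j).

(** The action of gl(m) on C_m as a tensor product of the polynomials in row m with C_{m-1}. It
    differs from [glact m.+1] by the scalar that fixes the trace. *)
Definition tact m i j (p : P) := x m i * dx m j p + glact m i j p.

Lemma tact_linear m i j : linear (tact m i j).
Proof.
by move=> a p q; rewrite /tact !linearP /= mulrDr scalerDr scalerAr addrACA.
Qed.
HB.instance Definition _ m i j :=
  GRing.isLinear.Build F P P *:%R (tact m i j) (tact_linear m i j).

Lemma dx_xM_row l a m i p : l != m -> dx l a (x m i * p) = x m i * dx l a p.
Proof. by move=> /negbTE nlm; rewrite dx_xM nlm andbF mulr0n addr0. Qed.

Lemma euler_x_row l a m p : l != m -> euler m (x l a * p) = x l a * euler m p.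
Proof.
move=> nlm; rewrite !eulerE mulr_sumr; apply: eq_bigr => s _.
by rewrite dx_xM_row 1?eq_sym // mulrCA.
Qed.

Lemma euler_dx_row l a m p : l != m -> euler m (dx l a p) = dx l a (euler m p).
Proof.
move=> nlm; rewrite !eulerE linear_sum; apply: eq_bigr => s _ /=.
by rewrite dx_xM_row // dx_comm.
Qed.

Lemma glact_x m i j l a p : (m <= l)%N ->
  glact m i j (x l a * p) = x l a * glact m i j p.
Proof.
elim: m i j p => [|m ih] i j p lml /=; first by rewrite mulr0.
have nml : m != l by rewrite ltn_eqF.
have nlm : l != m by rewrite eq_sym.
case: ifP => _; case: ifP => _.
- rewrite dx_xM_row // ih 1?ltnW // !mulrDr mulrnAr -scalerAr.
  by rewrite [x l a * (x m i * _)]mulrCA.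
- have -> : \sum_(1 <= r < m.+1) x m r * glact m i r (x l a * p)
      = x l a * \sum_(1 <= r < m.+1) x m r * glact m i r p.
    rewrite [RHS]mulr_sumr; apply: eq_bigr => r _.
    by rewrite ih 1?ltnW // mulrCA.
  by rewrite euler_x_row // !mulrDr -scalerAr ![x l a * (x m i * _)]mulrCA.
- by rewrite dx_xM_row // mulrN.
by rewrite euler_x_row // mulrBr -scalerAr.
Qed.

Lemma glact_dx m i j l a p : (m <= l)%N ->
  glact m i j (dx l a p) = dx l a (glact m i j p).
Proof.
elim: m i j p => [|m ih] i j p lml /=; first by rewrite linear0.
have nml : m != l by rewrite ltn_eqF.
have nlm : l != m by rewrite eq_sym.
case: ifP => _; case: ifP => _.
- rewrite !dxD [dx l a (_ *+ _)]raddfMn /= dxZ dx_xM_row // ih 1?ltnW //.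
  by rewrite [dx m _ _]dx_comm.
- have -> : \sum_(1 <= r < m.+1) x m r * glact m i r (dx l a p)
      = dx l a (\sum_(1 <= r < m.+1) x m r * glact m i r p).
    rewrite linear_sum; apply: eq_bigr => r _ /=.
    by rewrite ih 1?ltnW // dx_xM_row.
  by rewrite !(dxD, dxZ) !dx_xM_row // euler_dx_row.
- by rewrite dxN dx_comm.
by rewrite dxB dxZ euler_dx_row.
Qed.

Section Level.
Variables (m : nat) (lemn : (m <= n)%N).
Local Notation X := (fun r : 'I_m => @mulx F n m r.+1 : {linear P -> P}).
Local Notation Y := (fun r : 'I_m => dx m r.+1 : {linear P -> P}).
Local Notation e := (fun i j : 'I_m => glact m i.+1 j.+1 : {linear P -> P}).

Lemma level_XX i j v : X i (X j v) = X j (X i v).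
Proof. exact: mulrCA. Qed.

Lemma level_YY i j v : Y i (Y j v) = Y j (Y i v).
Proof. exact: dx_comm. Qed.

Lemma level_YX i j v : Y j (X i v) = X i (Y j v) + v *+ (i == j).
Proof.
rewrite /= /mulx dx_xM; congr (_ + _ *+ nat_of_bool _).
by rewrite /valid /= ltn_ord lemn eqxx eqSS eq_sym.
Qed.

Lemma level_eX i j a v : e i j (X a v) = X a (e i j v).
Proof. by rewrite /= glact_x. Qed.

Lemma level_eY i j a v : e i j (Y a v) = Y a (e i j v).
Proof. by rewrite /= glact_dx. Qed.

Hypothesis ee : forall i j a b v,
  e i j (e a b v) = e a b (e i j v) + e i b v *+ (j == a) - e a j v *+ (i == b).

Definition opt_idx (a : option 'I_m) : nat := if a is Some i then i.+1 else m.+1.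

Lemma opt_idx_inj : injective opt_idx.
Proof.
move=> [i|] [j|] //= [] => [/val_inj -> //|h|h].
  by move: (ltn_ord i); rewrite h ltnn.
by move: (ltn_ord j); rewrite -h ltnn.
Qed.

Lemma opt_idxP i : (1 <= i <= m.+1)%N -> exists a, i = opt_idx a.
Proof.
case: i => // i /andP[_]; rewrite ltnS leq_eqVlt => /orP[/eqP->|lt].
  by exists None.
by exists (Some (Ordinal lt)).
Qed.

Lemma glactS a b v : glact m.+1 (opt_idx a) (opt_idx b) v
  = gl_ext (fun i j => weyl_gl X Y e i j : {linear P -> P})
      (fun i => weyl_raise X Y e (c m) i : {linear P -> P}) Y
      (weyl_euler X Y : {linear P -> P}) (c m) (c m.+1 / m.+1%:R) a b v.
Proof.
case: a b => [i|] [j|]; rewrite /= ?ltnn ?ltn_ord ?eulerE ?big_ord1 //=.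
Qed.

Lemma glactS_rel i j a b v : (1 <= i <= m.+1)%N -> (1 <= j <= m.+1)%N ->
  (1 <= a <= m.+1)%N -> (1 <= b <= m.+1)%N ->
  glact m.+1 i j (glact m.+1 a b v) = glact m.+1 a b (glact m.+1 i j v)
    + glact m.+1 i b v *+ (j == a) - glact m.+1 a j v *+ (i == b).
Proof.
move=> /opt_idxP[i' ->] /opt_idxP[j' ->] /opt_idxP[a' ->] /opt_idxP[b' ->].
rewrite !(inj_eq opt_idx_inj) !glactS; apply: gl_ext_rel.
- exact: (weyl_gl_gl level_XX level_YY level_YX level_eX level_eY ee).
- exact: (weyl_gl_raise _ level_XX level_YY level_YX level_eX level_eY ee).
- exact: (weyl_glY level_YY level_YX level_eY).
- exact: (weyl_gl_euler level_XX level_YY level_YX level_eX level_eY).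
- exact: (weyl_raise_raise _ level_XX level_YX level_eX level_eY ee).
- exact: (weyl_raiseY _ level_YY level_YX level_eY).
- exact: (weyl_raiseX_euler _ level_XX level_YX level_eX level_eY).
- exact: level_YY.
- exact: (weyl_eulerY level_YY level_YX).
Qed.

End Level.

(** The relations of [glact m] are the hypothesis [ee] of the abstract computation, and the abstract
    extension is [glact m.+1]. *)
Lemma glact_rel m i j a b v : (m <= n.+1)%N -> (1 <= i <= m)%N -> (1 <= j <= m)%N ->
  (1 <= a <= m)%N -> (1 <= b <= m)%N ->
  glact m i j (glact m a b v) = glact m a b (glact m i j v)
    + glact m i b v *+ (j == a) - glact m a j v *+ (i == b).
Proof.
elim: m i j a b v => [|m ih] i j a b v lemn; first by case: i.
apply: glactS_rel => // {}i {}j {}a {}b {}v.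
by apply: ih; rewrite ?ltn_ord // ltnW.
Qed.

End Ops.

(** * Vectors annihilated by the positive root vectors *)

Section Invariants.
Variables (F : numClosedFieldType) (n : nat) (k : nat -> nat).
Local Notation N := 'C(n.+1, 2).
Local Notation P := {mpoly F[N]}.
Local Notation x := (@x F n).
Local Notation dx := (@dx F n).
Local Notation tact := (@tact F n k).

(** Positive root vectors have no second order part: unfolding the recursion stops at the derivative
    of row s - 1, whose sign is absorbed by x_{s-1,s} = -1. The result is a derivation that
    substitutes column s for column t. *)
Lemma tact_low m s t p : (1 <= t < s)%N -> (s <= m)%N ->
  tact m s t p = \sum_(s.-1 <= l < m.+1) x l s * dx l t p.
Proof.
move=> /andP[t1 lts]; elim: m => [|m ih] lesm; first by lia.
rewrite big_nat_recr /=; last by lia.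
rewrite addrC /tact /=; congr (_ + _).
case: ifP => [les|/negbT]; rewrite -?ltnNge.
  rewrite (_ : (t <= m)%N); last by lia.
  by rewrite [s == t]gtn_eqF // mulr0n addr0 -ih.
move=> gts; have -> : s = m.+1 by lia.
rewrite (_ : (t <= m)%N); last by lia.
by rewrite big_nat1 x_sup mulN1r.
Qed.

Lemma tact_lowM m s t p q : (1 <= t < s)%N -> (s <= m)%N ->
  tact m s t (p * q) = tact m s t p * q + p * tact m s t q.
Proof.
move=> hts lesm; rewrite !tact_low // mulr_suml mulr_sumr -big_split.
by apply: eq_bigr => l _; rewrite dxM /=; ring.
Qed.

Lemma tact_low_x m s t l j : (1 <= t < s)%N -> (s <= m)%N -> (m <= n)%N ->
  (l <= m)%N -> tact m s t (x l j) = x l s *+ (j == t).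
Proof.
move=> hts lesm lemn lelm; rewrite tact_low //.
have [->|njt] := eqVneq j t; last first.
  rewrite big1 // => a _; rewrite dx_x [t == j]eq_sym (negbTE njt).
  by rewrite !andbF mulr0.
case: (ltnP l s.-1) => [ltl|gel].
  rewrite [x l s]x_zero; last by lia.
  rewrite mul0rn big_nat_cond big1 // => a /andP[/andP[ga _] _].
  by rewrite dx_x (_ : _ == l = false) ?andbF ?mulr0 //; apply/eqP; lia.
rewrite (bigD1_seq l) /= ?mem_index_iota ?iota_uniq //; last by lia.
rewrite dx_x !eqxx (_ : valid n l t); last by rewrite /valid; lia.
rewrite mulr1 big1 ?addr0 // => a /negbTE na.
by rewrite dx_x na andbF mulr0.
Qed.

Lemma tact_low_x_gt m s t l j : (1 <= t < s)%N -> (s <= m)%N ->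
  (m < l)%N -> tact m s t (x l j) = 0.
Proof.
move=> hts lesm ltml; rewrite tact_low // big_nat_cond big1 // => a.
move=> /andP[/andP[_ ?] _].
by rewrite dx_x (_ : _ == l = false) ?andbF ?mulr0 //; apply/eqP; lia.
Qed.

(* The minors D_{m,i}(i), through their expansion along the first column: the
   column operations act on the matrix, and (D_{m,l+1}(l+1))_l is orthogonal to
   all its columns. *)
Fixpoint hess_seq m d : seq P :=
  if d is d'.+1 then
    let s := hess_seq m d' in
    (\sum_(q < d'.+1) x (m - d' + q) (m - d') * nth 0 s q) :: s
  else [:: 1].
Definition hess m i := nth 0 (hess_seq m (m.+1 - i)) 0.

Lemma hess_seq_nth m d q : (q <= d)%N ->
  nth 0 (hess_seq m d) q = nth 0 (hess_seq m (d - q)) 0.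
Proof.
elim: d q => [|d ih] [|q] //= leqd; rewrite ih // subSS.
Qed.

Lemma hess_last m : hess m m.+1 = 1.
Proof. by rewrite /hess subnn. Qed.

Lemma hess_rec m i : (i <= m)%N ->
  hess m i = \sum_(i <= l < m.+1) x l i * hess m l.+1.
Proof.
move=> leim; rewrite /hess subSn //= (_ : m - (m - i) = i)%N; last by lia.
rewrite -[X in \sum_(X <= _ < _) _]add0n big_addn big_mkord subSn //; apply: eq_bigr => q _.
rewrite hess_seq_nth; last by have := ltn_ord q; lia.
by rewrite addnC; congr (x _ _ * nth 0 (hess_seq m _) 0); have := ltn_ord q; lia.
Qed.

Lemma hess_orth m j : (1 <= j <= m)%N ->
  \sum_(j.-1 <= l < m.+1) x l j * hess m l.+1 = 0.
Proof.
move=> /andP[j1 jm]; rewrite big_ltn; last by lia.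
by rewrite prednK // -hess_rec // x_sup_pred // mulN1r addNr.
Qed.

(** In the expansion along the first column only i = t is affected: there column t is replaced by
    column s, to which the vector of minors is orthogonal. *)
Lemma tact_low_hess m s t i : (1 <= t < s)%N -> (s <= m)%N -> (m <= n)%N ->
  (i <= m.+1)%N -> tact m s t (hess m i) = 0.
Proof.
move=> hts lesm lemn lei.
have t1 p q := @tact_lowM m s t p q hts lesm.
have tact1 : tact m s t 1 = 0.
  by apply: (addrI (tact m s t 1)); rewrite addr0 -[in RHS](mulr1 1) t1 mulr1 mul1r.
have [d] := ubnP (m.+1 - i); elim: d => // d ih in i lei * => ltd.
case: (leqP i m) => [leim|gtim]; last first.
  by rewrite (_ : i = m.+1) ?hess_last //; lia.
rewrite hess_rec // linear_sum /=.
rewrite (eq_big_nat _ _ (F2 := fun l => (x l s * hess m l.+1) *+ (i == t))); last first.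
  move=> l /andP[gl ll]; rewrite t1 tact_low_x // ih ?mulr0 ?addr0 ?mulrnAl //; lia.
have [eit|_] := eqVneq i t; last by rewrite big1.
rewrite -[RHS](hess_orth (m := m) (j := s)); last by lia.
rewrite [LHS](big_cat_nat _ (n := s.-1)) /=; [|lia|lia].
rewrite [X in X + _]big_nat_cond big1 ?add0r // => l /andP[/andP[_ ?] _].
by rewrite x_zero ?mul0r //; lia.
Qed.

End Invariants.

(** * The invariants are the polynomials in the minors of row m and the higher variables *)

Section Evaluation.
Variables (F : numClosedFieldType) (n : nat) (k : nat -> nat).
Local Notation N := 'C(n.+1, 2).
Local Notation P := {mpoly F[N]}.
Local Notation x := (@x F n).
Local Notation dx := (@dx F n).
Local Notation tact := (@tact F n k).
Local Notation expo := (@expo n).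

Definition high m (mu : 'X_{1..N}) := [forall v, (row v < m)%N ==> (mu v == 0%N)].

Lemma highP m mu : reflect (forall i j, (i < m)%N -> expo mu i j = 0%N) (high m mu).
Proof.
apply: (iffP forallP) => [h i j lti|h v].
  case: (boolP (valid n i j)) => [/var_idxP[v e]|/expo_invalid -> //].
  have := h v; have [-> _] := rowcolE e; rewrite lti /expo e.
  by move=> /eqP.
by apply/implyP => lt; rewrite -expo_rowcol h.
Qed.

Lemma high_uexp m mu l a : (m <= l)%N -> high m (mu + uexp n l a)%MM = high m mu.
Proof.
move=> leml; apply/highP/highP => h i j lti; have := h i j lti.
  by rewrite expoD => /eqP; rewrite addn_eq0 => /andP[/eqP].
rewrite expoD => ->; rewrite expo_uexp (_ : l == i = false) ?andbF //.
by apply/eqP; lia.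
Qed.

Lemma high_uexpF m mu l a : (l < m)%N -> valid n l a ->
  high m (mu + uexp n l a)%MM = false.
Proof.
move=> ltlm v; apply/highP => /(_ l a ltlm).
by rewrite expoD expo_uexp v !eqxx addn1.
Qed.

Definition ev m : P -> P :=
  comp_mpoly [tuple (if (row v < m)%N then 0 else 'X_v) | v < N].
HB.instance Definition _ m := GRing.RMorphism.copy (ev m)
  (comp_mpoly [tuple (if (row v < m)%N then 0 else 'X_v : P) | v < N]).
HB.instance Definition _ m := GRing.Linear.copy (ev m)
  (comp_mpoly [tuple (if (row v < m)%N then 0 else 'X_v : P) | v < N]).

Definition minor_tuple m : N.-tuple P :=
  [tuple (if (row v < m)%N then 0 else
     if row v == m then hess F n m (col v) else 'X_v) | v < N].
(** An invariant lift of the evaluation [ev m]: modulo the rows below m the minor put in place of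
    x_{m,j} is x_{m,j} itself, all other terms of its expansion containing a lower variable. *)
Definition minor_subst m : P -> P := comp_mpoly (minor_tuple m).
HB.instance Definition _ m := GRing.RMorphism.copy (minor_subst m) (comp_mpoly (minor_tuple m)).
HB.instance Definition _ m := GRing.Linear.copy (minor_subst m) (comp_mpoly (minor_tuple m)).

Lemma ev_mpolyX m mu : ev m 'X_[mu] = 'X_[mu] *+ high m mu.
Proof.
rewrite /ev comp_mpolyX; case: (boolP (high m mu)) => [/forallP h|].
  rewrite mulr1n mpolyXE_id; apply: eq_bigr => v _; rewrite tnth_mktuple.
  by case: ifP => // lt; have := h v; rewrite lt => /eqP ->; rewrite !expr0.
rewrite negb_forall => /existsP[v]; rewrite negb_imply => /andP[lt nz].
by rewrite mulr0n (bigD1 v) //= tnth_mktuple lt expr0n (negbTE nz) mul0r.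
Qed.

Lemma mcoeff_ev m p mu : (ev m p)@_mu = p@_mu *+ high m mu.
Proof.
have -> : ev m p = \sum_(nu <- msupp p) p@_nu *: ('X_[nu] *+ high m nu).
  rewrite {1}[p]mpolyE linear_sum; apply: eq_bigr => nu _.
  by rewrite linearZ /= ev_mpolyX.
have -> : p@_mu = \sum_(nu <- msupp p) p@_nu * (nu == mu)%:R.
  rewrite {1}[p]mpolyE raddf_sum; apply: eq_bigr => nu _ /=.
  by rewrite mcoeffZ mcoeffX.
rewrite raddf_sum -sumrMnl; apply: eq_bigr => nu _ /=.
rewrite mcoeffZ mcoeffMn mcoeffX.
by case: eqP => [->|_]; rewrite ?mulrnAr // !(mulr0n, mul0rn, mulr0).
Qed.

Lemma ev_dx m l a p : (m <= l)%N -> ev m (dx l a p) = dx l a (ev m p).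
Proof.
move=> leml; case: (boolP (valid n l a)) => v; last by rewrite !dx_invalid // linear0.
apply/mpolyP => mu; rewrite mcoeff_ev !mcoeff_dx // mcoeff_ev high_uexp //.
by rewrite mulrnAC.
Qed.

Lemma ev_x m l a : (m <= l)%N -> valid n l a -> ev m (x l a) = x l a.
Proof.
by move=> leml v; rewrite x_validE // ev_mpolyX -[uexp n l a]add0m high_uexp // (_ : high m 0%MM) //; apply/highP => *; rewrite expo0.
Qed.

Lemma ev_xM m l a p : (m <= l)%N -> valid n l a -> ev m (x l a * p) = x l a * ev m p.
Proof. by move=> leml v; rewrite rmorphM /= ev_x. Qed.

Lemma ev_xM0 m l a p : (l < m)%N -> valid n l a -> ev m (x l a * p) = 0.
Proof.
move=> ltlm v; rewrite rmorphM /= x_validE // ev_mpolyX.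
by rewrite -[uexp n l a]add0m high_uexpF // mulr0n mul0r.
Qed.

Lemma ev_lift m p : ev m (minor_subst m p) = ev m p.
Proof.
pose f : {linear P -> P} := ev m \o minor_subst m.
apply: (linear_ext (f := f) (g := ev m)) => mu.
rewrite /f /= /minor_subst comp_mpolyX rmorph_prod mpolyXE_id rmorph_prod /=.
apply: eq_bigr => v _; rewrite !rmorphXn; congr (_ ^+ _).
rewrite tnth_mktuple; case: ifP => [lt|ge].
  by rewrite [LHS]raddf0 /= /ev comp_mpolyXU -tnth_nth tnth_mktuple lt.
have /and3P[j1 ji iN] := rowcol_valid v.
case: eqP => [er|//].
rewrite hess_rec; last by rewrite -er.
rewrite rmorph_sum big_nat_recr /=; last by rewrite -er.
rewrite hess_last mulr1 big_nat_cond big1 ?add0r => [|l /andP[/andP[gl ltl] _]].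
  by rewrite -er /Defs.x rowcolP.
by apply: ev_xM0 => //; rewrite /valid j1 gl /=; lia.
Qed.

Definition gl_invariant m (f : P) :=
  forall s t, (1 <= t < s)%N -> (s <= m)%N -> tact m s t f = 0.

Lemma lift_invariant m p : (m <= n)%N -> gl_invariant m (minor_subst m p).
Proof.
move=> lemn s t hts lesm.
pose f : {linear P -> P} := tact m s t \o minor_subst m.
apply: (linear_ext (f := f) (g := \0)) => mu /=.
have tM p1 p2 := @tact_lowM F n k m s t p1 p2 hts lesm.
have t1 : tact m s t 1 = 0.
  by apply: (addrI (tact m s t 1)); rewrite addr0 -[in RHS](mulr1 1) tM mulr1 mul1r.
rewrite /minor_subst comp_mpolyX; apply: (big_ind (fun q => tact m s t q = 0)) => //.
  by move=> p1 p2 h1 h2; rewrite tM h1 h2 mul0r mulr0 addr0.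
move=> v _; rewrite tnth_mktuple; set y := (if _ then _ else _).
suff h : tact m s t y = 0.
  by elim: (mu v) => [|q ih]; rewrite ?expr0 // exprS tM h ih mul0r mulr0 addr0.
rewrite /y; case: ifP => [_|ge]; first exact: linear0.
case: eqP => [er|ne]; last first.
  have -> : 'X_v = x (row v) (col v) by rewrite /Defs.x rowcolP.
  by apply: tact_low_x_gt => //; lia.
apply: tact_low_hess => //; have /and3P[_ h _] := rowcol_valid v.
by rewrite -er; lia.
Qed.

(** Take in [f] a monomial of least degree in the rows below m. If it contained x_{r,c} with r < m,
    the term -d/dx_{r,c} of E_{r+1,c} would give a monomial that the other terms can only obtain
    from monomials of smaller degree in these rows. So it contains none, and it survives the
    evaluation. *)
Lemma invariant_ev_inj m f : (m <= n)%N -> gl_invariant m f -> ev m f = 0 -> f = 0.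
Proof.
move=> lemn invf evf; apply/eqP; apply: contraT => fn0.
pose dl (mu : 'X_{1..N}) := (\sum_(v | row v < m) mu v)%N.
have [mu fmu mumin] : exists2 mu, f@_mu != 0 & forall nu, f@_nu != 0 -> (dl mu <= dl nu)%N.
  have ex : exists d, has (fun mu => dl mu == d) (msupp f).
    move: fn0; rewrite -msupp_eq0; case E: (msupp f) => [|mu s] // _.
    by exists (dl mu); rewrite /= eqxx.
  case: (ex_minnP ex) => d /hasP[mu mus /eqP <-] mind.
  exists mu; first by rewrite -mcoeff_msupp.
  by move=> nu fnu; apply: mind; apply/hasP; exists nu; rewrite // mcoeff_msupp.
have dlE mu1 l a : valid n l a -> dl (mu1 + uexp n l a)%MM = (dl mu1 + (l < m))%N.
  move=> va; have [w e] := var_idxP va; rewrite /dl /uexp e.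
  under eq_bigr => v _ do rewrite mnmDE mnm1E.
  rewrite big_split /=; congr (_ + _)%N; have [erw ecw] := rowcolE e.
  case: ltnP => [ltlm|geml].
    by rewrite (bigD1 w) /= ?erw // eqxx big1 // => v /andP[_ /negbTE]; rewrite eq_sym => ->.
  by rewrite big1 // => v ltv; case: eqP => // ewv; move: ltv; rewrite -ewv erw ltnNge geml.
have [hmu|] := boolP (high m mu).
  have e := mcoeff_ev m f mu; rewrite evf hmu mcoeff0 mulr1n in e.
  by rewrite -e eqxx in fmu.
rewrite negb_forall => /existsP[v]; rewrite negb_imply => /andP[ltv nz].
have vv := rowcol_valid v; have /and3P[j1 ji _] := vv.
have ex0 : (0 < expo mu (row v) (col v))%N by rewrite expo_rowcol lt0n.
have [nu emu] := expo_split vv ex0.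
have hts : (1 <= col v < (row v).+1)%N by rewrite j1.
have := invf (row v).+1 (col v) hts ltv.
rewrite tact_low // big_ltn /=; last by lia.
rewrite x_sup mulN1r => /(congr1 (mcoeff nu)); rewrite mcoeff0 mcoeffD mcoeffN.
rewrite mcoeff_dx // -emu (raddf_sum (mcoeff nu)) big_nat_cond big1 => [|l].
  move/eqP; rewrite addr0 oppr_eq0 -mulr_natr mulf_eq0 (negbTE fmu) /=.
  by rewrite pnatr_eq0.
move=> /andP[/andP[gl ltl] _].
case: (boolP (valid n l (row v).+1)) => vl; last first.
  by move: vl; rewrite /valid; lia.
have vl' : valid n l (col v) by move: vl vv; rewrite /valid; lia.
case: (posnP (expo nu l (row v).+1)) => [e0|/(expo_split vl)[nu' enu]].
  by rewrite /= mcoeff_xM0.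
rewrite enu /= mcoeff_xM // mcoeff_dx //; case: (eqVneq (f@_(nu' + uexp n l (col v))) 0).
  by move=> ->; rewrite mul0rn.
move=> /mumin; rewrite emu enu !dlE // ltv; lia.
Qed.

(** Both sides are invariant and have the same evaluation. *)
Lemma invariant_minor_subst m f : (m <= n)%N -> gl_invariant m f -> f = minor_subst m f.
Proof.
move=> lemn invf; apply/eqP; rewrite -subr_eq0; apply/eqP.
apply: (invariant_ev_inj lemn); last by rewrite linearB /= ev_lift subrr.
by move=> s t hts les; rewrite linearB /= invf // lift_invariant // subrr.
Qed.

Definition hwv m mu : P := minor_subst m 'X_[mu].

Lemma hwvE m mu : hwv m mu = minor_subst m 'X_[mu]. Proof. by []. Qed.

Lemma hwv_invariant m mu : (m <= n)%N -> gl_invariant m (hwv m mu).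
Proof. by move=> lemn; apply: lift_invariant. Qed.

Lemma ev_hwv m mu : high m mu -> ev m (hwv m mu) = 'X_[mu].
Proof. by move=> h; rewrite ev_lift ev_mpolyX h. Qed.

Lemma hwv_low m mu : ~~ high m mu -> hwv m mu = 0.
Proof.
rewrite negb_forall => /existsP[v]; rewrite negb_imply => /andP[lt nz].
by rewrite /hwv /minor_subst comp_mpolyX (bigD1 v) //= tnth_mktuple lt expr0n (negbTE nz) mul0r.
Qed.

Lemma hwv_n0 m mu : high m mu -> hwv m mu != 0.
Proof.
move=> h; apply/eqP => e; have := ev_hwv h; rewrite e linear0 => /esym/eqP.
by rewrite -msupp_eq0 msuppX.
Qed.

Lemma invariant_sum m f : (m <= n)%N -> gl_invariant m f ->
  f = \sum_(mu <- msupp f) f@_mu *: hwv m mu.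
Proof.
move=> lemn invf; rewrite {1}(invariant_minor_subst lemn invf) {1}[f]mpolyE linear_sum.
by apply: eq_bigr => mu _; rewrite linearZ.
Qed.

End Evaluation.

(** * Row operations *)

Section RowOps.
Variables (F : numClosedFieldType) (n : nat) (k : nat -> nat).
Local Notation N := 'C(n.+1, 2).
Local Notation P := {mpoly F[N]}.
Local Notation x := (@x F n).
Local Notation dx := (@dx F n).
Local Notation euler := (@euler F n).
Local Notation tact := (@tact F n k).
Local Notation glact := (@glact F n k).

Definition rowop l (p : P) : P := \sum_(1 <= j < l.+1) x l.-1 j * dx l j p.

Lemma rowopE l p : rowop l p = \sum_(1 <= j < l.+1) x l.-1 j * dx l j p.
Proof. by []. Qed.

Lemma rowop_linear l : linear (rowop l).
Proof.
move=> a p q; rewrite /rowop scaler_sumr -big_split; apply: eq_bigr => j _ /=.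
by rewrite dxD dxZ mulrDr scalerAr.
Qed.
HB.instance Definition _ l := GRing.isLinear.Build F P P *:%R (rowop l) (rowop_linear l).

Lemma rowopM l p q : rowop l (p * q) = rowop l p * q + p * rowop l q.
Proof.
rewrite /rowop mulr_suml mulr_sumr -big_split; apply: eq_bigr => j _.
by rewrite dxM /=; ring.
Qed.

Lemma rowop_x l a b : (1 <= b)%N -> (1 <= l <= n)%N -> rowop l (x a b) = x l.-1 b *+ (a == l).
Proof.
move=> b1 hl; rewrite /rowop; have [->|nal] := eqVneq a l; last first.
  by rewrite big1 // => j _; rewrite dx_x [l == a]eq_sym (negbTE nal) andbF mulr0.
case: (leqP b l) => [lebl|ltlb]; last first.
  rewrite [x l.-1 b]x_zero ?mul0rn; last by lia.
  rewrite big_nat_cond big1 // => j /andP[/andP[_ ?] _].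
  by rewrite dx_x (_ : j == b = false) ?andbF ?mulr0 //; apply/eqP; lia.
rewrite (bigD1_seq b) /= ?mem_index_iota ?iota_uniq //; last by lia.
rewrite dx_x !eqxx (_ : valid n l b); last by rewrite /valid; lia.
rewrite mulr1 big1 ?addr0 // => j /negbTE nj.
by rewrite dx_x nj !andbF mulr0.
Qed.

Lemma rowop_xM l a b p : a != l -> rowop l (x a b * p) = x a b * rowop l p.
Proof.
move=> nal; rewrite /rowop mulr_sumr; apply: eq_bigr => j _.
by rewrite dx_xM_row 1?eq_sym // mulrCA.
Qed.

Lemma rowop_dx l a b p : (l <= a)%N -> rowop l (dx a b p) = dx a b (rowop l p).
Proof.
move=> lela; rewrite /rowop linear_sum big_nat_cond [RHS]big_nat_cond.
apply: eq_bigr => j /andP[/andP[j1 jl] _] /=.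
rewrite [RHS]dx_xM_row; last by apply/eqP; lia.
by rewrite [dx a b (dx _ _ _)]dx_comm.
Qed.

(** Each order of composition has one extra term, x_{l-1,s} d/dx_{l,t}. When t or s - 1 exceeds l it
    is absent from one of the sums, but then x_{l-1,s} = 0. *)
Lemma rowop_tact_low m l s t p : (1 <= t < s)%N -> (s <= m)%N -> (m <= n)%N ->
  (1 <= l <= m)%N -> rowop l (tact m s t p) = tact m s t (rowop l p).
Proof.
move=> hts lesm lemn /andP[l1 lelm]; rewrite tact_low // /rowop !linear_sum /=.
have -> : \sum_(1 <= j < l.+1) tact m s t (x l.-1 j * dx l j p)
    = \sum_(1 <= j < l.+1) x l.-1 s * dx l t p *+ (j == t)
      + \sum_(1 <= j < l.+1) x l.-1 j * (\sum_(s.-1 <= a < m.+1) x a s * dx a t (dx l j p)).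
  rewrite -big_split; apply: eq_big_nat => j /andP[j1 jl] /=.
  rewrite tact_lowM // tact_low_x //; last by lia.
  rewrite [in X in _ + X]tact_low //; congr (_ + _).
  by case: eqP => [->|_]; rewrite ?mulr1n // mulr0n mul0r.
have -> : \sum_(1 <= j < l.+1) x l.-1 j * dx l j (\sum_(s.-1 <= l0 < m.+1) x l0 s * dx l0 t p)
   = \sum_(s.-1 <= a < m.+1) x l.-1 s * dx a t p *+ (a == l)
     + \sum_(1 <= j < l.+1) x l.-1 j * (\sum_(s.-1 <= a < m.+1) x a s * dx a t (dx l j p)).
  rewrite -[LHS]/(rowop l _) linear_sum.
  have -> : \sum_(1 <= j < l.+1) x l.-1 j * (\sum_(s.-1 <= a < m.+1) x a s * dx a t (dx l j p))
     = \sum_(s.-1 <= a < m.+1) x a s * (\sum_(1 <= j < l.+1) x l.-1 j * dx l j (dx a t p)).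
    under eq_bigr => j _ do rewrite mulr_sumr.
    rewrite exchange_big; apply: eq_bigr => a _; rewrite mulr_sumr.
    by apply: eq_bigr => j _; rewrite mulrCA [dx a t _]dx_comm.
  rewrite -big_split; apply: eq_bigr => a _ /=.
  rewrite rowopM rowop_x ?l1 //=; [|by lia|by lia].
  by rewrite mulrnAl.
congr (_ + _).
case: (boolP ((t <= l)%N && (s.-1 <= l)%N)) => [/andP[tl sl]|nh].
  rewrite (bigD1_seq l) ?mem_index_iota ?iota_uniq //=; last by lia.
  rewrite (bigD1_seq t) ?mem_index_iota ?iota_uniq //=; last by lia.
  rewrite !eqxx !big1 // => [j /negbTE ->|j /negbTE ->]; by rewrite mulr0n.
have xz : x l.-1 s = 0 by rewrite x_zero //; lia.
by rewrite !big1 // => j _; rewrite xz mul0r mul0rn.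
Qed.

Lemma rowopD l p q : rowop l (p + q) = rowop l p + rowop l q. Proof. exact: linearD. Qed.
Lemma rowopN l p : rowop l (- p) = - rowop l p. Proof. exact: linearN. Qed.
Lemma rowopZ l a p : rowop l (a *: p) = a *: rowop l p. Proof. exact: linearZ. Qed.

Lemma rowopS m p : rowop m.+1 p
  = \sum_(1 <= j < m.+1) x m j * dx m.+1 j p - dx m.+1 m.+1 p.
Proof. by rewrite /rowop big_nat_recr //= x_sup mulN1r. Qed.

Lemma dx_rowop m j p : (1 <= j <= m)%N -> (m.+1 <= n)%N ->
  dx m j (rowop m.+1 p) = rowop m.+1 (dx m j p) + dx m.+1 j p.
Proof.
move=> hj lemn; rewrite !rowopS dxB linear_sum /= [dx m j (dx _ _ p)]dx_comm.
rewrite [RHS]addrAC; congr (_ - _).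
rewrite (bigD1_seq j) ?mem_index_iota ?iota_uniq //=.
rewrite [in RHS](bigD1_seq j) ?mem_index_iota ?iota_uniq //=.
rewrite dx_xM !eqxx (_ : valid n m j) ?andbT; last by rewrite /valid; lia.
rewrite mulr1n [dx m j (dx _ _ p)]dx_comm -!addrA; congr (_ + _).
rewrite addrC; congr (_ + _); apply: eq_bigr => b /negbTE nb.
by rewrite dx_xM [j == b]eq_sym nb !andbF addr0 dx_comm.
Qed.

Lemma euler_xM m j p : (1 <= j <= m)%N -> (m <= n)%N ->
  euler m (x m j * p) = x m j * euler m p + x m j * p.
Proof.
move=> hj lemn; have ltj : (j.-1 < m)%N by lia.
have := weyl_eulerX (level_XX (m := m)) (level_YX lemn) (Ordinal ltj) p.
by rewrite /weyl_euler /mulx /= prednK ?eulerE //; lia.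
Qed.

Lemma rowop_euler m p : (m.+1 <= n)%N ->
  euler m (rowop m.+1 p) = rowop m.+1 (euler m p) + rowop m.+1 p + dx m.+1 m.+1 p.
Proof.
move=> lemn; have nmm : m.+1 != m by rewrite gtn_eqF.
have eB q r : euler m (q - r) = euler m q - euler m r by exact: linearB.
have eS (s : seq nat) f : euler m (\sum_(j <- s) f j) = \sum_(j <- s) euler m (f j).
  exact: linear_sum.
rewrite !rowopS eB eS euler_dx_row //.
have -> : \sum_(1 <= j < m.+1) euler m (x m j * dx m.+1 j p)
    = \sum_(1 <= j < m.+1) x m j * dx m.+1 j (euler m p)
      + \sum_(1 <= j < m.+1) x m j * dx m.+1 j p.
  rewrite -big_split; apply: eq_big_nat => j hj /=.
  by rewrite (euler_xM _ hj (ltnW lemn)) euler_dx_row.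
zmod.
Qed.

Lemma rowop_glact m l i j p : (m < l)%N -> glact m i j (rowop l p) = rowop l (glact m i j p).
Proof.
move=> ltml; rewrite /rowop linear_sum; apply: eq_bigr => b _ /=.
by rewrite glact_x ?glact_dx //; lia.
Qed.

(** The commutator is a multiple of [rowop m] itself, and the factor x_{m-1,i} commutes with
    [rowop m]; this makes the kernels of the powers of [rowop m] stable under gl(m). *)
Lemma rowop_tact m i j p : (1 <= i <= m)%N -> (1 <= j <= m)%N -> (m <= n)%N ->
  tact m i j (rowop m p) = rowop m (tact m i j p) + (x m.-1 i * rowop m p) *+ (j == m).
Proof.
case: m => [|m]; first by lia.
move=> hi hj lemn; have nmm : m != m.+1 by rewrite ltn_eqF.
have Rx q : rowop m.+1 (x m.+1 i * q) = x m.+1 i * rowop m.+1 q + x m i * q.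
  by rewrite rowopM rowop_x ?eqxx 1?addrC //; lia.
have Rx0 b q : rowop m.+1 (x m b * q) = x m b * rowop m.+1 q by rewrite rowop_xM.
have Rd q : rowop m.+1 (dx m.+1 j q) = dx m.+1 j (rowop m.+1 q) by rewrite rowop_dx.
have Rg a b q : rowop m.+1 (glact m a b q) = glact m a b (rowop m.+1 q).
  by rewrite rowop_glact.
rewrite /tact /=; case: (leqP i m) => him; case: (leqP j m) => hjm.
- rewrite [j == _]ltn_eqF // mulr0n addr0 !rowopD Rx Rx0 Rd Rg dx_rowop //; last by lia.
  by rewrite [rowop _ (_ *+ _)]raddfMn /= rowopZ mulrDr; zmod.
- have ej : j = m.+1 by lia.
  have Rs : rowop m.+1 (\sum_(1 <= r < m.+1) x m r * glact m i r p)
     = \sum_(1 <= r < m.+1) x m r * glact m i r (rowop m.+1 p).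
    by rewrite linear_sum; apply: eq_bigr => r _ /=; rewrite Rx0 Rg.
  rewrite ej eqxx mulr1n !rowopD Rs Rx Rx0 rowopZ Rx0 [rowop _ (dx _ _ _)]rowop_dx //.
  rewrite rowop_euler //.
  by rewrite !mulrDr; zmod.
- have ei : i = m.+1 by lia.
  rewrite [j == _]ltn_eqF // mulr0n addr0 !rowopD rowopN Rx Rd dx_rowop //; last by lia.
  by rewrite ei x_sup mulN1r; zmod.
have ei : i = m.+1 by lia.
have ej : j = m.+1 by lia.
rewrite ej eqxx mulr1n !rowopD rowopN rowopZ Rx [rowop _ (dx _ _ _)]rowop_dx //.
rewrite rowop_euler //.
by rewrite ei x_sup !mulN1r; zmod.
Qed.

Lemma iter_rowop_tact q m i j p : (1 <= i <= m)%N -> (1 <= j <= m)%N -> (m <= n)%N ->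
  tact m i j (iter q (rowop m) p) = iter q (rowop m) (tact m i j p)
    + (x m.-1 i * iter q (rowop m) p) *+ (q * (j == m)).
Proof.
move=> hi hj lemn; elim: q => [|q ih] /=; first by rewrite mul0n mulr0n addr0.
rewrite rowop_tact // ih rowopD [rowop _ (_ *+ _)]raddfMn /= rowop_xM; last first.
  by apply/eqP; lia.
by rewrite -addrA -mulrnDr mulSn addnC.
Qed.

End RowOps.

(** * The common kernel of powers of the row operations *)

Section RowKernel.
Variables (F : numClosedFieldType) (n : nat) (k : nat -> nat).
Local Notation N := 'C(n.+1, 2).
Local Notation P := {mpoly F[N]}.
Local Notation x := (@x F n).
Local Notation dx := (@dx F n).
Local Notation tact := (@tact F n k).
Local Notation glact := (@glact F n k).
Local Notation expo := (@expo n).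
Local Notation ev := (@ev F n).
Local Notation inv := (@gl_invariant F n k).
Local Notation rowop := (@rowop F n).

Definition kap l : nat := k (n.+1 - l)%N.

Lemma kapE l : kap l = k (n.+1 - l)%N. Proof. by []. Qed.

(* This turns out to be V^(m), with the variables of the rows l > m adjoined. *)
Definition row_kernel m (f : P) : Prop :=
  forall l, (1 <= l <= m)%N -> iter (kap l).+1 (rowop l) f = 0.

Lemma iter_linear (f : {linear P -> P}) q : linear (iter q f).
Proof. by elim: q => [|q ih] a u v //=; rewrite ih linearP. Qed.

Lemma iter_lin0 (f : {linear P -> P}) q : iter q f 0 = 0.
Proof. by elim: q => //= q ->; rewrite linear0. Qed.

Lemma iter_commute (f g : P -> P) q : (forall u, f (g u) = g (f u)) ->
  forall u, iter q f (g u) = g (iter q f u).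
Proof. by move=> h u; elim: q => //= q ->. Qed.

Lemma row_kernel_subspace m : subspace (row_kernel m).
Proof.
split=> [l _|a u v hu hv l hl]; first exact: (iter_lin0 (rowop l)).
rewrite [LHS](iter_linear (rowop l)).
by rewrite (hu l hl) (hv l hl) scaler0 addr0.
Qed.

Lemma row_kernel_le m m' f : (m' <= m)%N -> row_kernel m f -> row_kernel m' f.
Proof. by move=> le h l hl; apply: h; lia. Qed.

Lemma row_kernelS m f : row_kernel m f -> iter (kap m.+1).+1 (rowop m.+1) f = 0 ->
  row_kernel m.+1 f.
Proof.
move=> h h' l /andP[l1]; rewrite leq_eqVlt => /orP[/eqP->//|lt].
by apply: h; rewrite l1.
Qed.

Lemma row_kernel_x m l a f : (m < l)%N -> row_kernel m f -> row_kernel m (x l a * f).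
Proof.
move=> lt h l' hl'; rewrite (iter_commute (g := fun u => x l a * u)) ?h ?mulr0 //.
by move=> u; rewrite rowop_xM //; apply/eqP; lia.
Qed.

Lemma row_kernel_dx m l a f : (m <= l)%N -> row_kernel m f -> row_kernel m (dx l a f).
Proof.
move=> lt h l' hl'; rewrite (iter_commute (g := dx l a)) ?h ?linear0 //.
by move=> u; rewrite rowop_dx //; lia.
Qed.

(** The condition on row m is preserved since the commutator with a power of [rowop m] is a multiple
    of that power. The conditions on lower rows only see [glact m]. The two values of [M] are the
    kernels before and after row m is imposed. *)
Lemma row_kernel_tact m i j f : (1 <= m <= n)%N -> (1 <= i <= m)%N -> (1 <= j <= m)%N ->
  (forall u, row_kernel m.-1 u -> row_kernel m.-1 (glact m i j u)) ->
  forall M, (m.-1 <= M <= m)%N -> row_kernel M f -> row_kernel M (tact m i j f).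
Proof.
move=> /andP[m1 lemn] hi hj hg M hM hf.
have hm : row_kernel m.-1 (tact m i j f).
  have hf' : row_kernel m.-1 f by apply: row_kernel_le hf; lia.
  apply: (subspaceD (row_kernel_subspace _)); last exact: hg.
  by apply: row_kernel_x; [lia | apply: row_kernel_dx => //; lia].
have [->|eM] : M = m.-1 \/ M = m by lia.
  exact: hm.
rewrite eM in hf * => l hl; have [->|nlm] := eqVneq l m; last by apply: hm; lia.
have h0 : iter (kap m).+1 (rowop m) f = 0 by apply: hf; lia.
have := iter_rowop_tact k (kap m).+1 f hi hj lemn.
by rewrite h0 linear0 mulr0 mul0rn addr0.
Qed.

Lemma iter_rowop_invariant m l q f : (m <= n)%N -> (1 <= l <= m)%N -> inv m f ->
  inv m (iter q (rowop l) f).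
Proof.
move=> lemn hl invf; elim: q => //= q ih s t hts les.
by rewrite -rowop_tact_low // ih // linear0.
Qed.

Definition row_coef m l : P := if (l < m)%N then x m l.+1 else 1.

Lemma dx_row_coef m l p : dx m l (row_coef m l * p) = row_coef m l * dx m l p.
Proof.
rewrite /row_coef; case: ifP => _; last by rewrite !mul1r.
by rewrite dx_xM (_ : l == l.+1 = false) ?andbF ?mulr0n ?addr0 //; apply/eqP; lia.
Qed.

Lemma row_coef_n0 m l : (m <= n)%N -> row_coef m l != 0.
Proof.
rewrite /row_coef; case: ifP => [lt lemn|_ _]; last exact: oner_neq0.
by rewrite x_validE ?/valid -?msupp_eq0 ?msuppX //; lia.
Qed.

(** Evaluation kills x_{l-1,j} for j < l and leaves -d/dx_{l,l}. For l < m, invariance under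
    E_{l+1,l} rewrites this derivative as the sum of x_{a,l+1} d/dx_{a,l} over a > l, of which only
    a = m survives. *)
Lemma ev_rowop m l f : (m <= n)%N -> (1 <= l <= m)%N -> inv m f ->
  ev m (rowop l f) = - (row_coef m l * dx m l (ev m f)).
Proof.
move=> lemn /andP[l1 lelm] invf; rewrite /rowop big_nat_recr //= linearD linear_sum.
rewrite big_nat_cond big1 ?add0r => [|j /andP[/andP[j1 jl] _]]; last first.
  by apply: ev_xM0; rewrite /valid; lia.
rewrite x_sup_pred // mulN1r linearN /=; congr (- _); rewrite /row_coef.
case: ltnP => [ltlm|geml]; last by rewrite mul1r (_ : l = m) ?ev_dx //; lia.
have hts : (1 <= l < l.+1)%N by lia.
have := invf l.+1 l hts ltlm; rewrite tact_low // big_ltn /=; last by lia.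
move/(congr1 (ev m)); rewrite linear0 linearD /= x_sup mulN1r linearN /=.
move/eqP; rewrite addrC addr_eq0 opprK => /eqP <-.
rewrite big_nat_recr //= linearD linear_sum big_nat_cond big1 ?add0r => [|j /andP[/andP[j1 jl] _]].
  by rewrite /= ev_xM ?ev_dx // /valid; lia.
by apply: ev_xM0; rewrite /valid; lia.
Qed.

Lemma ev_iter_rowop m l q f : (m <= n)%N -> (1 <= l <= m)%N -> inv m f ->
  ev m (iter q (rowop l) f)
  = (-1) ^+ q * row_coef m l ^+ q * iter q (dx m l) (ev m f).
Proof.
move=> lemn hl invf; elim: q => [|q ih] /=; first by rewrite !mul1r.
rewrite ev_rowop //; last exact: iter_rowop_invariant.
rewrite ih -mulrA -(signr_odd _ q) mulr_sign.
have -> : forall (b : bool) (g : P), dx m l (if b then - g else g)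
    = if b then - dx m l g else dx m l g.
  by move=> [] g //; rewrite linearN.
have -> : forall g, dx m l (row_coef m l ^+ q * g) = row_coef m l ^+ q * dx m l g.
  move=> g; elim: (q) => [|r ih']; first by rewrite !mul1r.
  by rewrite exprS -!mulrA dx_row_coef ih'.
rewrite -mulr_sign signr_odd !exprS; ring.
Qed.

(** The factor is a quotient of factorials; its positivity is all that is used. *)
Lemma mcoeff_iter_dx l a q g mu : valid n l a -> exists r,
  (iter q (dx l a) g)@_mu = g@_(mu + uexp n l a *+ q) *+ r.+1.
Proof.
move=> v; elim: q mu => [|q ih] mu; first by exists 0%N; rewrite mulm0n addm0.
rewrite /= mcoeff_dx //; have [r ->] := ih (mu + uexp n l a)%MM.
exists (r.+1 * (expo mu l a).+1).-1; rewrite -mulrnA prednK; last by lia.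
by rewrite mulmS addmA.
Qed.

Lemma iter_dx_eq0 l a q g : valid n l a ->
  (iter q (dx l a) g = 0 <-> forall mu, g@_mu != 0 -> (expo mu l a < q)%N).
Proof.
move=> v; have exq nu : expo (nu + uexp n l a *+ q)%MM l a = (expo nu l a + q)%N.
  rewrite expoD; congr (_ + _)%N; elim: (q) => [|r ih]; first by rewrite mulm0n expo0.
  by rewrite mulmS expoD ih expo_uexp v !eqxx.
split=> [h mu|h].
  apply: contraNltn => leq.
  have [nu e] : exists nu, mu = (nu + uexp n l a *+ q)%MM.
    elim: (q) leq => [|r ih] ler; first by exists mu; rewrite mulm0n addm0.
    have [|nu e] := ih; first by lia.
    have [|nu' e'] := @expo_split n l a nu v; last first.
      by exists nu'; rewrite e e' mulmS addmA.
    have er : expo mu l a = (expo nu l a + r)%N.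
      rewrite e expoD; congr (_ + _)%N; elim: (r) => [|r' ih']; first by rewrite mulm0n expo0.
      by rewrite mulmS expoD ih' expo_uexp v !eqxx.
    by lia.
  have [r e'] := mcoeff_iter_dx q g nu v; move: e'; rewrite h mcoeff0 -e => /esym/eqP.
  by rewrite -mulr_natr mulf_eq0 pnatr_eq0 orbF.
apply/mpolyP => mu; have [r ->] := mcoeff_iter_dx q g mu v; rewrite mcoeff0.
case: (eqVneq (g@_(mu + uexp n l a *+ q)) 0) => [->|/h]; first by rewrite mul0rn.
by rewrite exq; lia.
Qed.

(** On evaluated invariants the power of [rowop l] is, up to a nonzero polynomial factor, the same
    power of d/dx_{m,l}. Membership in the kernel thus becomes a separate bound on each exponent of
    row m. *)
Lemma invariant_row_kernel m M f : (m <= n)%N -> (M <= m)%N -> inv m f ->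
  (row_kernel M f <->
   forall mu, (ev m f)@_mu != 0 -> forall l, (1 <= l <= M)%N -> (expo mu m l <= kap l)%N).
Proof.
move=> lemn leMm invf.
have vl l : (1 <= l <= M)%N -> valid n m l by rewrite /valid; lia.
have key l : (1 <= l <= M)%N -> iter (kap l).+1 (rowop l) f = 0 <->
    iter (kap l).+1 (dx m l) (ev m f) = 0.
  move=> hl; have hl' : (1 <= l <= m)%N by lia.
  have e := ev_iter_rowop (kap l).+1 lemn hl' invf.
  split=> h; last first.
    apply: (invariant_ev_inj lemn); first exact: iter_rowop_invariant.
    by rewrite e h mulr0.
  move: e; rewrite h linear0 => /esym/eqP; rewrite !mulf_eq0 !expf_eq0 oppr_eq0 oner_eq0 /=.
  by rewrite (negbTE (row_coef_n0 l lemn)) => /eqP.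
split=> [h mu cmu l hl|h l hl].
  by have /(iter_dx_eq0 _ _ (vl l hl))/(_ mu cmu) := (key l hl).1 (h l hl).
by apply/key/iter_dx_eq0 => // [|mu cmu]; [apply: vl | apply: h].
Qed.

End RowKernel.

(** * Weights and degrees *)

Section Weights.
Variables (F : numClosedFieldType) (n : nat) (k : nat -> nat).
Local Notation N := 'C(n.+1, 2).
Local Notation P := {mpoly F[N]}.
Local Notation x := (@x F n).
Local Notation dx := (@dx F n).
Local Notation euler := (@euler F n).
Local Notation c := (@c F n k).
Local Notation tact := (@tact F n k).
Local Notation glact := (@glact F n k).
Local Notation expo := (@expo n).
Local Notation ev := (@ev F n).
Local Notation inv := (@gl_invariant F n k).
Local Notation hwv := (@hwv F n).

(** The scalar by which E_{a,a} of gl(m) acts on the constant 1 of C_{m-1}. *)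
Fixpoint gl_wt m a : F :=
  if m is m'.+1 then
    if (a <= m')%N then gl_wt m' a + c m / m%:R else c m / m%:R - c m'
  else 0.

Lemma c_real m : c m \is Num.real.
Proof.
by rewrite /Defs.c; apply: rpredM; [rewrite realN realV|]; exact: realn.
Qed.

Lemma gl_wt_real m a : gl_wt m a \is Num.real.
Proof.
elim: m => [|m ih] /=; first exact: real0.
have h q : c q / q%:R \is Num.real by rewrite rpred_div ?c_real ?realn.
by case: ifP => _; [apply: realD | apply: realB] => //; apply: c_real.
Qed.

(** This is where the constants c_m enter: they satisfy c_{m+1}/(m+1) - c_m + c_{m+1} =
    -kappa_{m+1}, so that each further level adds one kappa. *)
Lemma gl_wt_c m a : (1 <= a <= m)%N -> (m <= n)%N ->
  gl_wt m a + c m = - (\sum_(a <= j < m.+1) kap n k j)%:R.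
Proof.
elim: m => [|m ih]; first by lia.
move=> ha lemn.
have mc q : (q <= n)%N -> q.+1%:R * c q
    = - (\sum_(0 <= i < q) (q - i) * k (n - q + 1 + i))%:R :> F.
  by move=> _; rewrite /Defs.c mulrA mulrN mulfV ?pnatr_eq0 // mulN1r.
have key : c m.+1 / m.+1%:R - c m + c m.+1 = - (kap n k m.+1)%:R :> F.
  have m1 : m.+1%:R != 0 :> F by rewrite pnatr_eq0.
  apply: (mulfI m1); rewrite mulrDr mulrBr mulrCA mulfV // mulr1.
  rewrite (mc m); last exact: ltnW.
  have -> : c m.+1 - - (\sum_(0 <= i < m) (m - i) * k (n - m + 1 + i))%:R + m.+1%:R * c m.+1
      = m.+2%:R * c m.+1 + (\sum_(0 <= i < m) (m - i) * k (n - m + 1 + i))%:R.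
    by rewrite opprK -[m.+2%:R]natr1 mulrDl mul1r; ring.
  rewrite mc // big_nat_recl // subn0 natrD.
  have -> : (\sum_(0 <= i < m) (m.+1 - i.+1) * k (n - m.+1 + 1 + i.+1) =
             \sum_(0 <= i < m) (m - i) * k (n - m + 1 + i))%N.
    apply: eq_big_nat => i _; rewrite subSS; congr (_ * k _)%N; lia.
  rewrite opprD subrK natrM mulrN /kap; congr (- (_ * (k _)%:R)); lia.
rewrite /=; case: leqP => ham; last first.
  by rewrite key big_nat_recr; [|lia]; rewrite big_geq ?add0n //; lia.
rewrite big_nat_recr; last by lia.
rewrite natrD opprD -ih; [|lia|lia]; rewrite -key; ring.
Qed.

Lemma ev_glact_diag m M a f : (m <= M)%N -> (m <= n.+1)%N -> (1 <= a <= m)%N ->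
  ev M (glact m a a f) = gl_wt m a *: ev M f.
Proof.
elim: m a => [|m ih] a; first by lia.
move=> leM lemn ha /=.
have eva j g : (1 <= j <= m)%N -> ev M (x m j * g) = 0.
  by move=> hj; apply: ev_xM0; rewrite /valid; lia.
case: leqP => ham.
  rewrite eqxx mulr1n !linearD linearZ /= eva; last by lia.
  by rewrite add0r ih ?scalerDl //; lia.
rewrite linearB linearZ /= (_ : ev M (euler m f) = 0) ?subr0 //.
by rewrite linear_sum big_nat_cond big1 // => j /andP[hj _]; apply: eva; lia.
Qed.

(** For i < j every term of the recursion has a variable of a row below m as a left factor. *)
Lemma ev_glact_up m M i j f : (m <= M)%N -> (m <= n.+1)%N -> (1 <= i < j)%N -> (j <= m)%N ->
  ev M (glact m i j f) = 0.
Proof.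
elim: m => [|m ih]; first by lia.
move=> leM lemn hij hj /=.
have eva b g : (1 <= b <= m)%N -> ev M (x m b * g) = 0.
  by move=> hb; apply: ev_xM0; rewrite /valid; lia.
rewrite (_ : (i <= m)%N); last by lia.
case: leqP => hjm.
  rewrite [i == j]ltn_eqF ?mulr0n ?addr0; last by lia.
  by rewrite linearD /= eva ?add0r ?ih //; lia.
rewrite !linearD linearZ /= !eva ?scaler0 ?add0r; [|lia|lia].
by rewrite linear_sum big_nat_cond big1 // => b /andP[hb _]; apply: eva; lia.
Qed.

Lemma tact_x_gt m l i j a p : (m < l)%N -> tact m i j (x l a * p) = x l a * tact m i j p.
Proof.
move=> lt; rewrite /tact dx_xM_row ?glact_x 1?ltnW //; last by apply/eqP; lia.
by rewrite mulrDr mulrCA.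
Qed.

Lemma tact_dx_gt m l i j a p : (m < l)%N -> tact m i j (dx l a p) = dx l a (tact m i j p).
Proof.
move=> lt; rewrite /tact dxD glact_dx 1?ltnW //.
by rewrite dx_xM_row ?[dx l a (dx _ _ _)]dx_comm //; apply/eqP; lia.
Qed.

Section Level.
Variables (m : nat) (lemn : (m <= n)%N).

Definition tactI (i j : 'I_m) : {linear P -> P} := tact m i.+1 j.+1.

Let ee (i j a b : 'I_m) v : glact m i.+1 j.+1 (glact m a.+1 b.+1 v)
  = glact m a.+1 b.+1 (glact m i.+1 j.+1 v)
    + glact m i.+1 b.+1 v *+ (j == a) - glact m a.+1 j.+1 v *+ (i == b).
Proof. by apply: glact_rel; rewrite ?ltn_ord // leqW. Qed.

Lemma tactI_rel i j a b v : tactI i j (tactI a b v)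
  = tactI a b (tactI i j v) + tactI i b v *+ (j == a) - tactI a j v *+ (i == b).
Proof.
exact: (weyl_gl_gl (@level_XX F n m) (@level_YY F n m) (level_YX lemn)
  (@level_eX F n k m) (@level_eY F n k m) ee).
Qed.

Lemma tact_rel i j a b v : (1 <= i <= m)%N -> (1 <= j <= m)%N ->
  (1 <= a <= m)%N -> (1 <= b <= m)%N ->
  tact m i j (tact m a b v)
  = tact m a b (tact m i j v) + tact m i b v *+ (j == a) - tact m a j v *+ (i == b).
Proof.
move=> /andP[i1 im] /andP[j1 jm] /andP[a1 am] /andP[b1 bm].
have lt q : (0 < q)%N -> (q <= m)%N -> (q.-1 < m)%N by lia.
have := tactI_rel (Ordinal (lt i i1 im)) (Ordinal (lt j j1 jm))
  (Ordinal (lt a a1 am)) (Ordinal (lt b b1 bm)) v.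
rewrite /tactI -!val_eqE /= !prednK //.
by rewrite -(eqSS j.-1) -(eqSS i.-1) !prednK.
Qed.

Lemma invariant_tact_diag a f : (1 <= a <= m)%N -> inv m f -> inv m (tact m a a f).
Proof.
move=> ha invf s t hts les; rewrite tact_rel; [|lia..].
rewrite [tact m s t f]invf // linear0 add0r.
have [eta|nta] := eqVneq t a; have [esa|nsa] := eqVneq s a; rewrite ?mulr0n ?mulr1n.
- by lia.
- by rewrite -eta invf ?subr0.
- by rewrite -esa invf ?subr0.
by rewrite subr0.
Qed.

(** An operator that preserves the invariants may be computed on [hwv m mu] modulo the lower rows,
    because evaluation is injective on invariants. *)
Lemma hwv_eigen (A : {linear P -> P}) mu w : high m mu ->
  (forall f, inv m f -> inv m (A f)) -> ev m (A (hwv m mu)) = w *: 'X_[mu] ->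
  A (hwv m mu) = w *: hwv m mu.
Proof.
move=> hmu Ainv Aev; apply/eqP; rewrite -subr_eq0; apply/eqP.
have hi := @hwv_invariant F n k m mu lemn.
apply: (@invariant_ev_inj F n k m _ lemn).
  by move=> s t hts les; rewrite linearB linearZ /= hi // Ainv // scaler0 subr0.
by rewrite linearB linearZ /= Aev ev_hwv // subrr.
Qed.

Lemma hwv_weight a mu : (1 <= a <= m)%N -> high m mu ->
  tact m a a (hwv m mu) = ((expo mu m a)%:R + gl_wt m a) *: hwv m mu.
Proof.
move=> ha hmu; apply: hwv_eigen => //; first by move=> f; apply: invariant_tact_diag.
rewrite /tact linearD /= ev_xM ?ev_dx ?ev_glact_diag ?ev_hwv ?xdx_mpolyX ?scalerDl //; rewrite ?/valid; lia.
Qed.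

Lemma hwv_euler mu : high m mu ->
  euler m (hwv m mu) = (\sum_(1 <= a < m.+1) expo mu m a)%:R *: hwv m mu.
Proof.
move=> hmu; apply: hwv_eigen => //.
  move=> f invf s t hts les.
  have -> : tact m s t (euler m f) = euler m (tact m s t f); last by rewrite invf ?linear0.
  have ls : (s.-1 < m)%N by lia.
  have lt : (t.-1 < m)%N by lia.
  have := weyl_gl_euler (@level_XX F n m) (@level_YY F n m) (level_YX lemn)
    (@level_eX F n k m) (@level_eY F n k m) (Ordinal ls) (Ordinal lt) f.
  by rewrite /weyl_gl /weyl_euler /mulx /= !prednK ?eulerE //; lia.
rewrite linear_sum natr_sum scaler_suml; apply: eq_big_nat => a ha /=.
by rewrite ev_xM ?ev_dx ?ev_hwv ?xdx_mpolyX // /valid; lia.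
Qed.

Lemma hwv_degree l a mu : (m < l)%N -> high m mu ->
  x l a * dx l a (hwv m mu) = (expo mu l a)%:R *: hwv m mu.
Proof.
move=> ltml hmu.
case: (boolP (valid n l a)) => [v|nv]; last first.
  by rewrite dx_invalid // expo_invalid // mulr0 scale0r.
pose A : {linear P -> P} := mulx l a \o dx l a.
apply: (hwv_eigen (A := A)) => //.
  move=> f invf s t hts les.
  by rewrite /A /= /mulx tact_x_gt // tact_dx_gt // invf // linear0 mulr0.
by rewrite /A /= /mulx ev_xM ?ev_dx ?ev_hwv ?xdx_mpolyX // ltnW.
Qed.

End Level.

End Weights.

(** * Decomposition of a level under gl *)

Section Support.
Variables (F : numClosedFieldType) (n : nat) (k : nat -> nat).
Local Notation N := 'C(n.+1, 2).
Local Notation P := {mpoly F[N]}.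
Local Notation x := (@x F n).
Local Notation dx := (@dx F n).
Local Notation tact := (@tact F n k).
Local Notation glact := (@glact F n k).
Local Notation expo := (@expo n).

Definition supported (Q : 'X_{1..N} -> Prop) (f : P) : Prop := forall mu, f@_mu != 0 -> Q mu.

Lemma supported_subspace Q : subspace (supported Q).
Proof.
split=> [mu|a u v hu hv mu]; first by rewrite mcoeff0 eqxx.
rewrite mcoeffD mcoeffZ; case: (eqVneq (u@_mu) 0) => [->|/hu //].
by rewrite mulr0 add0r; apply: hv.
Qed.

Lemma supported_dx (Q Q' : 'X_{1..N} -> Prop) l a f :
  (forall mu, valid n l a -> Q (mu + uexp n l a)%MM -> Q' mu) ->
  supported Q f -> supported Q' (dx l a f).
Proof.
move=> h hf mu; case: (boolP (valid n l a)) => [v|/dx_invalid->]; last first.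
  by rewrite mcoeff0 eqxx.
rewrite mcoeff_dx //; case: (eqVneq (f@_(mu + uexp n l a)) 0) => [->|].
  by rewrite mul0rn eqxx.
by move=> /hf /(h _ v).
Qed.

Lemma supported_x (Q Q' : 'X_{1..N} -> Prop) l a f : valid n l a ->
  (forall mu, Q mu -> Q' (mu + uexp n l a)%MM) ->
  supported Q f -> supported Q' (x l a * f).
Proof.
move=> v h hf mu; case: (posnP (expo mu l a)) => [e|/(expo_split v)[nu ->]].
  by rewrite mcoeff_xM0 // eqxx.
by rewrite mcoeff_xM // => /hf /h.
Qed.

Lemma fspan_monomials (s : seq 'X_{1..N}) f : {subset msupp f <= s} ->
  fspan [seq ('X_[mu] : P) | mu <- s] f.
Proof.
elim: s f => [|mu s ih] f h /=.
  by apply: msuppnil0; case: (msupp f) h => // a l /(_ a (mem_head _ _)).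
exists f@_mu; apply: ih => nu; rewrite mcoeff_msupp mcoeffB mcoeffZ mcoeffX.
have [->|nmn] := eqVneq mu nu; first by rewrite mulr1 subrr eqxx.
rewrite mulr0 subr0 -mcoeff_msupp => /h; rewrite inE eq_sym (negbTE nmn).
by [].
Qed.

Lemma fspan_bounded (Q : 'X_{1..N} -> Prop) b : (forall mu, Q mu -> forall v, mu v <= b)%N ->
  exists L, forall f, supported Q f -> fspan L f.
Proof.
move=> hQ; exists [seq ('X_[mu] : P) | mu <- [seq val nu | nu <- enum {: 'X_{1..N < (N * b).+1}}]].
move=> f hf; apply: fspan_monomials => mu; rewrite mcoeff_msupp => /hf /hQ hmu.
have lt : (mdeg mu < (N * b).+1)%N.
  rewrite ltnS mdegE -[N in (N * _)%N]card_ord -sum_nat_const.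
  by apply: leq_sum => v _; apply: hmu.
by apply/mapP; exists (BMultinom lt); rewrite ?mem_enum.
Qed.

(* Column operations replace x_{l,t} by x_{l,s} with t < s, lowering this weight. *)
Definition col_filt d (f : P) := supported (fun mu => \sum_v mu v * ((row v).+1 - col v) < d)%N f.

Lemma sum_uexp mu l a (g : 'I_N -> nat) (g' : nat -> nat -> nat) :
  valid n l a -> (forall v, g v = g' (row v) (col v)) ->
  (\sum_v (mu + uexp n l a)%MM v * g v = \sum_v mu v * g v + g' l a)%N.
Proof.
move=> /var_idxP[w e] hg; rewrite /uexp e; have [er ec] := rowcolE e.
under eq_bigr => v _ do rewrite mnmDE mnm1E mulnDl.
rewrite big_split /=; congr (_ + _)%N.
rewrite (bigD1 w) //= eqxx mul1n big1 ?addn0 ?hg ?er ?ec // => v.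
by rewrite eq_sym => /negbTE->.
Qed.

Lemma col_filtE f : exists d, col_filt d f.
Proof.
pose g (mu : 'X_{1..N}) := (\sum_v mu v * ((row v).+1 - col v))%N.
exists (\max_(mu <- msupp f) g mu).+1 => mu; rewrite -mcoeff_msupp => h.
by rewrite ltnS -/(g mu); apply: (leq_bigmax_seq (F := g)).
Qed.

Lemma col_filt0 f : col_filt 0 f -> f = 0.
Proof.
move=> h; apply/mpolyP => mu; rewrite mcoeff0.
by case: (eqVneq (f@_mu) 0) => // /h.
Qed.

Lemma col_filt_tact m s t d f : (m <= n)%N -> (1 <= t < s)%N -> (s <= m)%N ->
  col_filt d.+1 f -> col_filt d (tact m s t f).
Proof.
move=> lemn hts les hf; rewrite tact_low //.
pose g l a := (l.+1 - a)%N.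
apply: subspace_sum; first exact: supported_subspace.
move=> l; rewrite mem_index_iota => /andP[gl ltl] _.
have vt : valid n l t by rewrite /valid; lia.
have Hd e : col_filt e.+1 f -> supported
    (fun mu => \sum_v mu v * ((row v).+1 - col v) + g l t < e.+1)%N (dx l t f).
  by apply: supported_dx => mu _; rewrite (sum_uexp _ (g' := g)).
have [els|nls] := eqVneq l s.-1.
  rewrite els x_sup_pred ?mulN1r; last by lia.
  apply: (subspaceN (supported_subspace _)).
  by move=> mu; rewrite -els => /(Hd _ hf); rewrite /g; lia.
have vs : valid n l s by rewrite /valid; lia.
apply: (supported_x vs) (Hd _ hf) => mu; rewrite (sum_uexp _ (g' := g)) // /g; lia.
Qed.

(** A bound on this degree is preserved by gl(m), and together with a bound on the lower exponents
    it cuts out finite-dimensional submodules. *)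
Definition top_deg m (mu : 'X_{1..N}) : nat := \sum_(v | (m <= row v)%N) mu v.

Lemma top_degD m mu l a : valid n l a ->
  top_deg m (mu + uexp n l a)%MM = (top_deg m mu + (m <= l))%N.
Proof.
move=> v; rewrite /top_deg.
have e nu : (\sum_(v | m <= row v) (nu : 'X_{1..N}) v = \sum_v nu v * (m <= row v))%N.
  rewrite big_mkcond; apply: eq_bigr => w _.
  by case: (m <= row w)%N; rewrite ?muln1 ?muln0.
by rewrite !e (sum_uexp _ (g' := fun l _ => (m <= l)%N : nat)).
Qed.

Lemma top_deg_glact m q i j d f : (m <= q)%N -> (m <= n.+1)%N -> (1 <= i <= m)%N -> (1 <= j <= m)%N ->
  supported (fun mu => top_deg q mu <= d)%N f ->
  supported (fun mu => top_deg q mu <= d)%N (glact m i j f).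
Proof.
set S := supported _; have sS : subspace S by apply: supported_subspace.
have Sdx l a g : S g -> S (dx l a g).
  by apply: supported_dx => mu v; rewrite top_degD //; lia.
have Sx l a g : (1 <= a <= l)%N -> (l < q)%N -> (l <= n)%N -> S g -> S (x l a * g).
  move=> ha ltl lel; have v : valid n l a by rewrite /valid; lia.
  by apply: (supported_x v) => mu; rewrite top_degD //; lia.
elim: m i j f => [|m ih] i j f; first by lia.
move=> ltmq lemn hi hj Sf /=.
have Se : S (euler m f).
  apply: (subspace_sum sS) => a; rewrite mem_index_iota => ha _.
  by apply: Sx; rewrite ?ltnS in lemn *; try lia; apply: Sdx.
case: leqP => him; case: leqP => hjm.
- apply: (subspaceD sS); last by apply: (subspaceMn _ sS); apply: (subspaceZ _ sS).
  by apply: (subspaceD sS); [apply: Sx; [lia..|exact: Sdx] | apply: ih => //; lia].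
- apply: (subspaceD sS).
    apply: (subspaceD sS); first by apply: Sx => //; lia.
    by apply: (subspaceZ _ sS); apply: Sx => //; lia.
  apply: (subspace_sum sS) => r; rewrite mem_index_iota => hr _.
  by apply: Sx; [lia..|apply: ih => //; lia].
- by apply: (subspaceN sS); apply: Sdx.
by apply: (subspaceB sS) => //; apply: (subspaceZ _ sS).
Qed.

Lemma top_deg_tact m i j d f : (m <= n)%N -> (1 <= i <= m)%N -> (1 <= j <= m)%N ->
  supported (fun mu => top_deg m mu <= d)%N f ->
  supported (fun mu => top_deg m mu <= d)%N (tact m i j f).
Proof.
move=> lemn hi hj hf; apply: (subspaceD (supported_subspace _)).
  have vi : valid n m i by rewrite /valid; lia.
  apply: (supported_x vi (Q := fun mu => (top_deg m mu).+1 <= d)%N) => [mu|].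
    by rewrite top_degD // leqnn addn1.
  by apply: supported_dx hf => mu vj; rewrite top_degD // leqnn addn1.
by apply: top_deg_glact => //; lia.
Qed.

End Support.

(** * Contravariant forms on a level and the orthogonal decomposition *)

Section LevelForm.
Variables (F : numClosedFieldType) (n : nat) (k : nat -> nat).
Local Notation N := 'C(n.+1, 2).
Local Notation P := {mpoly F[N]}.
Local Notation x := (@x F n).
Local Notation dx := (@dx F n).
Local Notation tact := (@tact F n k).
Local Notation glact := (@glact F n k).
Local Notation expo := (@expo n).
Local Notation ev := (@ev F n).
Local Notation inv := (@gl_invariant F n k).
Local Notation hwv := (@hwv F n).
Local Notation row_kernel := (@row_kernel F n k).
Local Notation kap := (kap n k).

(** The induction hypothesis on m. The rows above m stay free, and by [lf_x] the form is of Fischer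
    type in them, which is what the next level needs; [lf_bound] keeps the rows up to m within
    finite dimension. *)
Record level_form m (B : P -> P -> F) := LevelForm {
  lf_stable : forall i j u, (1 <= i <= m.+1)%N -> (1 <= j <= m.+1)%N ->
    row_kernel m u -> row_kernel m (glact m.+1 i j u);
  lf_form : pos_form (row_kernel m) B;
  lf_gl : forall i j u v, (1 <= i <= m.+1)%N -> (1 <= j <= m.+1)%N ->
    row_kernel m u -> row_kernel m v -> B (glact m.+1 i j u) v = B u (glact m.+1 j i v);
  lf_x : forall l a u v, (m < l)%N -> valid n l a -> row_kernel m u -> row_kernel m v ->
    B (x l a * u) v = B u (dx l a v);
  lf_bound : exists b, forall f, row_kernel m f ->
    supported (fun mu => forall l a, (l <= m)%N -> expo mu l a <= b)%N f }.

Section Decomposition.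
Variables (m' : nat) (B : P -> P -> F).
Local Notation m := m'.+1.
Hypotheses (lemn : (m <= n)%N) (lf : level_form m' B).
Local Notation W := (row_kernel m').
Local Notation T := (@tactI F n k m).

Let sW : subspace W. Proof. exact: row_kernel_subspace. Qed.
Let fB : pos_form W B. Proof. exact: (lf_form lf). Qed.
Let hm : (1 <= m <= n)%N. Proof. by []. Qed.

Lemma level_tact i j u : (1 <= i <= m)%N -> (1 <= j <= m)%N -> W u -> W (tact m i j u).
Proof.
by move=> hi hj Wu; apply: (row_kernel_tact hm hi hj _ (M := m')) => //; [move=> *; apply: (lf_stable lf) | lia].
Qed.

Lemma level_x l a u : (m <= l)%N -> W u -> W (x l a * u).
Proof. by move=> *; apply: row_kernel_x. Qed.

Lemma level_dx l a u : (m <= l)%N -> W u -> W (dx l a u).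
Proof. by move=> *; apply: row_kernel_dx => //; apply: ltnW. Qed.

Lemma level_xr l a u v : (m <= l)%N -> valid n l a -> W u -> W v ->
  B u (x l a * v) = B (dx l a u) v.
Proof.
move=> ml vl Wu Wv; rewrite (pos_formC fB) // ?(lf_x lf) //; last exact: level_x.
by rewrite -(pos_formC fB) //; apply: level_dx.
Qed.

Lemma level_tact_adj i j u v : (1 <= i <= m)%N -> (1 <= j <= m)%N -> W u -> W v ->
  B (tact m i j u) v = B u (tact m j i v).
Proof.
move=> hi hj Wu Wv.
have vi : valid n m i by rewrite /valid; lia.
have vj : valid n m j by rewrite /valid; lia.
have Wd a f : W f -> W (dx m a f) by apply: level_dx.
have Wg i' j' f : (1 <= i' <= m)%N -> (1 <= j' <= m)%N -> W f -> W (glact m i' j' f).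
  by move=> *; apply: (lf_stable lf).
have Wx a f : W f -> W (x m a * dx m j f) by move=> Wf; apply: level_x => //; apply: Wd.
have [Wdu Wdv Wgu Wgv] := And4 (Wd j u Wu) (Wd i v Wv) (Wg i j u hi hj Wu) (Wg j i v hj hi Wv).
have Wxu := level_x i (leqnn _) Wdu; have Wxv := level_x j (leqnn _) Wdv.
rewrite /tact (pformDl fB Wxu Wgu Wv) (pformDr sW fB Wu Wxv Wgv).
by rewrite (lf_gl lf) // (lf_x lf) // level_xr.
Qed.

Lemma level_finite v : W v -> exists (S : P -> Prop) (L : seq P),
  [/\ subspace S, forall i j u, S u -> S (T i j u), S v,
      forall u, S u -> W u & forall u, S u -> fspan L u].
Proof.
move=> Wv; have [b hb] := lf_bound lf.
pose d := (\max_(mu <- msupp v) top_deg m mu)%N.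
pose S f := W f /\ supported (fun mu => top_deg m mu <= d)%N f.
have sS : subspace S.
  have s2 := @supported_subspace F n (fun mu : 'X_{1..N} => top_deg m mu <= d)%N.
  split; first by split; [case: sW | case: s2].
  by move=> a y z [? ?] [? ?]; split; [apply: (subspaceL _ sW) | apply: (subspaceL _ s2)].
pose Q (mu : 'X_{1..N}) := (forall l a, (l <= m')%N -> expo mu l a <= b)%N /\ (top_deg m mu <= d)%N.
have [|L hL] := @fspan_bounded F n Q (b + d).
  move=> mu [h1 h2] w; case: (leqP (row w) m') => hw.
    by rewrite -expo_rowcol (leq_trans (h1 _ _ hw)) ?leq_addr.
  by rewrite (leq_trans _ (leq_trans h2 (leq_addl _ _))) // /top_deg (bigD1 w) //= leq_addr.
exists S, L; split=> //.
- move=> i j u [Wu Su]; split; first by apply: level_tact; rewrite ?ltn_ord.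
  by apply: top_deg_tact; rewrite ?ltn_ord.
- split=> // mu; rewrite -mcoeff_msupp => hmu.
  exact: (leq_bigmax_seq (F := top_deg m) _ hmu).
- by move=> u [].
by move=> u [Wu Su]; apply: hL => mu hmu; split; [apply: (hb u Wu) | apply: Su].
Qed.

(** Distinct indices differ either in row m, where a weight of gl(m) separates them, or in a higher
    row, where the degree in one variable does. Both are eigenvalues of self-adjoint operators and
    are real. *)
Lemma hwv_orth mu nu : W (hwv m mu) -> W (hwv m nu) -> high m mu -> high m nu ->
  mu != nu -> B (hwv m mu) (hwv m nu) = 0.
Proof.
move=> Wm Wn hmu hnu ne.
have [l [a [vla nla]]] : exists l a, valid n l a /\ expo mu l a != expo nu l a.
  case: (classic (exists l a, valid n l a /\ expo mu l a != expo nu l a)) => // nh.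
  case/eqP: ne; apply: expoP => l a vla; apply/eqP/negPn/negP => h.
  by apply: nh; exists l, a.
have lel : (m <= l)%N.
  rewrite leqNgt; apply: contra nla => lt.
  by rewrite (elimT (highP _ _) hmu l a lt) (elimT (highP _ _) hnu l a lt).
have sep (A : {linear P -> P}) s t : (forall u v, W u -> W v -> B (A u) v = B u (A v)) ->
    A (hwv m mu) = s *: hwv m mu -> A (hwv m nu) = t *: hwv m nu -> t \is Num.real ->
    s != t -> B (hwv m mu) (hwv m nu) = 0.
  move=> Aadj es et rt nst; have := Aadj _ _ Wm Wn.
  rewrite es et (pformZl sW fB) // (pformZr sW fB) // conj_Creal //.
  move/eqP; rewrite -subr_eq0 -mulrBl mulf_eq0 subr_eq0 (negbTE nst) /=.
  by move=> /eqP.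
have [elm|nlm] := eqVneq l m.
  have ha : (1 <= a <= m)%N by move: vla; rewrite /valid; lia.
  apply: (sep (tact m a a) _ _ _ (@hwv_weight F n k m lemn a mu ha hmu) (@hwv_weight F n k m lemn a nu ha hnu)).
  - by move=> u v Wu Wv; apply: level_tact_adj.
  - by rewrite realD ?realn ?gl_wt_real.
  by rewrite (inj_eq (addIr _)) eqr_nat -elm.
have ltl : (m < l)%N by rewrite ltn_neqAle eq_sym nlm.
pose A : {linear P -> P} := mulx l a \o dx l a.
apply: (sep A _ _ _ (@hwv_degree F n k m lemn l a mu ltl hmu) (@hwv_degree F n k m lemn l a nu ltl hnu)).
- move=> u v Wu Wv; rewrite /A /= /mulx (lf_x lf) //; [|by apply: level_dx..].
  by rewrite level_xr //; apply: level_dx.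
- exact: realn.
by rewrite eqr_nat.
Qed.

Section Submodule.
Variable W' : P -> Prop.
Hypotheses (sW' : subspace W') (W'W : forall u, W' u -> W u)
  (TW' : forall i j u, (1 <= i <= m)%N -> (1 <= j <= m)%N -> W' u -> W' (tact m i j u))
  (W'_hwv : forall f mu, W' f -> inv m f -> f@_mu != 0 -> high m mu -> W' (hwv m mu)).

(** The decomposition is applied to several submodules [W'] of the same kernel: with the condition
    on row m added, without higher variables, or of fixed degree in the last row. *)
Definition sub_idx mu : Prop := high m mu /\ W' (hwv m mu).

Definition comp mu : P -> Prop := low T (hwv m mu).

Let fB' : pos_form W' B. Proof. exact: pos_form_sub fB. Qed.

Let TT := @tactI_rel F n k m lemn.

Let TI (i j : 'I_m) u : W' u -> W' (T i j u).
Proof. by apply: TW'; rewrite ltn_ord. Qed.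

Let TB (i j : 'I_m) u v : W' u -> W' v -> B (T i j u) v = B u (T j i v).
Proof. by move=> Wu Wv; apply: level_tact_adj; rewrite ?ltn_ord //; apply: W'W. Qed.

Let FlT d (s t : 'I_m) u : (t < s)%N -> @col_filt F n d.+1 u -> @col_filt F n d (T s t u).
Proof. by move=> lts; apply: col_filt_tact; rewrite ?ltn_ord. Qed.

Let fdW v : W' v -> exists (S : P -> Prop) (L : seq P),
  [/\ subspace S, forall i j u, S u -> S (T i j u), S v,
      forall u, S u -> W' u & forall u, S u -> fspan L u].
Proof.
move=> Wv; have [S [L [sS TS Sv SW SL]]] := level_finite (W'W Wv).
exists (fun u => S u /\ W' u), L; split=> //.
- split; first by split; [case: sS | case: sW'].
  by move=> a y z [? ?] [? ?]; split; [apply: (subspaceL _ sS) | apply: (subspaceL _ sW')].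
- by move=> i j u [Su Wu]; split; [apply: TS | apply: TI].
- by move=> u [].
by move=> u [/SL].
Qed.

Let xiW mu : sub_idx mu -> W' (hwv m mu). Proof. by case. Qed.

Let xi_inv mu : sub_idx mu -> gl_inv T (hwv m mu).
Proof. by move=> _ s t lts; apply: hwv_invariant; rewrite ?ltn_ord. Qed.

Let xi_n0 mu : sub_idx mu -> hwv m mu != 0.
Proof. by case=> /hwv_n0. Qed.

Let xi_wt mu (a : 'I_m) : sub_idx mu ->
  T a a (hwv m mu) = ((expo mu m a.+1)%:R + gl_wt F n k m a.+1) *: hwv m mu.
Proof. by case=> hmu _; apply: hwv_weight; rewrite ?ltn_ord. Qed.

Let xi_orth mu nu : sub_idx mu -> sub_idx nu -> mu != nu -> B (hwv m mu) (hwv m nu) = 0.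
Proof. by move=> [h1 h2] [h3 h4]; apply: hwv_orth => //; apply: W'W. Qed.

Lemma gl_invI f : gl_inv T f <-> inv m f.
Proof.
split=> [h s t /andP[t1 lts] les|h s t lts]; last by apply: h; rewrite ?ltn_ord.
have hs : (s.-1 < m)%N by lia.
have ht : (t.-1 < m)%N by lia.
have := h (Ordinal hs) (Ordinal ht); rewrite /tactI /= !prednK //; last by lia.
by apply; lia.
Qed.

Let inv_span f : W' f -> gl_inv T f -> lspan (fun u => exists2 mu, sub_idx mu & u = hwv m mu) f.
Proof.
move=> Wf /gl_invI invf; rewrite (invariant_sum lemn invf).
apply: (subspace_sum (lspan_subspace _)) => mu; rewrite mcoeff_msupp => hmu _.
apply: (subspaceZ _ (lspan_subspace _)).
have [hh|nh] := boolP (high m mu); last by rewrite hwv_low //; case: (lspan_subspace (fun u => exists2 mu, sub_idx mu & u = hwv m mu)).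
by apply: lspan_in; exists mu => //; split=> //; apply: (W'_hwv Wf).
Qed.

Lemma sub_decomposition v : W' v -> lspan (fun u => exists2 mu, sub_idx mu & comp mu u) v.
Proof.
exact: (low_decomposition TT (@col_filtE F n) (@col_filt0 F n) FlT sW' fB' TB fdW
  xi_inv xi_wt inv_span).
Qed.

Lemma sub_comp_stable mu i j u : sub_idx mu -> (1 <= i <= m)%N -> (1 <= j <= m)%N ->
  comp mu u -> comp mu (tact m i j u).
Proof.
move=> hmu /andP[i1 im] /andP[j1 jm] hu.
have hi : (i.-1 < m)%N by lia.
have hj : (j.-1 < m)%N by lia.
have := lowT TT xi_inv xi_wt (Ordinal hi) (Ordinal hj) hmu hu.
by rewrite /tactI /= !prednK.
Qed.

Lemma sub_comp_sub mu u : sub_idx mu -> comp mu u -> W' u.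
Proof. exact: (lowW sW' TI xiW). Qed.

Lemma sub_comp_orth mu nu u v : sub_idx mu -> sub_idx nu -> mu != nu ->
  comp mu u -> comp nu v -> B u v = 0.
Proof. exact: (low_orth TT sW' fB' TI TB xiW xi_inv xi_wt xi_orth). Qed.

Lemma sub_comp_irreducible mu (S : P -> Prop) v : sub_idx mu -> subspace S ->
  (forall i j u, (1 <= i <= m)%N -> (1 <= j <= m)%N -> i != j -> S u -> S (tact m i j u)) ->
  (forall u, S u -> comp mu u) -> S v -> v != 0 -> forall u, comp mu u -> S u.
Proof.
move=> hmu sS TS SC Sv v0.
apply: (low_irreducible (@col_filtE F n) (@col_filt0 F n) FlT sW' fB' TI TB xiW xi_inv
  xi_n0 hmu sS _ SC Sv v0).
by move=> a b u nab; apply: TS; rewrite ?ltn_ord.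
Qed.

Section Rescaling.
Variable delta : 'X_{1..N} -> F.
Hypothesis delta_gt0 : forall mu, sub_idx mu -> 0 < delta mu.

Lemma sub_rescale : exists2 B' : P -> P -> F, pos_form W' B' &
  forall A A' : {linear P -> P},
    (forall v, W' v -> W' (A v)) -> (forall v, W' v -> W' (A' v)) ->
    (forall mu nu u v, sub_idx mu -> sub_idx nu -> comp mu u -> comp nu v ->
       delta nu ^+ 2 * B (A u) v = delta mu ^+ 2 * B u (A' v)) ->
    forall u v, W' u -> W' v -> B' (A u) v = B' u (A' v).
Proof.
exists (rescaled_form TT (@col_filtE F n) (@col_filt0 F n) FlT sW' fB' TI TB fdW xiW
  xi_inv xi_wt xi_orth inv_span delta_gt0); first exact: rescaled_pos_form.
by move=> A A' WA WA' h u v Wu Wv; apply: rescaled_adjoint.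
Qed.

End Rescaling.

End Submodule.

End Decomposition.

End LevelForm.

(** * The raising operators on the components *)

Section GlactCases.
Variables (F : numClosedFieldType) (n : nat) (k : nat -> nat).
Local Notation N := 'C(n.+1, 2).
Local Notation x := (@x F n).
Local Notation dx := (@dx F n).
Local Notation euler := (@euler F n).
Local Notation c := (@c F n k).
Local Notation tact := (@tact F n k).
Local Notation glact := (@glact F n k).
Local Notation gl_wt := (@gl_wt F n k).

Lemma glact_inner m i j u : (i <= m)%N -> (j <= m)%N ->
  glact m.+1 i j u = tact m i j u + ((c m.+1 / m.+1%:R) *: u) *+ (i == j).
Proof. by move=> hi hj; rewrite /= hi hj. Qed.

Lemma glact_raise m i u : (i <= m)%N -> glact m.+1 i m.+1 u
  = x m i * euler m u + c m *: (x m i * u) + \sum_(1 <= r < m.+1) x m r * glact m i r u.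
Proof. by move=> hi; rewrite /= hi ltnn. Qed.

Lemma glact_lower m j u : (j <= m)%N -> glact m.+1 m.+1 j u = - dx m j u.
Proof. by move=> hj; rewrite /= ltnn hj. Qed.

Lemma glact_last m u : glact m.+1 m.+1 m.+1 u = (c m.+1 / m.+1%:R - c m) *: u - euler m u.
Proof. by rewrite /= ltnn. Qed.

End GlactCases.

Arguments glact : simpl never.
Arguments gl_wt : simpl never.

Section Raising.
Variables (F : numClosedFieldType) (n : nat) (k : nat -> nat).
Local Notation N := 'C(n.+1, 2).
Local Notation P := {mpoly F[N]}.
Local Notation x := (@x F n).
Local Notation dx := (@dx F n).
Local Notation euler := (@euler F n).
Local Notation c := (@c F n k).
Local Notation tact := (@tact F n k).
Local Notation glact := (@glact F n k).
Local Notation expo := (@expo n).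
Local Notation inv := (@gl_invariant F n k).
Local Notation hwv := (@hwv F n).
Local Notation row_kernel := (@row_kernel F n k).
Local Notation kap := (kap n k).
Local Notation gl_wt := (@gl_wt F n k).

Variables (m' : nat) (B : P -> P -> F).
Local Notation m := m'.+1.
Hypotheses (lemn : (m <= n)%N) (lf : level_form k m' B).
Local Notation W := (row_kernel m').
Local Notation comp := (@comp F n k m').

Let sW : subspace W. Proof. exact: row_kernel_subspace. Qed.
Let fB : pos_form W B. Proof. exact: (lf_form lf). Qed.

Definition casimir (u : P) : P :=
  \sum_(r < m) \sum_(s < m) x m r.+1 * dx m s.+1 (glact m s.+1 r.+1 u).

Lemma casimir_linear : linear casimir.
Proof.
move=> a u v; rewrite /casimir scaler_sumr -big_split; apply: eq_bigr => r _ /=.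
rewrite scaler_sumr -big_split; apply: eq_bigr => s _ /=.
by rewrite glact_linear dxD dxZ mulrDr scalerAr.
Qed.
HB.instance Definition _ := GRing.isLinear.Build F P P *:%R casimir casimir_linear.

Lemma casimir_tact i j u : (1 <= i <= m)%N -> (1 <= j <= m)%N ->
  tact m i j (casimir u) = casimir (tact m i j u).
Proof.
move=> hi hj.
have li : (i.-1 < m)%N by lia.
have lj : (j.-1 < m)%N by lia.
have ee (p q a b : 'I_m) v : glact m p.+1 q.+1 (glact m a.+1 b.+1 v)
  = glact m a.+1 b.+1 (glact m p.+1 q.+1 v)
    + glact m p.+1 b.+1 v *+ (q == a) - glact m a.+1 q.+1 v *+ (p == b).
  by apply: glact_rel; rewrite ?ltn_ord // leqW.
have := weyl_gl_casimir (@level_XX F n m) (@level_YY F n m) (level_YX lemn)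
    (@level_eX F n k m) (@level_eY F n k m) ee (Ordinal li) (Ordinal lj) u.
by rewrite /weyl_gl /weyl_casimir /mulx /= !prednK //; lia.
Qed.

Lemma raiseE i u : (1 <= i <= m)%N -> glact m.+1 i m.+1 u
  = x m i * euler m u + c m *: (x m i * u) + (casimir (x m i * u) - x m i * casimir u).
Proof.
move=> hi; have li : (i.-1 < m)%N by lia.
rewrite glact_raise; last by lia.
congr (_ + _); rewrite big_ord1.
have := weyl_raise_e (@level_XX F n m) (level_YX lemn)
    (@level_eX F n k m) (Ordinal li) u.
by rewrite /weyl_casimir /mulx /= !prednK //; lia.
Qed.

Lemma tact_dx i j a u : (1 <= i <= m)%N -> (1 <= j <= m)%N ->
  dx m a (tact m i j u) = tact m i j (dx m a u) + dx m j u *+ (a == i).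
Proof.
move=> hi hj; have v : valid n m i by rewrite /valid; lia.
rewrite /tact dxD dx_xM glact_dx // [dx m a (dx _ _ _)]dx_comm.
have [->|nai] := eqVneq a i; first by rewrite v eqxx !mulr1n; zmod.
by rewrite !andbF !mulr0n; zmod.
Qed.

Lemma tact_x i j a u : (1 <= i <= m)%N -> (1 <= j <= m)%N -> (1 <= a <= m)%N ->
  tact m i j (x m a * u) = x m a * tact m i j u + (x m i * u) *+ (j == a).
Proof.
move=> hi hj ha; have v : valid n m j by rewrite /valid; lia.
rewrite /tact dx_xM glact_x // v eqxx /= !mulrDr mulrnAr mulrCA; zmod.
Qed.

Let vm i : (1 <= i <= m)%N -> valid n m i. Proof. by rewrite /valid; lia. Qed.

Lemma casimir_W u : W u -> W (casimir u).
Proof.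
move=> Wu; do 2!(apply: (subspace_sum sW) => ? _ _).
apply: level_x => //; apply: level_dx => //.
by apply: (lf_stable lf); rewrite ?ltn_ord.
Qed.

Lemma casimir_adj u v : W u -> W v -> B (casimir u) v = B u (casimir v).
Proof.
move=> Wu Wv.
have Wg (s r : 'I_m) f : W f -> W (glact m s.+1 r.+1 f).
  by move=> Wf; apply: (lf_stable lf); rewrite ?ltn_ord.
have Wt (s r q : 'I_m) f : W f -> W (x m q.+1 * dx m s.+1 (glact m s.+1 r.+1 f)).
  by move=> Wf; apply: level_x => //; apply: level_dx => //; apply: Wg.
have vI (i : 'I_m) : valid n m i.+1 by apply: vm; rewrite ltn_ord.
rewrite (pform_suml sW fB) //; last by move=> r _ _; apply: (subspace_sum sW) => s _ _; apply: Wt.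
rewrite (pform_sumr sW fB) //; last by move=> r _ _; apply: (subspace_sum sW) => s _ _; apply: Wt.
under eq_bigr => r _.
  rewrite (pform_suml sW fB) //; last by move=> s _ _; apply: Wt.
  over.
under [RHS]eq_bigr => r _.
  rewrite (pform_sumr sW fB) //; last by move=> s _ _; apply: Wt.
  over.
rewrite exchange_big; apply: eq_bigr => s _; apply: eq_bigr => r _.
have Wd l f : W f -> W (dx m l f) by move=> ?; apply: level_dx.
have Wx l f : W f -> W (x m l * f) by move=> ?; apply: level_x.
rewrite (lf_x lf) //; [|by apply: Wd; apply: Wg].
rewrite -(level_xr lf) //; [|by apply: Wg|by apply: Wd].
rewrite (lf_gl lf) ?ltn_ord //; [|by apply: Wx; apply: Wd].
by rewrite glact_x // glact_dx.
Qed.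

Definition casimir_wt (mu : 'X_{1..N}) : F :=
  \sum_(r < m) \sum_(s < m) (if (s < r)%N then 0 else
     if s == r then gl_wt m r.+1 * (expo mu m r.+1)%:R
     else - ((expo mu m s.+1).+1 * expo mu m r.+1)%:R).

Lemma casimir_wt_real mu : casimir_wt mu \is Num.real.
Proof.
apply: sum_real => r _; apply: sum_real => s _.
case: ifP => _; first exact: real0.
case: ifP => _; first by rewrite realM ?realn ?gl_wt_real.
by rewrite realN realn.
Qed.

(** Each term is evaluated modulo the lower rows. It vanishes for s < r; for s = r it is a weight
    times an exponent; for s > r invariance replaces the action of E_{s,r} on C_{m-1} by -x_{m,s}
    d/dx_{m,r}. *)
Lemma hwv_casimir mu : high m mu -> casimir (hwv m mu) = casimir_wt mu *: hwv m mu.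
Proof.
move=> hmu; apply: (hwv_eigen (k := k) lemn (A := casimir)) => //.
  by move=> f invf s t hts les; rewrite casimir_tact ?invf ?linear0 //; lia.
rewrite linear_sum scaler_suml; apply: eq_bigr => r _ /=.
rewrite linear_sum scaler_suml; apply: eq_bigr => s _ /=.
have hr : (1 <= r.+1 <= m)%N by rewrite ltn_ord.
have hs : (1 <= s.+1 <= m)%N by rewrite ltn_ord.
rewrite ev_xM ?vm // ev_dx //; case: ltnP => [lt|ge].
  by rewrite ev_glact_up ?linear0 ?mulr0 ?scale0r //; lia.
case: eqVneq => [->|nsr].
  rewrite ev_glact_diag //; last by lia.
  by rewrite ev_hwv // dxZ -scalerAr xdx_mpolyX scalerA.
have hts : (1 <= r.+1 < s.+1)%N by rewrite /= ltnS ltn_neqAle eq_sym nsr.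
have := @hwv_invariant F n k m mu lemn s.+1 r.+1 hts (ltn_ord s).
rewrite /tact => /eqP; rewrite addrC addr_eq0 => /eqP ->.
rewrite linearN /= ev_xM ?vm // ev_dx // ev_hwv // dxN mulrN scaleNr.
congr (- _); rewrite dx_xM vm // !eqxx mulr1n mulrDr xdx_mpolyX.
have -> : x m r.+1 * (x m s.+1 * dx m s.+1 (dx m r.+1 'X_[mu]))
    = x m s.+1 * dx m s.+1 (x m r.+1 * dx m r.+1 'X_[mu]).
  have nsr' : (s.+1 == r.+1) = false by apply/negbTE.
  by rewrite (dx_xM m s.+1 m r.+1) nsr' !andbF mulr0n addr0 mulrCA.
rewrite xdx_mpolyX dxZ -scalerAr xdx_mpolyX scalerA -scalerDl -natrM -natrD.
by congr (_%:R *: _); lia.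
Qed.

Lemma row_kernel_hwvE M mu : (M <= m)%N -> high m mu ->
  (row_kernel M (hwv m mu) <-> forall l, (1 <= l <= M)%N -> (expo mu m l <= kap l)%N).
Proof.
move=> leM hmu; have invh := @hwv_invariant F n k m mu lemn.
have key := @invariant_row_kernel F n k m M (hwv m mu) lemn leM invh.
split=> [h l hl|h].
  by apply: (key.1 h mu) => //; rewrite ev_hwv // mcoeffX eqxx oner_neq0.
apply: key.2 => nu; rewrite ev_hwv // mcoeffX; case: (eqVneq mu nu) => [<- _|_]; first exact: h.
by rewrite eqxx.
Qed.

Lemma row_kernel_hwv M f mu : (M <= m)%N -> row_kernel M f -> inv m f ->
  f@_mu != 0 -> high m mu -> row_kernel M (hwv m mu).
Proof.
move=> leM hf invf fmu hmu; apply/row_kernel_hwvE => // l hl.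
have key := @invariant_row_kernel F n k m M f lemn leM invf.
by apply: (key.1 hf) => //; rewrite mcoeff_ev hmu.
Qed.

Lemma row_kernel_tactM M i j u : (m' <= M <= m)%N -> (1 <= i <= m)%N -> (1 <= j <= m)%N ->
  row_kernel M u -> row_kernel M (tact m i j u).
Proof.
move=> hM hi hj; apply: row_kernel_tact => //.
by move=> v; apply: (lf_stable lf).
Qed.

Local Notation SI := (sub_idx m' W).

Let WW u : W u -> W u. Proof. by []. Qed.
Let TW i j u : (1 <= i <= m)%N -> (1 <= j <= m)%N -> W u -> W (tact m i j u).
Proof. by apply: row_kernel_tactM; lia. Qed.

Lemma comp_W mu u : SI mu -> comp mu u -> W u.
Proof. exact: (sub_comp_sub sW TW). Qed.

Lemma comp_orth mu nu u v : SI mu -> SI nu -> mu != nu -> comp mu u -> comp nu v -> B u v = 0.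
Proof. exact: (sub_comp_orth lemn lf sW WW TW). Qed.

Lemma comp_tact mu i j u : SI mu -> (1 <= i <= m)%N -> (1 <= j <= m)%N ->
  comp mu u -> comp mu (tact m i j u).
Proof. by move=> *; apply: (sub_comp_stable lemn (W' := W)). Qed.

Lemma comp_subspace mu : subspace (comp mu). Proof. exact: low_subspace. Qed.

Definition row_deg (mu : 'X_{1..N}) : nat := (\sum_(1 <= a < m.+1) expo mu m a)%N.

Lemma tactI_euler (i j : 'I_m) u : euler m (tactI F n k i j u) = tactI F n k i j (euler m u).
Proof.
have h := weyl_gl_euler (@level_XX F n m) (@level_YY F n m) (level_YX lemn)
    (@level_eX F n k m) (@level_eY F n k m) i j u.
by rewrite !eulerE; exact: (esym h).
Qed.

Lemma comp_euler mu u : high m mu -> comp mu u -> euler m u = (row_deg mu)%:R *: u.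
Proof.
move=> hmu hu; apply: (low_scalar (A := euler m) _ tactI_euler hu).
exact: (hwv_euler F k lemn hmu).
Qed.

Lemma comp_casimir mu u : high m mu -> comp mu u -> casimir u = casimir_wt mu *: u.
Proof.
move=> hmu hu; apply: (low_scalar (A := casimir) _ _ hu); first exact: hwv_casimir.
by move=> i j v; rewrite /tactI /= casimir_tact ?ltn_ord.
Qed.

(** In the commutator form of the raising operator, one occurrence of [casimir] acts on [u] and the
    other is moved to [v] by adjunction, so both become scalars. *)
Lemma raise_form i mu nu u v : (1 <= i <= m)%N -> SI mu -> SI nu -> comp mu u -> comp nu v ->
  B (glact m.+1 i m.+1 u) v
  = ((row_deg mu)%:R + c m + casimir_wt nu - casimir_wt mu) * B (x m i * u) v.
Proof.
move=> hi hmu hnu hu hv; have Wu := comp_W hmu hu; have Wv := comp_W hnu hv.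
have Wx a f : W f -> W (x m a * f) by move=> ?; apply: level_x.
have Wxu := Wx i u Wu; have WKx := casimir_W Wxu.
rewrite raiseE // (comp_euler hmu.1 hu) (comp_casimir hmu.1 hu) -!scalerAr.
have Z a : W (a *: (x m i * u)) by apply: (subspaceZ _ sW).
have WN : W (- (casimir_wt mu *: (x m i * u))) by apply: (subspaceN sW).
rewrite (pformDl fB) //; [|by apply: (subspaceD sW)..].
rewrite !(pformDl fB) // (pformNl sW fB) // !(pformZl sW fB) //.
rewrite casimir_adj // (comp_casimir hnu.1 hv) (pformZr sW fB) //.
by rewrite conj_Creal ?casimir_wt_real //; ring.
Qed.

(** A Pieri rule. By adjunction, pair the q-th derivative of [hwv m nu] with the component of [mu].
    A lowering operator of this component, moved across, is zero or turns the q-th derivative into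
    an a-th one with a < q; this is the induction on q, and it reduces to the generator
    [hwv m mu]. *)
Lemma comp_adjacent i mu nu u v : (1 <= i <= m)%N -> SI mu -> SI nu ->
  comp mu u -> comp nu v ->
  (forall j, (1 <= j <= m)%N -> nu <> (mu + uexp n m j)%MM) -> B (x m i * u) v = 0.
Proof.
move=> hi hmu hnu hu hv nadj; have [hh Wnu] := hnu; have [hh' Wmu] := hmu.
have Wd a f : W f -> W (dx m a f) by move=> ?; apply: level_dx.
have Wx l a f : (m <= l)%N -> W f -> W (x l a * f) by move=> ? ?; apply: level_x.
have hwmu : comp mu (hwv m mu) by apply: low_in.
have stepA q w : (1 <= q <= m)%N -> comp mu w -> B (dx m q (hwv m nu)) w = 0.
  have [d] := ubnP q; elim: d => // d ih in q w * => ltq hq hw.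
  pose S w := comp mu w /\ B (dx m q (hwv m nu)) w = 0.
  suff [] : S w by [].
  have WS f : comp mu f -> W f := comp_W hmu.
  apply: (hw S).
  - split; first by split; [case: (comp_subspace mu) | rewrite (pform0r sW fB) //; apply: Wd].
    move=> a y z [Cy By] [Cz Bz]; split; first exact: (subspaceL _ (comp_subspace mu)).
    rewrite (pformDr sW fB) ?(pformZr sW fB) ?By ?Bz ?mulr0 ?addr0 //; try exact: WS; try exact: Wd.
    by apply: (subspaceZ _ sW); apply: WS.
  (* If this pairing were nonzero, the weights of row m and the degrees in the higher variables
     would agree on its two arguments, forcing [nu] to be [mu] plus the unit exponent at q. *)
  - split=> //; apply/eqP; apply: contraT => Bn0; case: (nadj q hq); apply: expoP => l a vla.
    rewrite expoD expo_uexp vm //=.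
    case: (ltnP l m) => [ltl|gel].
      rewrite (elimT (highP _ _) hh l a ltl) (elimT (highP _ _) hh' l a ltl) add0n.
      by rewrite [m == l]gtn_eqF.
    move: gel; rewrite leq_eqVlt => /orP[/eqP el|gtl]; last first.
      rewrite ltn_eqF // addn0.
      have adj : B (x l a * dx l a (dx m q (hwv m nu))) (hwv m mu)
          = B (dx m q (hwv m nu)) (x l a * dx l a (hwv m mu)).
        have Wla f : W f -> W (dx l a f) by move=> ?; apply: level_dx => //; exact: ltnW.
        have ml := ltnW gtl; have Wdn := Wd q _ Wnu.
        by rewrite (lf_x lf ml vla (Wla _ Wdn) Wmu) (level_xr lf ml vla Wdn (Wla _ Wmu)).
      move: adj.
      rewrite dx_comm -[x l a * dx m q _]dx_xM_row; last by rewrite ltn_eqF.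
      rewrite (hwv_degree F k lemn a gtl hh) (hwv_degree F k lemn a gtl hh') dxZ.
      rewrite (pformZl sW fB) ?(pformZr sW fB) ?conj_Creal ?realn //; try exact: Wd.
      move/eqP; rewrite -subr_eq0 -mulrBl mulf_eq0 (negbTE Bn0) orbF subr_eq0 eqr_nat.
      by move/eqP.
    rewrite -el eqxx /=; have ha : (1 <= a <= m)%N by move: vla; rewrite -el /valid; lia.
    have := level_tact_adj lemn lf ha ha (Wd q _ Wnu) Wmu.
    have -> : tact m a a (dx m q (hwv m nu))
        = ((expo nu m a)%:R + gl_wt m a - (q == a)%:R) *: dx m q (hwv m nu).
      have e := tact_dx q (hwv m nu) ha ha; rewrite (hwv_weight F k lemn ha hh) dxZ in e.
      have -> : tact m a a (dx m q (hwv m nu)) = ((expo nu m a)%:R + gl_wt m a) *: dx m q (hwv m nu)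
          - dx m a (hwv m nu) *+ (q == a) by rewrite e addrK.
      by rewrite [RHS]scalerBl; have [->|_] := eqVneq q a; rewrite ?mulr1n ?scale1r ?mulr0n ?scale0r.
    rewrite (hwv_weight F k lemn ha hh') (pformZl sW fB) ?(pformZr sW fB) //; try exact: Wd.
    rewrite conj_Creal; last by rewrite realD ?realn ?gl_wt_real.
    move/eqP; rewrite -subr_eq0 -mulrBl mulf_eq0 (negbTE Bn0) orbF.
    have -> : (expo nu m a)%:R + gl_wt m a - (q == a)%:R - ((expo mu m a)%:R + gl_wt m a)
        = (expo nu m a)%:R - ((expo mu m a) + (q == a))%:R :> F by rewrite natrD; ring.
    by rewrite subr_eq0 eqr_nat => /eqP.
  move=> a b y ltab [Cy By]; split; first by apply: comp_tact; rewrite ?ltn_ord.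
  have hb : (1 <= b.+1 <= m)%N by rewrite ltn_ord.
  have ha : (1 <= a.+1 <= m)%N by rewrite ltn_ord.
  rewrite /tactI /= -(level_tact_adj lemn lf hb ha (Wd q _ Wnu) (WS _ Cy)).
  have := tact_dx q (hwv m nu) hb ha.
  have hab : (1 <= a.+1 < b.+1)%N by move: ltab; lia.
  rewrite (hwv_invariant F k nu lemn hab (ltn_ord b)).
  rewrite linear0 => /esym/eqP; rewrite addr_eq0 => /eqP ->.
  have [eq|_] := eqVneq q b.+1; last by rewrite mulr0n oppr0 (pform0l sW fB) //; apply: WS.
  rewrite mulr1n (pformNl sW fB) ?ih ?oppr0 //; try exact: WS; try exact: Wd.
  by move: ltq ltab; rewrite eq; lia.
(* From the generator to the whole component of [nu]. The index i and the vector u are quantified,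
   since moving an operator across the product changes both. *)
pose S v := comp nu v /\ forall i u, (1 <= i <= m)%N -> comp mu u -> B (x m i * u) v = 0.
suff [_] : S v by apply.
apply: (hv S).
- split.
    split; first by case: (comp_subspace nu).
    by move=> a w _ /(comp_W hmu) Ww; rewrite (pform0r sW fB) //; apply: Wx.
  move=> a y z [Cy By] [Cz Bz]; split; first exact: (subspaceL _ (comp_subspace nu)).
  move=> b w hb hw; have Ww := comp_W hmu hw; have Wy := comp_W hnu Cy; have Wz := comp_W hnu Cz.
  rewrite (pformDr sW fB) ?(pformZr sW fB) ?By ?Bz ?mulr0 ?addr0 //; try exact: Wx.
  exact: (subspaceZ _ sW).
- split=> [|a w ha hw]; first exact: low_in.
  have Ww := comp_W hmu hw; rewrite (lf_x lf) ?vm //.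
  by apply: (pform_orthC fB) => //; [apply: Wd | apply: stepA].
move=> a b y ltab [Cy By]; split; first by apply: comp_tact; rewrite ?ltn_ord.
move=> q w hq hw; have Ww := comp_W hmu hw; have Wy := comp_W hnu Cy.
have hb : (1 <= b.+1 <= m)%N by rewrite ltn_ord.
have ha : (1 <= a.+1 <= m)%N by rewrite ltn_ord.
rewrite /tactI /= -(level_tact_adj lemn lf hb ha (Wx m q w (leqnn _) Ww) Wy) tact_x //.
have CT := comp_tact hmu hb ha hw; have WT := comp_W hmu CT.
rewrite (pformDl fB) ?(pformMnl sW fB) ?By ?mul0rn ?addr0 //; try exact: Wx.
by apply: (subspaceMn _ sW); apply: Wx.
Qed.

End Raising.

(** * The Casimir eigenvalue when one exponent is raised *)

Section WeightDifference.
Variables (F : numClosedFieldType) (m : nat) (w : 'I_m -> F).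

Let cw (b : 'I_m -> nat) : F := \sum_(r < m) \sum_(s < m) (if (s < r)%N then 0 else
     if s == r then w r * (b r)%:R else - ((b s).+1 * b r)%:R).

Lemma sum_gt_ord (j : 'I_m) : (\sum_(s < m) (j < s))%N = (m - j.+1)%N.
Proof.
case: j => j ltj /=; rewrite -(big_mkord xpredT (fun s => nat_of_bool (j < s)%N)).
rewrite (big_cat_nat _ (n := j.+1)) //= big_nat_cond big1 ?add0n; last first.
  by move=> i /andP[/andP[_ lti] _]; rewrite ltnNge -ltnS lti.
rewrite (eq_big_nat _ _ (F2 := fun=> 1%N)) ?sum_nat_const_nat ?muln1 //.
by move=> i /andP[lti _]; rewrite lti.
Qed.

(** Only terms with r = j or s = j change. They contribute [w j], minus b_s for every s other than
    j, and a further -1 for each s > j; the degree cancels all the b_s except [b j]. *)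
Lemma casimir_difference (b b' : 'I_m -> nat) (j : 'I_m) : (forall s, b' s = b s + (s == j))%N ->
  (\sum_s b s)%:R + cw b' - cw b = (b j)%:R + w j - (m - j.+1)%:R.
Proof.
move=> hb'; rewrite -addrA.
have -> : cw b' - cw b = \sum_(s < m) (if (s < j)%N then 0 else if s == j then w j else - ((b s).+1)%:R)
    + \sum_(r < m) (if (r < j)%N then - (b r)%:R else 0).
  rewrite /cw -sumrB.
  rewrite -(sum_delta j (fun r : 'I_m => \sum_(s < m) (if (s < r)%N then 0 else if s == r then w r else - ((b s).+1)%:R))).
  rewrite -big_split; apply: eq_bigr => r _ /=.
  rewrite -[X in _ = _ + X](sum_delta j (fun s : 'I_m => if (r < s)%N then - (b r)%:R else 0)) -sumrMnl.
  rewrite -sumrB -big_split; apply: eq_bigr => s _ /=; rewrite !hb'.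
  have [srj|nsj] := eqVneq s j; have [rj|nrj] := eqVneq r j;
    rewrite ?mulr1n ?mulr0n ?addn0 ?add0r ?addr0.
  - by rewrite srj rj ltnn eqxx !addn1 -natr1; ring.
  - rewrite srj; case: ltngtP => [lt|lt|/val_inj e]; rewrite ?subrr //.
      by rewrite -val_eqE /= gtn_eqF // !natrM addn1 -natr1; ring.
    by rewrite e eqxx in nrj.
  - rewrite rj; case: ltngtP => [lt|lt|/val_inj e]; rewrite ?subrr //.
      by rewrite -val_eqE /= gtn_eqF // !natrM addn1 -natr1; ring.
    by rewrite e eqxx in nsj.
  by rewrite subrr.
rewrite natr_sum -!big_split /=.
rewrite (eq_bigr (fun s => ((b j)%:R + w j) *+ (s == j) - (j < s)%:R)); last first.
  move=> s _; have [->|nsj] := eqVneq s j; first by rewrite ltnn /= mulr1n; ring.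
  case: ltngtP => [lt|lt|/val_inj e]; rewrite ?mulr0n ?addr0 ?sub0r ?subr0.
  - by rewrite ?subrr oppr0.
  - by rewrite -natr1 /=; ring.
  by rewrite e eqxx in nsj.
by rewrite sumrB sum_delta -natr_sum sum_gt_ord.
Qed.

End WeightDifference.

(** * From a form on one level to a form on the next *)

Section Step.
Variables (F : numClosedFieldType) (n : nat) (k : nat -> nat).
Local Notation N := 'C(n.+1, 2).
Local Notation P := {mpoly F[N]}.
Local Notation x := (@x F n).
Local Notation dx := (@dx F n).
Local Notation euler := (@euler F n).
Local Notation c := (@c F n k).
Local Notation tact := (@tact F n k).
Local Notation glact := (@glact F n k).
Local Notation expo := (@expo n).
Local Notation inv := (@gl_invariant F n k).
Local Notation hwv := (@hwv F n).
Local Notation row_kernel := (@row_kernel F n k).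
Local Notation kap := (kap n k).
Local Notation gl_wt := (@gl_wt F n k).
Variables (m' : nat) (B : P -> P -> F).
Local Notation m := m'.+1.
Hypotheses (lemn : (m <= n)%N) (lf : level_form k m' B).
Local Notation W := (row_kernel m').
Local Notation comp := (@comp F n k m').
Local Notation W2 := (row_kernel m).
Local Notation SI := (sub_idx m' W).
Local Notation SI2 := (sub_idx m' W2).

(** The exponent of the j-th minor at which the raising scalar vanishes. It is at least kappa_j,
    with equality for j = m. *)
Definition gap j : nat := (\sum_(j <= q < m.+1) kap q + (m - j))%N.

(** The kappa's come from [gl_wt m j + c m], and the shift m - j from the indices s > j of the
    Casimir difference. *)
Lemma raise_scalar mu j : (1 <= j <= m)%N ->
  (row_deg m' mu)%:R + c m + casimir_wt F k m' (mu + uexp n m j)%MM - casimir_wt F k m' mu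
  = - ((gap j)%:R - (expo mu m j)%:R).
Proof.
move=> hj; have ltj : (j.-1 < m)%N by lia.
pose b (s : 'I_m) := expo mu m s.+1.
pose b' (s : 'I_m) := expo (mu + uexp n m j)%MM m s.+1.
have hb' s : (b' s = b s + (s == Ordinal ltj))%N.
  rewrite /b' expoD expo_uexp (_ : valid n m j) ?eqxx; last by rewrite /valid; lia.
  by congr (_ + nat_of_bool _)%N; rewrite -val_eqE /= eq_sym -(eqSS s) prednK //; lia.
have := casimir_difference (fun r : 'I_m => gl_wt m r.+1) hb'.
have eb : b (Ordinal ltj) = expo mu m j by rewrite /b /= prednK //; lia.
rewrite eb /= prednK; last by lia.
have -> : (\sum_s b s)%N = row_deg m' mu by rewrite /row_deg big_add1 big_mkord.
rewrite -/(casimir_wt F k m' mu) -/(casimir_wt F k m' (mu + uexp n m j)%MM) => e.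
have e2 := gl_wt_c F k hj lemn.
transitivity ((row_deg m' mu)%:R + casimir_wt F k m' (mu + uexp n m j)%MM
   - casimir_wt F k m' mu + c m); first by ring.
rewrite e /gap natrD; transitivity ((expo mu m j)%:R - (m - j)%:R + (gl_wt m j + c m)); first by ring.
by rewrite e2; ring.
Qed.

Let sW : subspace W. Proof. exact: row_kernel_subspace. Qed.
Let sW2 : subspace W2. Proof. exact: row_kernel_subspace. Qed.
Let fB : pos_form W B. Proof. exact: (lf_form lf). Qed.
Let W2W u : W2 u -> W u. Proof. by apply: row_kernel_le. Qed.
Let TW i j u : (1 <= i <= m)%N -> (1 <= j <= m)%N -> W u -> W (tact m i j u).
Proof. by apply: (row_kernel_tactM lemn lf); lia. Qed.
Let TW2 i j u : (1 <= i <= m)%N -> (1 <= j <= m)%N -> W2 u -> W2 (tact m i j u).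
Proof. by apply: (row_kernel_tactM lemn lf); lia. Qed.
Let hW f mu : W f -> inv m f -> f@_mu != 0 -> high m mu -> W (hwv m mu).
Proof. by apply: (row_kernel_hwv lemn). Qed.
Let hW2 f mu : W2 f -> inv m f -> f@_mu != 0 -> high m mu -> W2 (hwv m mu).
Proof. by apply: (row_kernel_hwv lemn). Qed.

Lemma SI2_SI mu : SI2 mu -> SI mu.
Proof. by case=> hh /W2W; split. Qed.

Lemma SI2P mu : SI2 mu <-> high m mu /\ forall l, (1 <= l <= m)%N -> (expo mu m l <= kap l)%N.
Proof.
split=> [[hh /(@row_kernel_hwvE F n k m' lemn m mu (leqnn m) hh)]|[hh h]]; first by [].
by split=> //; apply/(@row_kernel_hwvE F n k m' lemn m mu (leqnn m) hh).
Qed.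

Lemma SIP mu : SI mu <-> high m mu /\ forall l, (1 <= l <= m')%N -> (expo mu m l <= kap l)%N.
Proof.
split=> [[hh /(@row_kernel_hwvE F n k m' lemn m' mu (leqnSn m') hh)]|[hh h]]; first by [].
by split=> //; apply/(@row_kernel_hwvE F n k m' lemn m' mu (leqnSn m') hh).
Qed.

Lemma comp_W2 mu u : SI2 mu -> comp mu u -> W2 u.
Proof. exact: (sub_comp_sub sW2 TW2). Qed.

Lemma gap_ge j : (1 <= j <= m)%N -> (kap j <= gap j)%N.
Proof. by move=> hj; rewrite /gap big_ltn; [rewrite -addnA leq_addr|lia]. Qed.

Lemma gap_last : gap m = kap m.
Proof. by rewrite /gap big_nat1 subnn addn0. Qed.

(** A component of the image outside [W2] must be adjacent to [mu] and exceed a bound. The bounds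
    for l < m hold throughout [W], so the exponent raised is that of j = m, at its limit kappa_m,
    and there the raising scalar is zero. *)
Lemma raise_stable i u : (1 <= i <= m)%N -> W2 u -> W2 (glact m.+1 i m.+1 u).
Proof.
move=> hi /(sub_decomposition lemn lf sW2 W2W TW2 hW2).
apply: (lspan_min (W := fun u => W2 (glact m.+1 i m.+1 u))).
  split; first by rewrite linear0; case: sW2.
  by move=> a y z hy hz; rewrite glact_linear; apply: (subspaceL _ sW2).
move=> {}u [mu hmu hu]; have hmu' := SI2_SI hmu.
have Wu := comp_W lemn lf hmu' hu.
set y := glact _ _ _ _.
have Wy : W y.
  rewrite /y raiseE //; apply: (subspaceD sW); first apply: (subspaceD sW).
  - apply: level_x => //; rewrite (comp_euler lemn hmu'.1 hu); exact: (subspaceZ _ sW).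
  - by apply: (subspaceZ _ sW); apply: level_x.
  apply: (subspaceB sW); first by apply: (casimir_W lf); apply: level_x.
  by apply: level_x => //; apply: (casimir_W lf).
have [s hs ey] := lspan_indexed (fun nu => @comp_subspace F n k m' nu)
  (sub_decomposition lemn lf sW (fun u h => h) TW hW Wy).
have dec nu : {SI2 nu} + {~ SI2 nu} := excluded_middle_informative _.
pose p nu := if dec nu then true else false.
have pP nu : reflect (SI2 nu) (p nu) by rewrite /p; case: (dec nu) => h; constructor.
rewrite ey (bigID (fun a => p a.1)) /=.
set y1 := \sum_(a <- s | p a.1) _; set y2 := \sum_(a <- s | ~~ p a.1) _.
have Wa a : a \in s -> W a.2 by move=> /hs[ha1 ha2]; apply: (comp_W lemn lf ha1).
have W2y1 : W2 y1.
  by apply: (subspace_sum sW2) => a /hs[_ ha] /pP ha'; apply: comp_W2 ha.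
have Wy2 : W y2 by apply: (subspace_sum sW) => a /Wa.
suff -> : y2 = 0 by rewrite addr0.
have WP1 a : a \in s -> p a.1 -> W a.2 by move=> sa _; exact: Wa sa.
have WP2 a : a \in s -> ~~ p a.1 -> W a.2 by move=> sa _; exact: Wa sa.
apply: (pform_eq0 fB Wy2); rewrite {2}/y2 (pform_sumr sW fB WP2 Wy2).
rewrite big_seq_cond; apply: big1 => a /andP[sa /pP na]; have [ha1 ha2] := hs a sa.
have Wa2 := Wa a sa.
have o1 : B y1 a.2 = 0.
  rewrite (pform_suml sW fB WP1 Wa2) big_seq_cond.
  apply: big1 => b /andP[sb /pP hb]; have [hb1 hb2] := hs b sb.
  by apply: (comp_orth lemn lf hb1 ha1 _ hb2 ha2); apply/eqP => e; rewrite e in hb.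
have -> : B y2 a.2 = B y a.2.
  rewrite ey (bigID (fun a => p a.1)) /= (pformDl fB (W2W W2y1) Wy2 Wa2).
  by rewrite o1 add0r.
rewrite /y (raise_form lemn lf hi hmu' ha1 hu ha2).
case: (classic (exists j, (1 <= j <= m)%N /\ a.1 = (mu + uexp n m j)%MM)) => [[j [hj ej]]|nadj].
  have vj : valid n m j by rewrite /valid; lia.
  have [ha1h ha1l] := (SIP _).1 ha1; have [hmh hml] := (SI2P _).1 hmu.
  have [jm ej2] : j = m /\ expo mu m m = kap m.
    have na' : ~ forall l, (1 <= l <= m)%N -> (expo a.1 m l <= kap l)%N.
      by move=> h; apply: na; apply/SI2P.
    have [l h1] := not_all_ex_not _ _ na'; have [hl /negP] := imply_to_and _ _ h1.
    rewrite -ltnNge => gtl.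
    have lm : l = m.
      by move: hl gtl (ha1l l); clear; lia.
    have := hml m; move: gtl; rewrite lm ej expoD expo_uexp vj eqxx /=.
    by case: eqP => [->|_]; lia.
  by rewrite ej (raise_scalar _ hj) jm gap_last ej2 subrr oppr0 mul0r.
have B0 := comp_adjacent lemn lf hi hmu' ha1 hu ha2
  (fun j hj ej => nadj (ex_intro _ j (conj hj ej))).
rewrite B0; exact: mulr0.
Qed.

(** The inverses of the raising scalars, up to sign, met when the exponents grow from 0; they are
    positive as long as the exponents respect the bounds. This solves the recursion [gam_step]. *)
Definition gam (mu : 'X_{1..N}) : F :=
  \prod_(1 <= j < m.+1) \prod_(b < expo mu m j) ((gap j)%:R - b%:R)^-1.

Lemma gam_gt0 mu : SI2 mu -> 0 < gam mu.
Proof.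
move=> /SI2P[_ h]; rewrite /gam big_seq; apply: prodr_gt0 => j.
rewrite mem_index_iota => hj; apply: prodr_gt0 => b _.
have := leq_trans (ltn_ord b) (leq_trans (h j hj) (gap_ge hj)) => lt.
by rewrite invr_gt0 subr_gt0 ltr_nat.
Qed.

Lemma gam_step mu j : (1 <= j <= m)%N -> SI2 (mu + uexp n m j)%MM ->
  gam (mu + uexp n m j)%MM * ((gap j)%:R - (expo mu m j)%:R) = gam mu.
Proof.
move=> hj /SI2P[_ /(_ j hj)]; have vj : valid n m j by rewrite /valid; lia.
rewrite expoD expo_uexp vj !eqxx addn1 => lt; have lt2 := leq_trans lt (gap_ge hj).
have n0 : (gap j)%:R - (expo mu m j)%:R != 0 :> F by rewrite gt_eqF // subr_gt0 ltr_nat.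
rewrite /gam (bigD1_seq j) ?mem_index_iota ?iota_uniq //=.
rewrite [RHS](bigD1_seq j) ?mem_index_iota ?iota_uniq //=.
rewrite expoD expo_uexp vj !eqxx addn1 big_ord_recr /= -!mulrA; congr (_ * _).
rewrite mulrC -mulrA mulfV // mulr1; apply: eq_bigr => q /negbTE nqj.
by rewrite expoD expo_uexp [j == q]eq_sym nqj !andbF addn0.
Qed.

Lemma gam_x mu l a : (m < l)%N -> gam (mu + uexp n l a)%MM = gam mu.
Proof.
move=> lt; apply: eq_bigr => j _.
by rewrite expoD expo_uexp (_ : l == m = false) ?andbF ?addn0 //; apply/eqP; lia.
Qed.

Lemma hwv_x mu l a : (m < l)%N -> valid n l a ->
  x l a * hwv m mu = hwv m (mu + uexp n l a)%MM.
Proof.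
move=> lt v; rewrite !hwvE mpolyXD rmorphM /= mulrC; congr (_ * _).
have [w e] := var_idxP v; have [er ec] := rowcolE e.
rewrite x_validE // /uexp e /minor_subst comp_mpolyXU -tnth_nth tnth_mktuple er.
by rewrite ltnNge ltnW //= gtn_eqF.
Qed.

Lemma mcoeff_xdx l a f nu : (x l a * dx l a f)@_nu = f@_nu *+ expo nu l a.
Proof.
case: (boolP (valid n l a)) => v; last by rewrite dx_invalid // mulr0 mcoeff0 expo_invalid.
case: (posnP (expo nu l a)) => [e|/(expo_split v)[nu' ->]].
  by rewrite mcoeff_xM0 // e.
by rewrite mcoeff_xM // mcoeff_dx // expoD expo_uexp v !eqxx addn1.
Qed.

Lemma mcoeff_euler f nu : (euler m f)@_nu = f@_nu *+ row_deg m' nu.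
Proof.
rewrite /Defs.euler raddf_sum /row_deg -sumrMnr; apply: eq_bigr => a _.
exact: mcoeff_xdx.
Qed.

Lemma euler_W2 u : W2 u -> W2 (euler m u).
Proof.
move=> /(sub_decomposition lemn lf sW2 W2W TW2 hW2).
apply: (lspan_min (W := fun u => W2 (euler m u))).
  split; first by rewrite linear0; case: sW2.
  by move=> a y z hy hz; rewrite linearP; apply: (subspaceL _ sW2).
move=> {}u [mu hmu hu]; rewrite (comp_euler lemn hmu.1 hu).
by apply: (subspaceZ _ sW2); apply: comp_W2 hu.
Qed.

Lemma glact_W2 i j u : (1 <= i <= m.+1)%N -> (1 <= j <= m.+1)%N -> W2 u ->
  W2 (glact m.+1 i j u).
Proof.
move=> hi hj Wu; case: (leqP i m) => him; case: (leqP j m) => hjm.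
- rewrite glact_inner //; apply: (subspaceD sW2); first by apply: TW2 => //; lia.
  by apply: (subspaceMn _ sW2); apply: (subspaceZ _ sW2).
- have -> : j = m.+1 by lia.
  by apply: raise_stable => //; lia.
- have -> : i = m.+1 by lia.
  by rewrite glact_lower //; apply: (subspaceN sW2); apply: row_kernel_dx.
have -> : i = m.+1 by lia.
have -> : j = m.+1 by lia.
rewrite glact_last; apply: (subspaceB sW2); first exact: (subspaceZ _ sW2).
exact: euler_W2.
Qed.

Definition scaling mu : F := sqrtC (gam mu).

Lemma scaling_gt0 mu : SI2 mu -> 0 < scaling mu.
Proof. by move=> h; rewrite sqrtC_gt0 gam_gt0. Qed.

Lemma comp_glact mu i u : SI mu -> (i <= m.+1)%N -> forall j, (1 <= i <= m)%N -> (1 <= j <= m)%N ->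
  comp mu u -> comp mu (glact m.+1 i j u).
Proof.
move=> hmu _ j hi hj hu; have sC := @comp_subspace F n k m' mu.
rewrite glact_inner; [|lia|lia]; apply: (subspaceD sC).
  exact: (comp_tact lemn hmu).
by apply: (subspaceMn _ sC); apply: (subspaceZ _ sC).
Qed.

(** On adjacent components [gam] absorbs the raising scalar; on all others both sides vanish. The
    sign is that of E_{m+1,i} = -d/dx_{m,i}. *)
Lemma adjoint_raise i mu nu u v : (1 <= i <= m)%N -> SI2 mu -> SI2 nu ->
  comp mu u -> comp nu v ->
  gam nu * B (glact m.+1 i m.+1 u) v = - (gam mu * B u (dx m i v)).
Proof.
move=> hi hmu hnu hu hv; have hmu' := SI2_SI hmu; have hnu' := SI2_SI hnu.
have Wu := comp_W lemn lf hmu' hu; have Wv := comp_W lemn lf hnu' hv.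
have vi : valid n m i by rewrite /valid; lia.
rewrite -(lf_x lf (ltnSn m') vi Wu Wv) (raise_form lemn lf hi hmu' hnu' hu hv).
case: (classic (exists j, (1 <= j <= m)%N /\ nu = (mu + uexp n m j)%MM)) => [[j [hj ej]]|nadj].
  have hs : SI2 (mu + uexp n m j)%MM by rewrite -ej.
  rewrite ej (raise_scalar _ hj) -(gam_step hj hs); ring.
have -> := comp_adjacent lemn lf hi hmu' hnu' hu hv
  (fun j hj ej => nadj (ex_intro _ j (conj hj ej))).
by rewrite !mulr0 oppr0.
Qed.

Lemma gam_real mu : SI2 mu -> (gam mu)^* = gam mu.
Proof. by move=> h; rewrite geC0_conj // ltW // gam_gt0. Qed.

Theorem level_step : exists B' : P -> P -> F, level_form k m B'.
Proof.
have [B' fB' adj] := sub_rescale lemn lf sW2 W2W TW2 hW2 scaling_gt0.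
have adj' (A A' : {linear P -> P}) := adj A A'.
have s2 mu : scaling mu ^+ 2 = gam mu by rewrite sqrtCK.
(* Operators that preserve every component do not see the rescaling, since unequal components stay
   orthogonal. *)
have diag (A A' : {linear P -> P}) :
    (forall mu u, SI mu -> comp mu u -> comp mu (A u)) ->
    (forall mu u, SI mu -> comp mu u -> comp mu (A' u)) ->
    (forall u v, W u -> W v -> B (A u) v = B u (A' v)) ->
    forall mu nu u v, SI2 mu -> SI2 nu -> comp mu u -> comp nu v ->
    scaling nu ^+ 2 * B (A u) v = scaling mu ^+ 2 * B u (A' v).
  move=> hA hA' hadj mu nu u v /SI2_SI hmu /SI2_SI hnu hu hv.
  have [e|ne] := eqVneq mu nu.
    have Wu := comp_W lemn lf hmu hu; have Wv := comp_W lemn lf hnu hv.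
    by rewrite e hadj.
  have -> := comp_orth lemn lf hmu hnu ne (hA _ _ hmu hu) hv.
  have -> := comp_orth lemn lf hmu hnu ne hu (hA' _ _ hnu hv).
  by rewrite !mulr0.
have cr q r : (c q / r%:R)^* = c q / r%:R.
  by rewrite conj_Creal // rpred_div ?c_real ?realn.
exists B'; split=> //.
- exact: glact_W2.
- move=> i j u v hi hj Wu Wv.
  have st i' j' w := @glact_W2 i' j' w.
  apply: (adj' (glact m.+1 i j) (glact m.+1 j i)) => //; try by move=> w; apply: st.
  case: (leqP i m) => him; case: (leqP j m) => hjm.
  + apply: diag.
    * by move=> mu w hmu; apply: comp_glact => //; lia.
    * by move=> mu w hmu; apply: comp_glact => //; lia.
    move=> y z Wy Wz; rewrite /= !glact_inner //.
    have Ty : W (tact m i j y) by apply: TW => //; lia.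
    have Tz : W (tact m j i z) by apply: TW => //; lia.
    have Zy a q : W (((a : F) *: y) *+ q) by apply: (subspaceMn _ sW); apply: (subspaceZ _ sW).
    have Zz a q : W (((a : F) *: z) *+ q) by apply: (subspaceMn _ sW); apply: (subspaceZ _ sW).
    rewrite (pformDl fB Ty (Zy _ _) Wz) (pformDr sW fB Wy Tz (Zz _ _)).
    rewrite (pformMnl sW fB _ (subspaceZ _ sW Wy) Wz) (pformMnr sW fB _ Wy (subspaceZ _ sW Wz)).
    rewrite (pformZl sW fB _ Wy Wz) (pformZr sW fB _ Wy Wz) cr [j == i]eq_sym.
    by rewrite (level_tact_adj lemn lf _ _ Wy Wz) //; lia.
  + have -> : j = m.+1 by lia.
    have hi' : (1 <= i <= m)%N by lia.
    move=> mu nu y z hmu hnu hy hz; rewrite !s2 /= glact_lower //.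
    rewrite (adjoint_raise hi' hmu hnu hy hz).
    have Wy := comp_W lemn lf (SI2_SI hmu) hy; have Wz := comp_W lemn lf (SI2_SI hnu) hz.
    by rewrite (pformNr sW fB Wy) ?mulrN //; apply: level_dx.
  + have -> : i = m.+1 by lia.
    have hj' : (1 <= j <= m)%N by lia.
    move=> mu nu y z hmu hnu hy hz; rewrite !s2 /= glact_lower //.
    have Wy := comp_W lemn lf (SI2_SI hmu) hy; have Wz := comp_W lemn lf (SI2_SI hnu) hz.
    have Wdy : W (dx m j y) by apply: level_dx.
    have Wr : W (glact m.+1 j m.+1 z).
      by apply: W2W; apply: glact_W2; [lia|lia|apply: comp_W2 hz].
    rewrite (pformNl sW fB Wdy Wz) (pos_formC fB Wz Wdy) (pos_formC fB Wr Wy).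
    rewrite mulrN -(gam_real hnu) -(gam_real hmu) -!rmorphM -rmorphN /=.
    by rewrite (adjoint_raise hj' hnu hmu hz hy).
  have -> : i = m.+1 by lia.
  have {i j hi hj him hjm} -> : j = m.+1 by lia.
  have sC mu := @comp_subspace F n k m' mu.
  have cst mu w : SI mu -> comp mu w -> comp mu (glact m.+1 m.+1 m.+1 w).
    move=> hmu hw; rewrite glact_last (comp_euler lemn hmu.1 hw) -scalerBl.
    exact: (subspaceZ _ (sC mu)).
  move=> mu nu y z hmu hnu hy hz.
  have Wy := comp_W lemn lf (SI2_SI hmu) hy; have Wz := comp_W lemn lf (SI2_SI hnu) hz.
  have [e|ne] := eqVneq mu nu.
    rewrite e in hmu hy *; congr (_ * _); rewrite /= !glact_last.
    rewrite (comp_euler lemn (SI2_SI hmu).1 hy) (comp_euler lemn (SI2_SI hmu).1 hz) -!scalerBl.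
    rewrite (pformZl sW fB _ Wy Wz) (pformZr sW fB _ Wy Wz) conj_Creal //.
    by rewrite realB ?realn // realB ?c_real // rpred_div ?c_real ?realn.
  have -> := comp_orth lemn lf (SI2_SI hmu) (SI2_SI hnu) ne (cst _ _ (SI2_SI hmu) hy) hz.
  have -> := comp_orth lemn lf (SI2_SI hmu) (SI2_SI hnu) ne hy (cst _ _ (SI2_SI hnu) hz).
  by rewrite !mulr0.
- move=> l a u v lt vl Wu Wv; apply: (adj' (mulx l a) (dx l a)) => //.
  + by move=> w; apply: row_kernel_x.
  + by move=> w; apply: row_kernel_dx; exact: ltnW.
  move=> mu nu y z hmu hnu hy hz; rewrite !s2 /= /mulx.
  have Wy := comp_W lemn lf (SI2_SI hmu) hy; have Wz := comp_W lemn lf (SI2_SI hnu) hz.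
  have hs : SI (mu + uexp n l a)%MM.
    have /SIP[hh h] := SI2_SI hmu; apply/SIP; split; first by rewrite high_uexp // ltnW.
    move=> q hq; rewrite expoD expo_uexp (_ : l == m = false) ?andbF ?addn0; first exact: h.
    by apply/eqP; lia.
  (* Multiplication by a variable of a higher row commutes with gl(m) and maps one component into
     another with the same value of [gam]. *)
  have hxy : comp (mu + uexp n l a)%MM (x l a * y).
    apply: (low_map (A := mulx l a) _ _ hy).
      by exists 1; rewrite scale1r /= /mulx hwv_x.
    by move=> p q w; rewrite /tactI /= /mulx tact_x_gt.
  rewrite -(lf_x lf (ltnW lt) vl Wy Wz).
  have [e|ne] := eqVneq (mu + uexp n l a)%MM nu; first by rewrite -e gam_x.
  by rewrite (comp_orth lemn lf hs (SI2_SI hnu) ne hxy hz) !mulr0.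
(* On a component the degree in row m is that of its index, at most kappa_1 + ... + kappa_m; this
   bounds the new exponents. *)
have [b hb] := lf_bound lf; set b' := (b + \sum_(1 <= q < m.+1) kap q)%N; exists b' => f.
move=> /(sub_decomposition lemn lf sW2 W2W TW2 hW2).
have sQ := @supported_subspace F n (fun nu => forall l a, (l <= m)%N -> (expo nu l a <= b')%N).
move=> hf; refine (lspan_min sQ _ hf) => {f hf} u [mu hmu hu] nu unu l a lel.
have Wu := comp_W lemn lf (SI2_SI hmu) hu.
case: (leqP l m') => hl; first by apply: leq_trans (hb u Wu nu unu l a hl) (leq_addr _ _).
have -> : l = m by lia.
case: (boolP (valid n m a)) => [va|/expo_invalid->//].
have ha : (1 <= a <= m)%N by move: va; rewrite /valid; lia.
have := mcoeff_euler u nu; rewrite (comp_euler lemn hmu.1 hu) mcoeffZ.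
rewrite -(mulr_natr u@_nu) mulrC => /(mulfI unu) e0; have /eqP e : (row_deg m' mu == row_deg m' nu) by rewrite -(eqr_nat F) e0.
have := (SI2P mu).1 hmu => -[_ hk].
apply: leq_trans (leq_addl _ _); apply: (@leq_trans (row_deg m' nu)).
  by rewrite /row_deg (bigD1_seq a) ?mem_index_iota ?iota_uniq //= leq_addr.
by rewrite -e /row_deg big_seq [X in (_ <= X)%N]big_seq; apply: leq_sum => q; rewrite mem_index_iota => /hk.
Qed.

End Step.

(** * The start of the induction *)

Section Bargmann.
Variables (F : numClosedFieldType) (n : nat) (k : nat -> nat).
Local Notation N := 'C(n.+1, 2).
Local Notation P := {mpoly F[N]}.
Local Notation x := (@x F n).
Local Notation dx := (@dx F n).
Local Notation row_kernel := (@row_kernel F n k).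

Definition mfact (mu : 'X_{1..N}) : nat := \prod_(v < N) (mu v)`!.

Lemma mfact_gt0 mu : (0 < mfact mu)%N.
Proof. by rewrite prodn_gt0 // => v; rewrite fact_gt0. Qed.

Lemma mfactD mu l a : valid n l a ->
  mfact (mu + uexp n l a)%MM = (mfact mu * (expo mu l a).+1)%N.
Proof.
move=> /var_idxP[v e]; rewrite /mfact /uexp /expo e (bigD1 v) //= [in RHS](bigD1 v) //=.
rewrite mnmDE mnm1E eqxx addn1 factS mulnC [((mu v).+1 * _)%N]mulnC mulnA; congr (_ * _)%N.
rewrite mulnC; congr (_ * _)%N; apply: eq_bigr => w /negbTE nw.
by rewrite mnmDE mnm1E eq_sym nw addn0.
Qed.

(* The Fischer-Bargmann form, for which multiplication by a variable is adjoint to the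
   corresponding derivative. *)
Definition bargmann (u v : P) : F :=
  \sum_(mu <- msupp u) (mfact mu)%:R * u@_mu * (v@_mu)^*.

Lemma bargmannE (s : seq 'X_{1..N}) u v : uniq s -> {subset msupp u <= s} ->
  bargmann u v = \sum_(mu <- s) (mfact mu)%:R * u@_mu * (v@_mu)^*.
Proof.
move=> us sub; rewrite /bargmann [RHS](bigID (mem (msupp u))) /= [X in _ + X]big1 ?addr0.
  rewrite -[RHS]big_filter; apply: perm_big; apply: uniq_perm; rewrite ?filter_uniq ?msupp_uniq // => mu.
  by rewrite mem_filter andbC; case: (boolP (mu \in msupp u)) => [/sub ->|]; rewrite ?andbF.
by move=> mu nu; rewrite (memN_msupp_eq0 nu) mulr0 mul0r.
Qed.

Lemma bargmann_form : pos_form (fun=> True) bargmann.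
Proof.
split=> [a u u' v _ _ _|u v _ _|v _ nv].
- pose s := undup (msupp (a *: u + u') ++ msupp u ++ msupp u').
  have us : uniq s by apply: undup_uniq.
  rewrite !(bargmannE (s := s)) //; try by move=> mu h; rewrite mem_undup !mem_cat h ?orbT.
  rewrite mulr_sumr -big_split; apply: eq_bigr => mu _ /=.
  by rewrite mcoeffD mcoeffZ; ring.
- pose s := undup (msupp u ++ msupp v).
  have us : uniq s by apply: undup_uniq.
  rewrite !(bargmannE (s := s)) //; try by move=> mu h; rewrite mem_undup !mem_cat h ?orbT.
  rewrite rmorph_sum; apply: eq_bigr => mu _ /=.
  by rewrite !rmorphM /= conjCK rmorph_nat; ring.
rewrite /bargmann; have : msupp v != [::] by rewrite msupp_eq0.
have h mu : mu \in msupp v -> 0 < (mfact mu)%:R * v@_mu * (v@_mu)^*.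
  by move=> hmu; rewrite -mulrA mulr_gt0 ?ltr0n ?mfact_gt0 // mul_conjC_gt0 -mcoeff_msupp.
elim: (msupp v) h => // mu s ih h _; rewrite big_cons.
case: s ih h => [_ h|nu s ih h]; first by rewrite big_nil addr0 h ?mem_head.
by rewrite addr_gt0 ?h ?mem_head // ih // => xi hxi; rewrite h // inE hxi orbT.
Qed.

Lemma bargmannX mu v : bargmann 'X_[mu] v = (mfact mu)%:R * (v@_mu)^*.
Proof. by rewrite /bargmann msuppX big_seq1 mcoeffX eqxx mulr1. Qed.

Lemma bargmann_x l a u v : valid n l a -> bargmann (x l a * u) v = bargmann u (dx l a v).
Proof.
move=> vl; have sT : subspace (fun _ : P => True) by [].
rewrite [u]mpolyE mulr_sumr (pform_suml sT bargmann_form) // (pform_suml sT bargmann_form) //.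
apply: eq_bigr => mu _; rewrite -scalerAr !(pformZl sT bargmann_form) //; congr (_ * _).
rewrite x_validE // mulrC -mpolyXD !bargmannX mfactD // mcoeff_dx //.
by rewrite rmorphMn -mulr_natr natrM /=; ring.
Qed.

(** At level 0 the kernel is the whole polynomial algebra and gl(1) acts by a real scalar. *)
Lemma level_form0 : level_form k 0 bargmann.
Proof.
have fB : pos_form (row_kernel 0) bargmann by apply: pos_form_sub bargmann_form.
have sT : subspace (fun _ : P => True) by [].
split=> //.
- by move=> i j u _ _ _ l; lia.
- move=> i j u v hi hj _ _; have -> : i = 1%N by lia.
  have -> : j = 1%N by lia.
  rewrite !glact_last /Defs.euler !big_geq // !subr0.
  rewrite (pformZl sT bargmann_form) // (pformZr sT bargmann_form) // conj_Creal //.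
  by rewrite rpredB ?rpred_div ?c_real ?realn.
- by move=> *; apply: bargmann_x.
exists 0%N => f _ mu _ l a; rewrite leqn0 => /eqP ->.
by rewrite expo_invalid //; apply/negP => /and3P[]; lia.
Qed.

Theorem level_form_exists m : (m <= n)%N -> exists B : P -> P -> F, level_form k m B.
Proof.
elim: m => [_|m ih lt]; first by exists bargmann; apply: level_form0.
by have [B hB] := ih (ltnW lt); apply: level_step hB.
Qed.

End Bargmann.

(** * Comparison with the recursive construction of the modules *)

Section Realization.
Variables (F : numClosedFieldType) (n : nat) (k : nat -> nat).
Local Notation N := 'C(n.+1, 2).
Local Notation P := {mpoly F[N]}.
Local Notation x := (@x F n).
Local Notation dx := (@dx F n).
Local Notation euler := (@euler F n).
Local Notation c := (@c F n k).
Local Notation tact := (@tact F n k).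
Local Notation glact := (@glact F n k).
Local Notation expo := (@expo n).
Local Notation inv := (@gl_invariant F n k).
Local Notation hwv := (@hwv F n).
Local Notation row_kernel := (@row_kernel F n k).
Local Notation sl_op := (@sl_op F n k).
Local Notation gl_op := (@gl_op F n k).
Local Notation Vm := (@Vm F n k).

Definition sl_gl M (g : slgen) (p : P) : P :=
  match g with
  | RootE i j => glact M i j p
  | DiagH i j => glact M i i p - glact M j j p
  end.

Lemma c0 : c 0 = 0.
Proof. by rewrite /Defs.c big_geq // mulr0. Qed.

Lemma c1 : (0 < n)%N -> c 1 *+ 2 = - (k n)%:R.
Proof.
by move=> n1; rewrite /Defs.c big_nat1 subn0 mul1n addn0 subnK //; field.
Qed.

(** In the inductive step the Euler operator in the last entry cancels the diagonal terms of the new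
    row, and the m + 1 added scalars, together with c_m from the old trace and -c_m from the last
    entry, leave the new trace. *)
Lemma glact_trace m (p : P) : (0 < m)%N -> \sum_(1 <= l < m.+1) glact m l l p = c m *: p.
Proof.
case: m => // m _; elim: m => [|m ih].
  by rewrite big_nat1 glact_last c0 subr0 divr1 /Defs.euler big_geq // subr0.
rewrite big_nat_recr //= glact_last.
rewrite (eq_big_nat _ _ (F2 := fun l => x m.+1 l * dx m.+1 l p + (glact m.+1 l l p
     + (c m.+2 / m.+2%:R) *: p))); last first.
  by move=> l /andP[_ h]; rewrite glact_inner // eqxx mulr1n /tact addrA.
rewrite !big_split /= ih -/(euler m.+1 p) sumr_const_nat subn1 /=.
rewrite -[RHS](_ : (c m.+1 + (c m.+2 / m.+2%:R) *+ m.+1 + (c m.+2 / m.+2%:R - c m.+1)) *: p = _).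
  rewrite !scalerDl scaleNr -scalerMnl; zmod.
have e : c m.+2 = c m.+2 / m.+2%:R * m.+2%:R by rewrite divfK ?pnatr_eq0.
by congr (_ *: p); rewrite [RHS]e; set a := c m.+2 / _; rewrite -(natr1 m.+1) -[a *+ _]mulr_natr; ring.
Qed.

Lemma gl_opE m (sl : slgen -> P -> P) i j p : (0 < m)%N ->
  (forall g q, in_sl m g -> sl g q = sl_gl m g q) ->
  (1 <= i <= m)%N -> (1 <= j <= m)%N -> gl_op m sl i j p = glact m i j p.
Proof.
move=> m0 h hi hj; rewrite /Defs.gl_op; have [<-|nij] := eqVneq i j; last first.
  by rewrite h //= hi hj nij.
rewrite (eq_big_nat _ _ (F2 := fun l => glact m i i p - glact m l l p)); last first.
  by move=> l hl; rewrite h //= hi; lia.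
rewrite sumrB glact_trace // sumr_const_nat subn1 /= addrCA subrr addr0.
by rewrite -scaler_nat scalerA mulVf ?scale1r // pnatr_eq0 -lt0n.
Qed.

(** The construction recovers E_{i,i} from sl(m) and the prescribed trace; by [glact_trace] this
    gives back the diagonal entries of [glact]. *)
Lemma sl_opE m g p : (m <= n)%N -> in_sl m.+1 g -> sl_op m g p = sl_gl m.+1 g p.
Proof.
elim: m g p => [|m ih] g p lemn.
  case: g => i j /=; last by move=> h; have -> : i = j; [lia|rewrite subrr].
  by move=> h; lia.
have glE sl i j q : sl =2 sl_op m -> (1 <= i <= m.+1)%N -> (1 <= j <= m.+1)%N ->
    gl_op m.+1 sl i j q = glact m.+1 i j q.
  by move=> e *; apply: gl_opE => // g' q' hg; rewrite e; apply: ih => //; apply: ltnW.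
have stepE sl g' q : sl =2 sl_op m -> in_sl m.+2 g' ->
    step_op k m.+1 sl g' q = sl_gl m.+2 g' q.
  move=> e; have ih' g2 q2 : in_sl m.+1 g2 -> sl g2 q2 = sl_gl m.+1 g2 q2.
    by move=> h; rewrite e ih // ltnW.
  have diagE i j : (1 <= i <= m.+1)%N -> (1 <= j <= m.+1)%N ->
      step_diag m.+1 sl i j q = glact m.+2 i i q - glact m.+2 j j q.
    move=> hi hj; rewrite /step_diag ih' /= ?hi //.
    by rewrite (@glact_inner _ _ _ m.+1 i i) ?(@glact_inner _ _ _ m.+1 j j) ?eqxx ?mulr1n /tact; [zmod|lia..].
  have lastE i : (1 <= i <= m.+1)%N -> step_diag m.+1 sl i m.+1 q + step_last k m.+1 sl q
      = glact m.+2 i i q - glact m.+2 m.+2 m.+2 q.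
    move=> hi; rewrite /step_last glE // ?leqnn // diagE ?leqnn //.
    rewrite [glact m.+2 m.+2 m.+2 q]glact_last [glact m.+2 m.+1 m.+1 q]glact_inner // eqxx mulr1n /tact scalerBl; zmod.
  case: g' => i j /= => [/and3P[hi hj nij]|/andP[hi hj]].
    rewrite /step_root; case: eqP => [ej|nj].
      rewrite ej glact_raise; last by lia.
      congr (_ + _); apply: eq_big_nat => r hr; rewrite glE //; lia.
    case: eqP => [ei|ni]; first by rewrite ei glact_lower; [|lia].
    rewrite ih' /=; last by lia.
    by rewrite (@glact_inner _ _ _ m.+1) ?(negbTE nij) ?mulr0n ?addr0 //; lia.
  case: leqP => him; case: leqP => hjm.
  - by rewrite diagE //; lia.
  - have -> : j = m.+2 by lia.
    by rewrite lastE //; lia.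
  - rewrite lastE; last by lia.
    by rewrite opprB; have -> : i = m.+2 by lia.
  have -> : i = m.+2 by lia.
  by have -> : j = m.+2; [lia|rewrite subrr].
case: m ih glE stepE lemn => [|m] ih glE stepE lemn hg; last exact: stepE.
(* Since 2 c_1 = -k_n, the base case of the construction, written with k_n, follows the general
   pattern. *)
have c1E (q : P) : (k n)%:R *: q = - (c 1 *: q) *+ 2.
  by rewrite mulNrn scalerMnl c1 // scaleNr opprK.
have hmul : x 1 1 * (c 1 *: p) = c 1 *: (x 1 1 * p) by rewrite scalerAr.
have diag : (x 1 1 * dx 1 1 p) *+ 2 - (k n)%:R *: p = glact 2 1 1 p - glact 2 2 2 p.
  rewrite (@glact_inner _ _ _ 1 1 1) // eqxx mulr1n /tact glact_last (@glact_last _ _ _ 1) c0 subr0 divr1.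
  rewrite c1E /Defs.euler big_nat1 big_geq // subr0 scalerBl !mulr2n; zmod.
have root : x 1 1 ^+ 2 * dx 1 1 p - (k n)%:R *: (x 1 1 * p) = glact 2 1 2 p.
  rewrite glact_raise // /Defs.euler !big_nat1 glact_last c0 subr0 divr1 /Defs.euler big_geq // subr0.
  by rewrite hmul c1E; set z := _ *: _; ring.
by case: g hg => [[|[|[|i]]] [|[|[|j]]]|[|[|[|i]]] [|[|[|j]]]] //= _; rewrite ?subrr ?diag ?opprB ?(@glact_lower _ _ _ 1 1) ?root.
Qed.

Definition low_vars m (f : P) : Prop := forall l a, (m < l)%N -> dx l a f = 0.

(** The candidate for V^(m) inside C_m, whereas [row_kernel m] leaves the higher rows free. *)
Definition kernel m (f : P) : Prop := row_kernel m f /\ low_vars m f.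

Lemma low_vars_subspace m : subspace (low_vars m).
Proof.
split=> [l b _|a u v hu hv l b lt]; first exact: linear0.
by rewrite linearP /= (hu l b lt) (hv l b lt) scaler0 addr0.
Qed.

Lemma kernel_subspace m : subspace (kernel m).
Proof.
have sR := @row_kernel_subspace F n k m; have sL := low_vars_subspace m.
split; first by split; [case: sR | case: sL].
by move=> a u v [hu hu'] [hv hv']; split; [apply: (subspaceL _ sR)|apply: (subspaceL _ sL)].
Qed.

Lemma low_vars_expo m f mu l a : low_vars m f -> f@_mu != 0 -> (m < l)%N -> expo mu l a = 0%N.
Proof.
move=> hf fmu lt; case: (boolP (valid n l a)) => [v|/expo_invalid //].
apply/eqP; rewrite -leqn0 leqNgt; apply: contra fmu => gt0.
have := mcoeff_xdx l a f mu; rewrite hf // mulr0 mcoeff0 => /esym/eqP.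
by rewrite -mulr_natr mulf_eq0 pnatr_eq0 -[_ == 0%N]leqn0 leqNgt gt0 orbF.
Qed.

Lemma low_vars_hwv m mu : (m <= n)%N -> high m mu ->
  (forall l a, (m < l)%N -> expo mu l a = 0%N) -> low_vars m (hwv m mu).
Proof.
move=> lemn hmu h l a lt; case: (boolP (valid n l a)) => [v|/dx_invalid -> //].
have := @hwv_degree F n k m lemn l a mu lt hmu; rewrite h // scale0r => /eqP.
rewrite mulf_eq0 x_validE // -[X in X || _]negbK -msupp_eq0 msuppX /=.
by move/eqP.
Qed.

Lemma U_span_subspace m M (S : P -> Prop) : subspace (@U_span F n k m M S).
Proof. exact: lspan_subspace. Qed.

Lemma U_span_in m M (S : P -> Prop) v : S v -> @U_span F n k m M S v.
Proof. by move=> Sv; apply: lspan_in; exists [::]; split=> //; exists v. Qed.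

Lemma sl_op_linear m : (m <= n)%N -> forall g, in_sl m.+1 g -> linear (sl_op m g).
Proof.
move=> lemn g hg a u v; rewrite !sl_opE //; case: g {hg} => i j /=; first exact: linearP.
by rewrite !glact_linear scalerBr; zmod.
Qed.

Lemma in_sl_le M M' g : (M <= M')%N -> in_sl M g -> in_sl M' g.
Proof. by case: g => i j /=; lia. Qed.

Lemma U_span_op m M (S : P -> Prop) g v : (m <= n)%N -> (M <= m.+1)%N -> in_sl M g ->
  @U_span F n k m M S v -> @U_span F n k m M S (sl_op m g v).
Proof.
move=> lemn leM hg; have L := sl_op_linear lemn (in_sl_le leM hg).
have sU := U_span_subspace m M S.
have lin0 : sl_op m g 0 = 0.
  by have := L (-1) 0 0; rewrite scaler0 addr0 scaleN1r addNr.
move=> hv; refine (lspan_min (W := fun v => @U_span F n k m M S (sl_op m g v)) _ _ hv).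
  split; first by rewrite lin0; case: sU.
  by move=> a y z hy hz; rewrite L; apply: (subspaceL _ sU).
move=> {hv} {}v [gs [hgs [u Su ->]]]; apply: lspan_in; exists (g :: gs).
by split; [rewrite /= hg | exists u].
Qed.

Lemma U_span_min m M (S W : P -> Prop) : subspace W -> (forall v, S v -> W v) ->
  (forall g v, in_sl M g -> W v -> W (sl_op m g v)) ->
  forall v, @U_span F n k m M S v -> W v.
Proof.
move=> sW SW hW v; apply: (lspan_min sW) => {v} _ [gs [hgs [u Su ->]]].
elim: gs hgs => [_|g gs ih] /=; first exact: SW.
by case/andP=> hg /ih; apply: hW.
Qed.

Lemma sl_glact m (W : P -> Prop) : (m <= n)%N -> subspace W ->
  (forall i j v, (1 <= i <= m.+1)%N -> (1 <= j <= m.+1)%N -> W v -> W (glact m.+1 i j v)) ->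
  forall g v, in_sl m.+1 g -> W v -> W (sl_op m g v).
Proof.
move=> lemn sW h g v hg Wv; rewrite sl_opE //; case: g hg => i j /=.
  by case/and3P=> hi hj _; apply: h.
by case/andP=> hi hj; apply: (subspaceB sW); apply: h.
Qed.

Lemma glact_sl m (W : P -> Prop) : (m <= n)%N -> subspace W ->
  (forall g v, in_sl m.+1 g -> W v -> W (sl_op m g v)) ->
  forall i j v, (1 <= i <= m.+1)%N -> (1 <= j <= m.+1)%N -> W v -> W (glact m.+1 i j v).
Proof.
move=> lemn sW h i j v hi hj Wv.
have h' g : in_sl m.+1 g -> sl_op m g v = sl_gl m.+1 g v by move=> hg; apply: sl_opE.
have [<-|nij] := eqVneq i j; last first.
  have hg : in_sl m.+1 (RootE i j) by rewrite /= hi hj nij.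
  by have := h _ _ hg Wv; rewrite (h' (RootE i j) hg).
have -> : glact m.+1 i i v = m.+1%:R^-1 *: (c m.+1 *: v
    + \sum_(1 <= l < m.+2) sl_op m (DiagH i l) v).
  rewrite (eq_big_nat _ _ (F2 := fun l => glact m.+1 i i v - glact m.+1 l l v)); last first.
    by move=> l hl; rewrite h' //= hi; lia.
  rewrite sumrB glact_trace // sumr_const_nat subn1 /= addrCA subrr addr0.
  by rewrite -scaler_nat scalerA mulVf ?scale1r // pnatr_eq0.
apply: (subspaceZ _ sW); apply: (subspaceD sW); first exact: (subspaceZ _ sW).
apply: (subspace_sum sW) => l; rewrite mem_index_iota => hl _.
by apply: h => //=; rewrite hi; lia.
Qed.

Lemma kernel_glact m i j v : (0 < m <= n)%N -> (1 <= i <= m.+1)%N -> (1 <= j <= m.+1)%N ->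
  kernel m v -> kernel m (glact m.+1 i j v).
Proof.
case: m => // m /= lemn hi hj [hv hv']; have [B lf] := level_form_exists F k (ltnW lemn).
split; first by apply: (glact_W2 lemn lf).
by move=> l a lt; rewrite -glact_dx // hv' // linear0.
Qed.

(** On level 1 invariance is vacuous and R_1 = -d/dx_{1,1}, so the condition is a bound on the
    degree by kappa_1 = k_n. *)
Lemma Vm1E f : (0 < n)%N -> Vm 1 f <-> kernel 1 f.
Proof.
move=> n1; have lowT mu : high 1 mu.
  by apply/highP => l a lt; apply: expo_invalid; rewrite /valid; lia.
have inv1 (g : P) : inv 1 g by move=> s t; lia.
have v1 : valid n 1 1 by rewrite /valid.
have kerE g : row_kernel 1 g <-> forall mu, g@_mu != 0 -> (expo mu 1 1 <= k n)%N.
  have e mu : (ev 1 g)@_mu = g@_mu by rewrite mcoeff_ev lowT mulr1n.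
  split=> [/(invariant_row_kernel n1 (leqnn _) (inv1 g)) h mu gmu|h].
    by have := h mu; rewrite e => /(_ gmu 1%N isT); rewrite kapE subn1.
  apply/(invariant_row_kernel n1 (leqnn _) (inv1 g)) => mu; rewrite e => gmu l hl.
  have -> : l = 1%N by lia.
  by rewrite kapE subn1 /=; apply: h.
have exw i l a : expo (uexp n 1 1 *+ i)%MM l a = if (l == 1%N) && (a == 1%N) then i else 0%N.
  elim: i => [|i ih]; first by rewrite mulm0n expo0 if_same.
  rewrite mulmS expoD ih expo_uexp v1 eq_sym [1%N == a]eq_sym /=.
  by case: ifP.
have xpow i : x 1 1 ^+ i = 'X_[uexp n 1 1 *+ i] by rewrite x_validE // mpolyXn.
split=> [|[/kerE hf hf']].
  apply: (lspan_min (kernel_subspace 1)) => _ [i lei ->]; rewrite xpow; split.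
    apply/kerE => mu; rewrite mcoeffX; have [<- _|_] := eqVneq (uexp n 1 1 *+ i)%MM mu; last by rewrite eqxx.
    by rewrite exw.
  move=> l a lt; apply: dx_mpolyX0; rewrite exw.
  by case: eqP => // e; rewrite e in lt.
rewrite /= [f]mpolyE; apply: (subspace_sum (lspan_subspace _)) => mu hmu _.
apply: (subspaceZ _ (lspan_subspace _)); apply: lspan_in.
have fmu : f@_mu != 0 by rewrite -mcoeff_msupp.
exists (expo mu 1 1); first exact: hf.
rewrite xpow; congr 'X_[_]; apply: expoP => l a vla; rewrite exw.
case: (ltnP 1 l) => hl; first by rewrite (@low_vars_expo 1 f mu l a hf' fmu hl) (_ : l == 1%N = false) //; apply/eqP; lia.
move: vla; rewrite /valid => vla; have -> : l = 1%N by lia.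
by have -> : a = 1%N by lia.
Qed.

End Realization.

(** * The kernel is generated by the constant 1 *)

Section Generation.
Variables (F : numClosedFieldType) (n : nat) (k : nat -> nat).
Local Notation N := 'C(n.+1, 2).
Local Notation P := {mpoly F[N]}.
Local Notation x := (@x F n).
Local Notation dx := (@dx F n).
Local Notation euler := (@euler F n).
Local Notation tact := (@tact F n k).
Local Notation glact := (@glact F n k).
Local Notation expo := (@expo n).
Local Notation inv := (@gl_invariant F n k).
Local Notation hwv := (@hwv F n).
Local Notation row_kernel := (@row_kernel F n k).
Local Notation kap := (kap n k).
Local Notation Vm := (@Vm F n k).
Local Notation kernel := (@kernel F n k).
Local Notation gl_wt := (@gl_wt F n k).
Local Notation low_vars := (@low_vars F n).

(** Applying [tact m a a] minus an eigenvalue removes the other highest weight vectors one by one.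
    In the absence of higher variables two distinct indices differ in row m, so some weight
    separates them. *)
Lemma weight_component m (Z : P -> Prop) f mu : (m <= n)%N -> subspace Z ->
  (forall a v, (1 <= a <= m)%N -> Z v -> Z (tact m a a v)) ->
  Z f -> inv m f -> low_vars m f -> f@_mu != 0 -> high m mu -> Z (hwv m mu).
Proof.
move=> lemn sZ TZ Zf invf lf fmu hmu.
have key (s : seq 'X_{1..N}) (b : F) (cf : 'X_{1..N} -> F) : b != 0 ->
    (forall nu, nu \in s -> f@_nu != 0 /\ nu != mu) ->
    Z (b *: hwv m mu + \sum_(nu <- s) cf nu *: hwv m nu) -> Z (hwv m mu).
  elim: s b cf => [|nu s ih] b cf b0 hs.
    rewrite big_nil addr0 => h; have := subspaceZ b^-1 sZ h.
    by rewrite scalerA mulVf // scale1r.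
  have hs' nu' : nu' \in s -> f@_nu' != 0 /\ nu' != mu.
    by move=> h; apply: hs; rewrite inE h orbT.
  rewrite big_cons; case: (boolP (high m nu)) => [hnu|/hwv_low ->]; last first.
    by rewrite scaler0 add0r; apply: ih.
  have [fnu ne] := hs nu (mem_head _ _).
  have [a [ha na]] : exists a, (1 <= a <= m)%N /\ expo mu m a != expo nu m a.
    case: (classic (exists a, (1 <= a <= m)%N /\ expo mu m a != expo nu m a)) => // nh.
    case/eqP: ne; apply: expoP => l a vla; case: (ltngtP l m) => lm.
    - by rewrite (elimT (highP _ _) hmu l a lm) (elimT (highP _ _) hnu l a lm).
    - by rewrite (@low_vars_expo F n m f mu l a lf fmu lm) (@low_vars_expo F n m f nu l a lf fnu lm).
    apply/eqP/negPn/negP => h; apply: nh; exists a; rewrite eq_sym -lm; split=> //.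
    by move: vla; rewrite /valid => vla; apply/negP; move: vla h; clear; lia.
  set v := _ + _ => Zv.
  pose w nu' : F := (expo nu' m a)%:R + gl_wt m a.
  have ew nu' : tact m a a (hwv m nu') = w nu' *: hwv m nu'.
    case: (boolP (high m nu')) => [hn|/hwv_low ->]; last by rewrite linear0 scaler0.
    exact: (hwv_weight F k lemn ha hn).
  apply: (ih (b * (w mu - w nu)) (fun nu' => cf nu' * (w nu' - w nu))) => //.
    rewrite mulf_neq0 // subr_eq0 /w (inj_eq (addIr _)) eqr_nat //.
  pose A : {linear P -> P} := tact m a a \- (w nu \*: idfun).
  have eA nu' : A (hwv m nu') = (w nu' - w nu) *: hwv m nu' by rewrite /A /= ew scalerBl.
  have ZA : Z (A v) by rewrite /A /=; apply: (subspaceB sZ); [exact: TZ|exact: (subspaceZ _ sZ)].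
  have -> // : b * (w mu - w nu) *: hwv m mu + \sum_(nu' <- s) cf nu' * (w nu' - w nu) *: hwv m nu'
     = A v.
  have AP : linear A by exact: linearP.
  have AS : A (\sum_(nu' <- s) cf nu' *: hwv m nu') = \sum_(nu' <- s) cf nu' *: A (hwv m nu').
    by rewrite linear_sum; apply: eq_bigr => nu' _; rewrite linearZ.
  rewrite /v !AP AS !eA scalerA subrr scale0r scaler0 add0r; congr (_ + _).
  by apply: eq_bigr => nu' _; rewrite eA scalerA.
apply: (key (rem mu (msupp f)) f@_mu (fun nu => f@_nu)) => //.
  move=> nu; rewrite mem_rem_uniq ?msupp_uniq // !inE => /andP[ne].
  by rewrite mcoeff_msupp.
have -> // : f@_mu *: hwv m mu + \sum_(nu <- rem mu (msupp f)) f@_nu *: hwv m nu = f.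
rewrite [RHS](invariant_sum lemn invf).
by rewrite (perm_big _ (perm_to_rem (_ : mu \in msupp f))) ?big_cons // mcoeff_msupp.
Qed.

Section Step.
Variables (m' : nat) (B : P -> P -> F).
Local Notation m := m'.+1.
Hypotheses (lemn : (m <= n)%N) (lf : level_form k m' B).
Local Notation W := (row_kernel m').
Local Notation W2 := (row_kernel m).
Local Notation K2 := (kernel m).
Local Notation comp := (@comp F n k m').
Local Notation SI := (sub_idx m' W).
Local Notation SI2 := (sub_idx m' W2).
Local Notation SK := (sub_idx m' K2).

Let sW : subspace W. Proof. exact: row_kernel_subspace. Qed.
Let sK2 : subspace K2. Proof. exact: kernel_subspace. Qed.
Let fB : pos_form W B. Proof. exact: (lf_form lf). Qed.
Let W2W u : W2 u -> W u. Proof. by apply: row_kernel_le. Qed.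
Let K2W u : K2 u -> W u. Proof. by case=> /W2W. Qed.

Lemma kernel_tact i j u : (1 <= i <= m)%N -> (1 <= j <= m)%N -> K2 u -> K2 (tact m i j u).
Proof.
move=> hi hj [hu hu']; split; first by apply: (row_kernel_tactM lemn lf) => //; lia.
by move=> l a lt; rewrite -tact_dx_gt // hu' // linear0.
Qed.

Lemma kernel_hwv f mu : K2 f -> inv m f -> f@_mu != 0 -> high m mu -> K2 (hwv m mu).
Proof.
move=> [hf hf'] invf fmu hmu; split; first exact: (row_kernel_hwv lemn (leqnn _) hf invf fmu hmu).
by apply: low_vars_hwv => // l a; apply: low_vars_expo hf' fmu.
Qed.

Lemma row_deg_uexp mu j : (1 <= j <= m)%N ->
  row_deg m' (mu + uexp n m j)%MM = (row_deg m' mu).+1.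
Proof.
move=> hj; have vj : valid n m j by rewrite /valid; lia.
rewrite /row_deg (eq_bigr (fun a => expo mu m a + (j == a))%N); last first.
  by move=> a _; rewrite expoD expo_uexp vj eqxx.
rewrite big_split /= -[RHS]addn1; congr (_ + _)%N.
rewrite (bigD1_seq j) ?mem_index_iota ?iota_uniq //= eqxx big1 ?addn0 // => a.
by rewrite eq_sym => /negbTE ->.
Qed.

Variable Z : P -> Prop.
Hypotheses (sZ : subspace Z) (ZK : forall v, Z v -> K2 v) (Z1 : Z 1)
  (gZ : forall i j v, (1 <= i <= m.+1)%N -> (1 <= j <= m.+1)%N -> Z v -> Z (glact m.+1 i j v)).

Let tZ i j v : (1 <= i <= m)%N -> (1 <= j <= m)%N -> Z v -> Z (tact m i j v).
Proof.
move=> hi hj Zv.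
have -> : tact m i j v = glact m.+1 i j v - ((@c F n k m.+1 / m.+1%:R) *: v) *+ (i == j).
  by rewrite glact_inner; [rewrite addrK|lia..].
apply: (subspaceB sZ); first by apply: gZ => //; lia.
by apply: (subspaceMn _ sZ); apply: (subspaceZ _ sZ).
Qed.

Lemma comp_sub_Z mu u : Z (hwv m mu) -> comp mu u -> Z u.
Proof. by move=> Zmu; apply=> // i j v _; apply: tZ; rewrite ltn_ord. Qed.

(** By induction on the degree in row m, a lower component that pairs nontrivially with [xi] through
    a multiplication by x_{m,i} lies in [Z]. Raising it inside [Z] multiplies this pairing by a
    nonzero scalar, so [Z], which is a sum of components, must contain the one of [mu]. *)
Lemma generation mu : SK mu -> Z (hwv m mu).
Proof.
have [d] := ubnP (row_deg m' mu); elim: d mu => // d ih mu ltd hmu.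
have [hh [W2mu Lmu]] := hmu; have hSI2 : SI2 mu by [].
have hSI : SI mu by split=> //; apply: W2W.
have Wmu := hSI.2; set xi := hwv m mu.
have [|degn0] := eqVneq (row_deg m' mu) 0%N.
  move=> deg0; have -> // : xi = 1.
  rewrite /xi; have -> : mu = 0%MM.
    apply: expoP => l a vla; rewrite expo0; case: (ltngtP l m) => lm.
    - exact: (elimT (highP _ _) hh).
    - have := @hwv_degree F n k m lemn l a mu lm hh; rewrite Lmu // mulr0 => /esym/eqP.
      by rewrite scaler_eq0 (negbTE (hwv_n0 F hh)) orbF pnatr_eq0 => /eqP.
    move/eqP: deg0; rewrite /row_deg sum_nat_seq_eq0 => /allP/(_ a).
    rewrite mem_index_iota lm => /(_ _)/eqP; apply; first by move: vla; rewrite /valid; lia.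
  by rewrite !hwvE mpolyX0 rmorph1.
(* Otherwise the Euler operator, which multiplies [xi] by its nonzero degree, would make [xi]
   orthogonal to itself. *)
have [i hi Bi] : exists2 i, (1 <= i <= m)%N & B (x m i * dx m i xi) xi != 0.
  case: (classic (exists2 i, (1 <= i <= m)%N & B (x m i * dx m i xi) xi != 0)) => // nh.
  have : B (euler m xi) xi = 0.
    rewrite /Defs.euler (pform_suml sW fB _ Wmu); last first.
      by move=> i _ _; apply: level_x => //; apply: level_dx.
    rewrite big_seq big1 // => i; rewrite mem_index_iota => hi.
    by apply/eqP; apply: contraT => h; case: nh; exists i.
  rewrite (hwv_euler F k lemn hh) (pformZl sW fB _ Wmu Wmu) => /eqP.
  rewrite mulf_eq0 -/(row_deg m' mu) pnatr_eq0 (negbTE degn0) /=.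
  by rewrite gt_eqF // (pos_form_gt0 fB) // hwv_n0.
have Ku : K2 (dx m i xi).
  by split; [apply: row_kernel_dx | move=> l a lt; rewrite dx_comm Lmu // linear0].
have := sub_decomposition lemn lf sK2 K2W kernel_tact kernel_hwv Ku.
move=> /(lspan_indexed (fun nu => @comp_subspace F n k m' nu))[s hs eu].
have Ws a : a \in s -> W a.2.
  by move=> /hs[ha1 ha2]; apply: K2W; apply: (sub_comp_sub sK2 kernel_tact ha1).
have [a sa Ba] : exists2 a, a \in s & B (x m i * a.2) xi != 0.
  case: (classic (exists2 a, a \in s & B (x m i * a.2) xi != 0)) => // nh.
  case/eqP: Bi; rewrite eu mulr_sumr (pform_suml sW fB _ Wmu); last first.
    by move=> a /Ws Wa _; apply: level_x.
  rewrite big_seq big1 // => a sa.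
  by apply/eqP; apply: contraT => h; case: nh; exists a.
have [ha1 ha2] := hs a sa; have hh1 := ha1.1; have hS1 : SI a.1 by case: ha1 => ? /K2W.
have ximu : comp mu xi by apply: low_in.
have [j [hj emu]] : exists j, (1 <= j <= m)%N /\ mu = (a.1 + uexp n m j)%MM.
  case: (classic (exists j, (1 <= j <= m)%N /\ mu = (a.1 + uexp n m j)%MM)) => // nh.
  case/eqP: Ba; apply: (comp_adjacent lemn lf hi hS1 hSI ha2 ximu) => j hj ej.
  by apply: nh; exists j.
have Za : Z a.2.
  apply: (comp_sub_Z _ ha2); apply: ih ha1.
  by move: ltd; rewrite emu row_deg_uexp.
pose z := glact m.+1 i m.+1 a.2.
have Zz : Z z by apply: gZ => //; lia.
have Bz : B z xi != 0.
  (* The raising scalar is nonzero: the exponent of [a.1] at j is below that of [mu], hence below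
     kappa_j and the gap. *)
  rewrite /z (raise_form lemn lf hi hS1 hSI ha2 ximu) emu (@raise_scalar F n k m' lemn a.1 j hj).
  rewrite mulf_neq0 // oppr_eq0 gt_eqF // subr_gt0 ltr_nat.
  have [_ /(_ j hj)] := (@SI2P F n k m' lemn mu).1 hSI2.
  rewrite emu expoD expo_uexp (_ : valid n m j) ?eqxx /= ?addn1; last by rewrite /valid; lia.
  by move=> h; apply: leq_trans h _; apply: gap_ge.
have ZW v : Z v -> W v by move=> /ZK/K2W.
have hZ f nu : Z f -> inv m f -> f@_nu != 0 -> high m nu -> Z (hwv m nu).
  move=> Zf invf fnu hnu; apply: (weight_component lemn sZ _ Zf invf (ZK Zf).2 fnu hnu).
  by move=> b v hb; apply: tZ.
have := sub_decomposition lemn lf sZ ZW tZ hZ Zz.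
move=> /(lspan_indexed (fun nu => @comp_subspace F n k m' nu))[t ht ez].
have Wt b : b \in t -> W b.2.
  by move=> /ht[hb1 hb2]; apply: ZW; apply: (sub_comp_sub sZ tZ hb1).
apply: NNPP => nZ; case/eqP: Bz; rewrite ez (pform_suml sW fB _ Wmu); last first.
  by move=> b /Wt Wb _.
rewrite big_seq big1 // => b /ht[hb1 hb2].
have hb1' : SI b.1 by case: hb1 => ? /ZW.
apply: (comp_orth lemn lf hb1' hSI _ hb2 ximu); apply/eqP => e.
by apply: nZ; rewrite /xi -e; case: hb1.
Qed.

End Step.

End Generation.

(** * The modules of the construction as kernels *)

Section Levels.
Variables (F : numClosedFieldType) (n : nat) (k : nat -> nat).
Local Notation N := 'C(n.+1, 2).
Local Notation P := {mpoly F[N]}.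
Local Notation x := (@x F n).
Local Notation dx := (@dx F n).
Local Notation euler := (@euler F n).
Local Notation glact := (@glact F n k).
Local Notation expo := (@expo n).
Local Notation rowop := (@rowop F n).
Local Notation row_kernel := (@row_kernel F n k).
Local Notation Vm := (@Vm F n k).
Local Notation kernel := (@kernel F n k).

Lemma row_kernel1 m : row_kernel m 1.
Proof.
move=> l hl; rewrite iterSr (_ : rowop l 1 = 0); first exact: (iter_lin0 (rowop l)).
by rewrite rowopE big1 // => j _; rewrite dx1 mulr0.
Qed.

Lemma kernel_succ m v : kernel m v -> kernel m.+1 v.
Proof.
move=> [hv hv']; split; last by move=> l a lt; apply: hv'; apply: ltnW.
apply: row_kernelS => //; rewrite iterSr (_ : rowop m.+1 v = 0).
  exact: (iter_lin0 (rowop m.+1)).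
by rewrite rowopE big1 // => j _; rewrite hv' // mulr0.
Qed.

(** Stability of the kernel under gl(m+1) gives one inclusion. For the other, the constant 1 already
    belongs to V^(m-1), and it generates all the highest weight vectors of the kernel. *)
Theorem VmE m f : (0 < m <= n)%N -> Vm m f <-> kernel m f.
Proof.
elim: m f => [|m ih] f; first by lia.
case: m ih => [|m] ih hm; first by apply: Vm1E.
have lemn : (m.+2 <= n)%N by lia.
have IH g : Vm m.+1 g <-> kernel m.+1 g by apply: ih; lia.
have [B lf] := level_form_exists F k (ltnW lemn).
have sK := @kernel_subspace F n k m.+2.
split=> [|Kf].
  apply: (U_span_min sK) => [v /IH/kernel_succ //|].
  by apply: (sl_glact lemn sK) => i j v hi hj; apply: kernel_glact.
pose Z := Vm m.+2; have sZ : subspace Z := U_span_subspace k m.+2 m.+3 (Vm m.+1).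
have gZ : forall i j v, (1 <= i <= m.+3)%N -> (1 <= j <= m.+3)%N -> Z v -> Z (glact m.+3 i j v).
  by apply: (glact_sl lemn sZ) => g v hg; apply: U_span_op.
have Z1 : Z 1.
  apply: U_span_in; apply/IH; split; first exact: row_kernel1.
  by move=> l a _; rewrite dx1.
have ZK v : Z v -> kernel m.+2 v.
  apply: (U_span_min sK) => [u /IH/kernel_succ //|].
  by apply: (sl_glact lemn sK) => i j u hi hj; apply: kernel_glact.
have KW u : kernel m.+2 u -> row_kernel m.+1 u by case=> /(row_kernel_le (leqnSn _)).
have := sub_decomposition lemn lf sK KW (kernel_tact lemn lf) (kernel_hwv lemn) Kf.
apply: (lspan_min sZ) => u [mu hmu hu].
exact: (comp_sub_Z lemn sZ gZ (generation lemn lf sZ ZK Z1 gZ hmu) hu).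
Qed.

Lemma eulerM m (p q : P) : euler m (p * q) = euler m p * q + p * euler m q.
Proof.
rewrite /Defs.euler mulr_suml mulr_sumr -big_split; apply: eq_bigr => a _.
by rewrite dxM /=; ring.
Qed.

Lemma euler_x m a : valid n m a -> euler m (x m a) = x m a.
Proof.
move=> v; have := v; rewrite /valid => hv.
rewrite /Defs.euler (bigD1_seq a) ?mem_index_iota ?iota_uniq //=; last by lia.
rewrite dx_x v !eqxx mulr1 big1 ?addr0 // => b /negbTE nb.
by rewrite dx_x nb !andbF mulr0.
Qed.

Lemma euler_dx m a p : valid n m a -> euler m (dx m a p) = dx m a (euler m p) - dx m a p.
Proof.
move=> v; have := v; rewrite /valid => hv.
rewrite /Defs.euler [dx m a (\sum_(_ <= _ < _) _)]linear_sum /=.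
rewrite [in RHS](eq_bigr (fun s => x m s * dx m s (dx m a p) + dx m s p *+ (a == s))); last first.
  by move=> s _; rewrite dx_xM v eqxx /= [dx m a (dx m s p)]dx_comm.
rewrite big_split /= (bigD1_seq a (F := fun s => dx m s p *+ (a == s))) ?mem_index_iota ?iota_uniq //=; last by lia.
rewrite eqxx mulr1n [X in _ = _ + (_ + X) - _]big1 ?addr0 ?addrK // => s.
by rewrite eq_sym => /negbTE ->; rewrite mulr0n.
Qed.

Local Notation lift := (comp_mpoly [tuple x n s.+1 | s < n]).

Lemma lift_homog r (q : {mpoly F[n]}) v : (0 < n)%N -> q \is r.-homog -> row_kernel n.-1 v ->
  row_kernel n.-1 (lift q * v) /\ euler n (lift q) = r%:R *: lift q.
Proof.
have sR := @row_kernel_subspace F n k n.-1.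
move=> n0.
pose Q d (p : P) := (forall v, row_kernel n.-1 v -> row_kernel n.-1 (p * v)) /\ euler n p = d%:R *: p.
have QM d e p p' : Q d p -> Q e p' -> Q (d + e)%N (p * p').
  move=> [h1 h2] [h3 h4]; split; first by move=> u hu; rewrite -mulrA; auto.
  by rewrite eulerM h2 h4 natrD scalerDl -scalerAl -scalerAr.
have Q1 : Q 0%N 1.
  split; first by move=> u hu; rewrite mul1r.
  by rewrite scale0r /Defs.euler big1 // => s _; rewrite dx1 mulr0.
have Qx (s : 'I_n) : Q 1%N (x n s.+1).
  split; first by move=> u hu; apply: row_kernel_x => //; rewrite prednK.
  by rewrite scale1r euler_x // /valid; have := ltn_ord s; lia.
have Qpow d p b : Q d p -> Q (d * b)%N (p ^+ b).
  move=> hp; elim: b => [|b ih]; first by rewrite muln0 expr0.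
  by rewrite mulnS exprS; apply: QM.
have Qmon (nu : 'X_{1..n}) : Q (mdeg nu) (lift 'X_[nu]).
  rewrite comp_mpolyX mdegE; apply: (big_ind2 (fun d p => Q d p)) => // [d p e q' h1 h2|i _].
    exact: QM.
  by rewrite tnth_mktuple; have := Qpow _ _ (nu i) (Qx i); rewrite mul1n.
move=> /dhomogP hq hv; rewrite [q]mpolyE linear_sum /= mulr_suml; split.
  apply: (subspace_sum sR) => nu hnu _; rewrite linearZ /= -scalerAl.
  by apply: (subspaceZ _ sR); apply: (Qmon nu).1.
rewrite linear_sum scaler_sumr big_seq [RHS]big_seq; apply: eq_bigr => nu hnu /=.
rewrite !linearZ /= (Qmon nu).2.
by have /= -> := hq _ hnu; rewrite !scalerA mulrC.
Qed.

(** Multiplication by the variables of row n preserves [row_kernel n.-1], which gives one direction.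
    Conversely Euler's identity writes f as a combination of x_{n,a} times its derivatives, to which
    the induction on r applies. *)
Lemma MhatE r f : (2 <= n)%N ->
  Mhat F n k r f <-> row_kernel n.-1 f /\ euler n f = r%:R *: f.
Proof.
move=> n2; have n1 : (0 < n.-1 <= n)%N by lia.
have n0 : (0 < n)%N by lia.
have ME v : M k v <-> kernel n.-1 v by apply: VmE.
have sR := @row_kernel_subspace F n k n.-1.
have eM v : M k v -> euler n v = 0.
  by move=> /ME[_ h]; rewrite /Defs.euler big1 // => s _; rewrite h ?mulr0 //; lia.
split.
  apply: (lspan_min (W := fun f => row_kernel n.-1 f /\ euler n f = r%:R *: f)).
    split; first by rewrite linear0 scaler0; split=> //; case: sR.
    move=> a u v [hu hu'] [hv hv']; split; first exact: (subspaceL _ sR).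
    by rewrite linearP /= hu' hv' scalerDr !scalerA mulrC.
  move=> _ [_ [v [[q hq ->] Mv ->]]].
  have [hv _] := (ME v).1 Mv; have [h1 h2] := lift_homog n0 hq hv.
  by split=> //; rewrite eulerM h2 eM // mulr0 addr0 scalerAl.
have sM q := @lspan_subspace F P (fun p : P => exists q' v, [/\ A q q', M k v & p = q' * v]).
elim: r f => [|r ih] f [hf ef].
  apply: lspan_in; exists 1, f; split; last by rewrite mul1r.
  - by exists 1; rewrite ?rmorph1 ?dhomog1.
  apply/ME; split=> // l a lt; case: (boolP (valid n l a)) => [v|/dx_invalid -> //].
  have ln : l = n by move: v; rewrite /valid; lia.
  rewrite ln in v *; apply/mpolyP => mu; rewrite mcoeff_dx // mcoeff0.
  have := @mcoeff_euler F n n.-1; rewrite prednK; last by lia.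
  move=> /(_ f (mu + uexp n n a)%MM); rewrite ef scale0r mcoeff0 => /esym/eqP.
  rewrite -mulr_natr mulf_eq0 pnatr_eq0 => /orP[/eqP ->|]; first by rewrite mul0rn.
  have ea : expo (mu + uexp n n a)%MM n a = (expo mu n a).+1 by rewrite expoD expo_uexp v !eqxx addn1.
  rewrite /row_deg prednK // sum_nat_seq_eq0 => /allP/(_ a); rewrite mem_index_iota /= ea.
  by move: v; rewrite /valid => v; lia.
have rn : (r.+1)%:R != 0 :> F by rewrite pnatr_eq0.
have -> : f = r.+1%:R^-1 *: euler n f by rewrite ef scalerA mulVf // scale1r.
apply: (subspaceZ _ (sM _)); apply: (subspace_sum (sM _)) => a; rewrite mem_index_iota => ha _.
have va : valid n n a by rewrite /valid; lia.
have : Mhat F n k r (dx n a f).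
  apply: ih; split; first by apply: row_kernel_dx => //; lia.
  by rewrite euler_dx // ef dxZ -natr1 scalerDl scale1r addrK.
apply: (lspan_min (W := fun g => Mhat F n k r.+1 (x n a * g))).
  split; first by rewrite mulr0; case: (sM r.+1).
  by move=> b u v hu hv; rewrite mulrDr -scalerAr; apply: (subspaceL _ (sM _)).
move=> _ [_ [v [[q hq ->] Mv ->]]]; apply: lspan_in.
have lta : (a.-1 < n)%N by lia.
exists (lift ('X_(Ordinal lta) * q)), v; split=> //.
  exists ('X_(Ordinal lta) * q) => //; rewrite -add1n; apply: dhomogM => //.
  by rewrite dhomogX /= mdeg1.
rewrite rmorphM /= comp_mpolyXU -tnth_nth tnth_mktuple /= prednK ?mulrA //; lia.
Qed.

Lemma MbarE f : (0 < n)%N -> Mbar F n k f <-> row_kernel n f.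
Proof.
move=> n0; have h := @VmE n f; rewrite /Mbar h; last by rewrite n0 leqnn.
split=> [[]|hf] //; split=> // l a lt; apply: dx_invalid.
by rewrite /valid; lia.
Qed.

End Levels.

(** * Singular vectors and irreducible components *)

Section Components.
Variables (F : numClosedFieldType) (m' : nat) (k : nat -> nat).
Local Notation n := m'.+1.
Local Notation N := 'C(n.+1, 2).
Local Notation P := {mpoly F[N]}.
Local Notation x := (@x F n).
Local Notation euler := (@euler F n).
Local Notation tact := (@tact F n k).
Local Notation glact := (@glact F n k).
Local Notation expo := (@expo n).
Local Notation ev := (@ev F n).
Local Notation gl_wt := (@gl_wt F n k).
Local Notation inv := (@gl_invariant F n k).
Local Notation hwv := (@hwv F n n).
Local Notation hess := (@hess F n n).
Local Notation row_kernel := (@row_kernel F n k).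
Local Notation kap := (kap n k).
Local Notation comp := (@comp F n k m').
Local Notation sl_op := (@sl_op F n k).

Let lenn : (n <= n)%N. Proof. exact: leqnn. Qed.

(** The exponent beta_{i+1} belongs to the minor D_{n,n-i}(n-i), hence the reversed column. *)
Definition row_mnm (b : 'X_{1..n}) : 'X_{1..N} := (\sum_(i < n) uexp n n (n - i) *+ b i)%MM.

Lemma expo_muln (mu : 'X_{1..N}) q l a : expo (mu *+ q)%MM l a = (q * expo mu l a)%N.
Proof. by elim: q => [|q ih]; rewrite ?mulm0n ?expo0 // mulmS expoD ih mulSn. Qed.

Lemma expo_row_mnm b l a : expo (row_mnm b) l a
  = (\sum_(i < n) b i * ((n == l) && (n - i == a)))%N.
Proof.
rewrite /row_mnm (big_morph (fun mu => expo mu l a) (fun mu nu => expoD mu nu l a) (expo0 n l a)).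
apply: eq_bigr => i _; rewrite expo_muln expo_uexp (_ : valid n n (n - i)) //.
by rewrite /valid leqnn leq_subr subn_gt0 ltn_ord.
Qed.

Lemma expo_row_mnmE b (i : 'I_n) : expo (row_mnm b) n (n - i) = b i.
Proof.
rewrite expo_row_mnm (bigD1 i) //= !eqxx muln1 big1 ?addn0 // => j.
rewrite -val_eqE /= => /negbTE nj.
rewrite (_ : (n - j == n - i)%N = false) ?muln0 //.
by have := ltn_ord i; have := ltn_ord j; move: nj; lia.
Qed.

Lemma high_row_mnm b : high n (row_mnm b).
Proof.
apply/highP => l a lt; rewrite expo_row_mnm big1 // => i _.
by rewrite (_ : n == l = false) ?muln0 //; apply/eqP; lia.
Qed.

Lemma row_mnm_inj : injective row_mnm.
Proof. by move=> b b' e; apply/mnmP => i; rewrite -!expo_row_mnmE e. Qed.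

Lemma row_mnmK mu : high n mu -> exists b, mu = row_mnm b.
Proof.
move=> hmu; exists [multinom expo mu n (n - i) | i < n]; apply: expoP => l a.
rewrite /valid => v; case: (ltngtP l n) => ln; last 1 first.
- rewrite ln; have lt : (n - a < n)%N by lia.
  have -> : a = (n - Ordinal lt)%N by rewrite /= subKn; lia.
  by rewrite expo_row_mnmE mnmE.
- by rewrite (elimT (highP _ _) hmu l a ln) (elimT (highP _ _) (high_row_mnm _) l a ln).
by move: v ln; lia.
Qed.

Lemma row_deg_row_mnm b : row_deg m' (row_mnm b) = mdeg b.
Proof.
rewrite /row_deg big_add1 big_mkord (reindex_inj rev_ord_inj) mdegE; apply: eq_bigr => i _ /=.
by rewrite -[RHS]expo_row_mnmE subnSK.
Qed.

(** The reversal turns kappa_{n-i} into k_{i+1}. With M = n - 1 the only bound missing is the one on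
    beta_1, which is the difference between the two index sets of the theorem. *)
Lemma row_mnm_bound M b : (M <= n)%N ->
  (forall l, (1 <= l <= M)%N -> (expo (row_mnm b) n l <= kap l)%N) <->
  forall i : 'I_n, (n <= M + i)%N -> (b i <= k i.+1)%N.
Proof.
move=> leM; split=> h.
  move=> i hi; have lti := ltn_ord i; rewrite -expo_row_mnmE.
  have e : i.+1 = (n.+1 - (n - i))%N by lia.
  by rewrite e; apply: h; lia.
move=> l hl; have lt : (n - l < n)%N by lia.
have := h (Ordinal lt); rewrite -expo_row_mnmE /= subKn; last by lia.
have hM : (n <= M + (n - l))%N by lia.
rewrite kapE (@subSn l n); last by lia.
by move=> h'; apply: h'.
Qed.

(** A unitriangular left factor with the later minors as last row turns the last row of the matrix
    into [hess i] followed by zeros, by orthogonality to the other columns. The remaining block is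
    triangular with diagonal -1, and its sign cancels that of the cofactor. *)
Lemma D_hess i : (1 <= i <= n)%N -> D F n i = hess i.
Proof.
move=> hi; rewrite /D; set dd := (n - i)%N.
pose A : 'M[P]_(dd.+1) := \matrix_(a, b) x (i + a) (i + b).
pose L : 'M[P]_(dd.+1) := \matrix_(a, b) if a == ord_max then hess (i + b).+1 else (a == b)%:R.
have LA b : (L *m A) ord_max b = hess i *+ (b == ord0).
  rewrite mxE; under eq_bigr do rewrite !mxE eqxx.
  have ei : (i + dd = n)%N by rewrite /dd; lia.
  have shift (f : nat -> P) : \sum_(a < dd.+1) f (i + a)%N = \sum_(i <= l < n.+1) f l.
    rewrite -(big_mkord xpredT (fun a => f (i + a)%N)).
    rewrite -[i in RHS]add0n big_addn (_ : n.+1 - i = dd.+1)%N; last by rewrite /dd; lia.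
    by apply: eq_bigr => a _; rewrite addnC.
  rewrite (shift (fun l => hess l.+1 * x l (i + b))).
  have [->|nb] := eqVneq b ord0.
    rewrite addn0 mulr1n hess_rec; last by lia.
    by apply: eq_bigr => l _; rewrite mulrC.
  have b0 : (0 < b)%N by rewrite lt0n; move: nb; rewrite -val_eqE.
  have := ltn_ord b => ltb; rewrite mulr0n.
  rewrite (big_cat_nat _ (n := (i + b).-1)) /=; [|lia..].
  rewrite [X in X + _]big_nat_cond [X in X + _]big1 ?add0r; last first.
    by move=> l /andP[/andP[_ h] _]; rewrite x_zero ?mulr0 //; lia.
  rewrite -[RHS](@hess_orth F n n (i + b)); last by lia.
  by apply: eq_bigr => l _; rewrite mulrC.
have dL : \det L = 1.
  rewrite det_trig ?big1 // => [a _|]; first rewrite mxE; last first.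
    apply/is_trig_mxP => a b lt; rewrite mxE; case: eqP => [e|_].
      by move: lt (ltn_ord b); rewrite e /=; lia.
    by rewrite (_ : a == b = false) //; apply/eqP => e; rewrite e ltnn in lt.
  case: eqP => [->|_]; last by rewrite eqxx.
  by rewrite /= (_ : (i + dd).+1 = n.+1)%N ?hess_last // /dd; lia.
rewrite -[LHS]mul1r -dL -det_mulmx -/A (expand_det_row _ ord_max).
rewrite (bigD1 ord0) //= LA eqxx big1 ?addr0 => [|b /negbTE nb]; last by rewrite LA nb mul0r.
rewrite /cofactor /= addn0 det_trig; last first.
  apply/is_trig_mxP => a b lt; rewrite !mxE big1 // => q _; rewrite !mxE lift0.
  have neq : lift ord_max a == ord_max :> 'I_(dd.+1) = false by apply/eqP => /(congr1 (@nat_of_ord _)); rewrite lift_max /=; have := ltn_ord a; lia.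
  rewrite neq; case: eqP => [<-|_]; last by rewrite mul0r.
  by rewrite lift_max x_zero ?mulr0 //; lia.
rewrite (eq_bigr (fun=> -1)) => [|a _]; last first.
  rewrite !mxE (bigD1 (lift ord_max a)) //= !mxE lift0 lift_max.
  have neq : lift ord_max a == ord_max :> 'I_(dd.+1) = false by apply/eqP => /(congr1 (@nat_of_ord _)); rewrite lift_max /=; have := ltn_ord a; lia.
  rewrite neq eqxx mul1r addnS x_sup big1 ?addr0 // => q nq.
  by rewrite !mxE neq eq_sym (negbTE nq) mul0r.
by rewrite prodr_const card_ord -exprD addnn -signr_odd odd_double mulr1 mulr1n.
Qed.

Lemma hwvD mu nu : hwv (mu + nu)%MM = hwv mu * hwv nu.
Proof. by rewrite !hwvE mpolyXD rmorphM. Qed.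

Lemma hwv0 : hwv 0%MM = 1. Proof. by rewrite !hwvE mpolyX0 rmorph1. Qed.

Lemma xi_hwv b : xi F n b = hwv (row_mnm b).
Proof.
rewrite /xi /row_mnm (big_morph hwv hwvD hwv0); apply: eq_bigr => i _.
have hpow mu q : hwv (mu *+ q)%MM = hwv mu ^+ q.
  by elim: q => [|q ih]; rewrite ?mulm0n ?hwv0 // mulmS hwvD ih exprS.
have lti := ltn_ord i; have v : valid n n (n - i) by rewrite /valid; lia.
rewrite hpow D_hess; last by lia.
congr (_ ^+ _); have [w e] := var_idxP v; have [er ec] := rowcolE e.
rewrite !hwvE /uexp e /minor_subst comp_mpolyXU -tnth_nth tnth_mktuple er ec eqxx.
by rewrite ltnn.
Qed.

Lemma sl_root i j v : (1 <= i <= n)%N -> (1 <= j <= n)%N -> i != j ->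
  sl_op n (RootE i j) v = tact n i j v.
Proof.
move=> hi hj nij; rewrite sl_opE //=; last by lia.
by rewrite (@glact_inner F n k n) ?(negbTE nij) ?addr0 //; lia.
Qed.

Lemma sl_diag i j v : (1 <= i <= n)%N -> (1 <= j <= n)%N ->
  sl_op n (DiagH i j) v = tact n i i v - tact n j j v.
Proof.
move=> hi hj; rewrite sl_opE //=; last by lia.
rewrite (@glact_inner F n k n i i) ?(@glact_inner F n k n j j) ?eqxx ?mulr1n; [|lia..].
by rewrite opprD addrACA subrr addr0.
Qed.

Lemma singular_inv v : singular F n k v -> inv n v.
Proof. by case=> _ _ h s t hts les; rewrite -(h s t hts les) sl_root //; lia. Qed.

Lemma hwv_singular mu a : high n mu -> a != 0 -> singular F n k (a *: hwv mu).
Proof.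
move=> hmu a0; split.
- by rewrite scaler_eq0 negb_or a0 hwv_n0.
- exists (fun i => ((expo mu n (n + 1 - i))%:R + gl_wt n (n + 1 - i))
      - ((expo mu n (n - i))%:R + gl_wt n (n - i))) => i hi.
  have hi' : (1 <= i < n)%N by move: hi => /=; lia.
  rewrite sl_diag; [|lia..]; rewrite !linearZ /= !(@hwv_weight F n k n lenn _ mu _ hmu); [|lia..].
  by rewrite -scalerDr -scalerBl.
move=> s t hts les; rewrite sl_root; [|lia..].
by rewrite linearZ /= (hwv_invariant F k mu lenn hts les) scaler0.
Qed.

(** A weight of sl(n) determines the exponents of the minors only up to a common shift, and the
    degree r fixes the shift. Hence a single monomial in the minors can occur. *)
Lemma singular_unique v r : singular F n k v -> euler n v = r%:R *: v ->
  exists mu, [/\ high n mu, v@_mu != 0 & v = v@_mu *: hwv mu].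
Proof.
move=> sv ev_; have invv := singular_inv sv; have [v0 [w hw] _] := sv.
have evE mu : (ev n v)@_mu = v@_mu *+ high n mu by apply: mcoeff_ev.
have [mu hmu vmu] : exists2 mu, high n mu & v@_mu != 0.
  have : ev n v != 0 by apply: contra v0 => /eqP h; apply/eqP; apply: invariant_ev_inj invv h.
  rewrite -msupp_eq0; case E : (msupp _) => [|mu s] // _; exists mu.
    have : mu \in msupp (ev n v) by rewrite E mem_head.
    by rewrite mcoeff_msupp evE; case: (high n mu) => //; rewrite mulr0n eqxx.
  have : mu \in msupp (ev n v) by rewrite E mem_head.
  by rewrite mcoeff_msupp evE; case: (high n mu); rewrite ?mulr0n ?eqxx.
have deg nu : v@_nu != 0 -> row_deg m' nu = r.
  move=> vnu; have := @mcoeff_euler F n m' v nu; rewrite ev_ mcoeffZ -(mulr_natr v@_nu) mulrC.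
  by move=> /(mulfI vnu) e; apply/eqP; rewrite -(eqr_nat F) e.
have ediag a : (1 <= a <= n)%N -> ev n (tact n a a v)
    = \sum_(nu <- msupp v) (v@_nu * ((expo nu n a)%:R + gl_wt n a)) *: ev n (hwv nu).
  move=> ha; rewrite {1}(invariant_sum lenn invv) linear_sum linear_sum; apply: eq_bigr => nu _.
  rewrite !linearZ /=; case: (boolP (high n nu)) => [hn|/hwv_low ->]; last by rewrite ?(linear0, scaler0).
  by rewrite (@hwv_weight F n k n lenn a nu ha hn) linearZ /= scalerA.
have coefd a nu : (1 <= a <= n)%N -> high n nu -> v@_nu != 0 ->
    (ev n (tact n a a v))@_nu = v@_nu * ((expo nu n a)%:R + gl_wt n a).
  move=> ha hnu vnu; rewrite ediag // raddf_sum (bigD1_seq nu) ?msupp_uniq ?mcoeff_msupp //=.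
  rewrite mcoeffZ ev_hwv // mcoeffX eqxx mulr1 big1 ?addr0 // => nu' ne.
  case: (boolP (high n nu')) => [hn|/hwv_low ->]; last by rewrite linear0 scaler0 mcoeff0.
  by rewrite mcoeffZ ev_hwv // mcoeffX (negbTE ne) mulr0.
have wt a nu : (1 <= a < n)%N -> high n nu -> v@_nu != 0 ->
    ((expo nu n a.+1)%:R + gl_wt n a.+1) - ((expo nu n a)%:R + gl_wt n a) = w (n - a)%N.
  move=> ha hnu vnu; apply: (mulfI vnu); rewrite mulrBr -!coefd //; [|lia..].
  rewrite -mcoeffB -linearB /=.
  have hi : (1 <= n - a <= n.-1)%N by move=> /=; lia.
  have := hw _ hi; rewrite (_ : n + 1 - (n - a) = a.+1)%N; last by lia.
  rewrite (_ : n - (n - a) = a)%N; last by lia.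
  rewrite sl_diag; [|lia..]; move=> ->.
  by rewrite linearZ mcoeffZ evE hnu mulr1n mulrC.
have uniq nu : high n nu -> v@_nu != 0 -> nu = mu.
  move=> hnu vnu; apply: expoP => l a vla; case: (ltngtP l n) => ln; last 1 first.
  - have step b : (1 <= b < n)%N -> (expo nu n b.+1 + expo mu n b = expo mu n b.+1 + expo nu n b)%N.
      move=> hb; have := wt b nu hb hnu vnu; rewrite -(wt b mu hb hmu vmu) => e.
      apply/eqP; rewrite -(eqr_nat F) !natrD -subr_eq0; apply/eqP.
      by move/eqP: e; rewrite -subr_eq0 => /eqP e; rewrite -[RHS]e; ring.
    have allb b : (1 <= b <= n)%N -> (expo nu n b + expo mu n 1 = expo mu n b + expo nu n 1)%N.
      by elim: b => // -[|b] ih hb; [rewrite addnC | have := ih; have := step b.+1; lia].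
    have : (row_deg m' nu + n * expo mu n 1 = row_deg m' mu + n * expo nu n 1)%N.
      have cst c : (n * c = \sum_(1 <= a < n.+1) c)%N by rewrite sum_nat_const_nat subn1.
      rewrite /row_deg !cst -!big_split big_seq [RHS]big_seq; apply: eq_bigr => b.
      by rewrite mem_index_iota => hb; apply: allb.
    rewrite !deg // => /addnI/eqP; rewrite eqn_mul2l /= => /eqP e1.
    by have := allb a; move: vla; rewrite ln /valid => vla; rewrite e1; lia.
  - by rewrite (elimT (highP _ _) hnu l a ln) (elimT (highP _ _) hmu l a ln).
  by move: vla ln; rewrite /valid; lia.
exists mu; split=> //; rewrite {1}(invariant_sum lenn invv) (bigD1_seq mu) ?msupp_uniq ?mcoeff_msupp //=.
rewrite big_seq_cond big1 ?addr0 // => nu /andP[snu ne].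
case: (boolP (high n nu)) => [hn|/hwv_low ->]; last by rewrite scaler0.
by rewrite (uniq nu hn) ?eqxx -?mcoeff_msupp // in ne.
Qed.

(** Taken with M = n - 1 for the tensor product and with M = n for the irreducible module. *)
Theorem singularE M r v : (m' <= M <= n)%N ->
  (row_kernel M v /\ euler n v = r%:R *: v) /\ singular F n k v <->
  exists b : 'X_{1..n}, (mdeg b = r /\ forall i : 'I_n, (n <= M + i)%N -> (b i <= k i.+1)%N) /\
    exists2 a : F, a != 0 & v = a *: xi F n b.
Proof.
move=> /andP[_ leM]; split.
  move=> [[hv ev_] sv]; have [mu [hmu vmu ->]] := singular_unique sv ev_.
  have [b eb] := row_mnmK hmu; exists b; split; last by exists v@_mu; rewrite // xi_hwv -eb.
  split; last first.
    apply/(row_mnm_bound b leM); rewrite -eb.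
    apply/(@row_kernel_hwvE F n k m' lenn M mu leM hmu).
    exact: (row_kernel_hwv lenn leM hv (singular_inv sv) vmu hmu).
  have := @mcoeff_euler F n m' v mu; rewrite ev_ mcoeffZ -(mulr_natr v@_mu) mulrC eb row_deg_row_mnm -eb.
  by move=> /(mulfI vmu) e; apply/eqP; rewrite -(eqr_nat F) e.
move=> [b [[db hb] [a a0 ->]]]; rewrite xi_hwv; have hh := high_row_mnm b.
split; last exact: hwv_singular.
split.
  apply: (subspaceZ _ (@row_kernel_subspace F n k M)).
  by apply/(@row_kernel_hwvE F n k m' lenn M _ leM hh)/row_mnm_bound.
by rewrite linearZ /= (hwv_euler F k lenn hh) -/(row_deg m' _) row_deg_row_mnm db scalerA mulrC -scalerA.
Qed.

Section Decomposition.
Variable B : P -> P -> F.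
Hypothesis lf : level_form k m' B.
Variable W' : P -> Prop.
Hypotheses (sW' : subspace W') (W'W : forall u, W' u -> row_kernel m' u)
  (TW' : forall i j u, (1 <= i <= n)%N -> (1 <= j <= n)%N -> W' u -> W' (tact n i j u))
  (W'_hwv : forall f mu, W' f -> inv n f -> f@_mu != 0 -> high n mu -> W' (hwv mu)).

Lemma comp_sl mu g v : sub_idx m' W' mu -> in_sl n g -> comp mu v -> comp mu (sl_op n g v).
Proof.
move=> hmu; case: g => i j; rewrite [in_sl _ _]/= => hg hv.
  rewrite sl_root; [|lia..]; apply: (sub_comp_stable lenn hmu) => //; lia.
rewrite sl_diag; [|lia..]; apply: (subspaceB (@comp_subspace F n k m' mu));
  apply: (sub_comp_stable lenn hmu) => //; lia.
Qed.

Lemma generated_comp mu v : sub_idx m' W' mu -> @generated F n k (hwv mu) v <-> comp mu v.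
Proof.
move=> hmu; split.
  apply: (U_span_min (@comp_subspace F n k m' mu)) => [_ <-|g u]; first exact: low_in.
  exact: comp_sl.
move=> hv; apply: hv => [||i j u lt]; [exact: U_span_subspace | exact: U_span_in |].
rewrite /tactI /= -sl_root ?ltn_ord //; last by apply/eqP => -[e]; rewrite e ltnn in lt.
by apply: U_span_op; rewrite ?leqnSn //= !ltn_ord /=; apply/eqP => -[e]; rewrite e ltnn in lt.
Qed.

Lemma comp_irreducible mu : sub_idx m' W' mu -> @irreducible F n k (@generated F n k (hwv mu)).
Proof.
move=> hmu; have gc v := generated_comp v hmu; split.
- split; first exact: U_span_subspace.
  by move=> g v hg; apply: U_span_op => //; apply: leqnSn.
- by exists (hwv mu); [apply: U_span_in | apply: hwv_n0; case: hmu].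
move=> S [sS hS] SC; case: (classic (exists2 v, S v & v != 0)) => [[v Sv v0]|h]; last first.
  by left=> v Sv; apply/eqP; apply: contraT => v0; case: h; exists v.
right=> u /gc; apply: (sub_comp_irreducible lenn lf sW' W'W TW' hmu sS _ _ Sv v0).
  by move=> i j w hi hj nij Sw; rewrite -sl_root //; apply: hS => //=; rewrite hi hj.
by move=> w /SC/gc.
Qed.

(** Exhaustion is the orthogonal decomposition, and directness follows from orthogonality by pairing
    a vanishing sum with each of its terms. *)
Theorem components (J : finType) (R : pred J) (bt : J -> 'X_{1..n}) (W : P -> Prop) :
  injective bt -> (forall v, W v <-> W' v) ->
  (forall b, W' (hwv (row_mnm b)) <-> exists2 j, R j & b = bt j) ->
  generate_components F n k R (fun j => xi F n (bt j)) W.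
Proof.
move=> inj_bt WE hR.
have idx j : R j -> sub_idx m' W' (row_mnm (bt j)).
  by move=> Rj; split; [apply: high_row_mnm | apply/hR; exists j].
have gc j v : R j -> @generated F n k (xi F n (bt j)) v <-> comp (row_mnm (bt j)) v.
  by move=> Rj; rewrite xi_hwv; apply: generated_comp; apply: idx.
have fB := lf_form lf; have sW := @row_kernel_subspace F n k m'.
have cW j v : R j -> comp (row_mnm (bt j)) v -> row_kernel m' v.
  by move=> Rj hv; apply: W'W; apply: (sub_comp_sub sW' TW' (idx j Rj) hv).
split.
  move=> j Rj; split; last by rewrite xi_hwv; apply: comp_irreducible; apply: idx.
  by rewrite xi_hwv -[hwv _]scale1r; apply: hwv_singular; [apply: high_row_mnm | apply: oner_neq0].
split=> [v|w hw w0 j Rj].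
  split=> [/WE W'v|[w hw ->]].
    have := sub_decomposition lenn lf sW' W'W TW' W'_hwv W'v.
    move=> /(lspan_components (fun mu => @comp_subspace F n k m' mu)
      (J := J) (idx := row_mnm \o bt) (R := R) (inj_comp row_mnm_inj inj_bt)).
    case=> [mu [hmu W'mu]|w hw ->].
      have [b eb] := row_mnmK hmu; rewrite eb in W'mu *.
      by have [j Rj ej] := (hR b).1 W'mu; exists j; rewrite //= ej.
    by exists w => // j Rj; apply/(gc _ _ Rj); apply: hw.
  apply/WE; apply: (subspace_sum sW') => j _ Rj.
  by apply: (sub_comp_sub sW' TW' (idx j Rj)); apply/(gc _ _ Rj); apply: hw.
have hw' i : R i -> comp (row_mnm (bt i)) (w i) by move=> Ri; apply/(gc _ _ Ri); apply: hw.
have Ww i : R i -> row_kernel m' (w i) by move=> Ri; apply: (cW i) => //; apply: hw'.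
apply: (pform_eq0 fB (Ww j Rj)); have := pform0l sW fB (Ww j Rj); rewrite -w0.
rewrite (pform_suml sW fB _ (Ww j Rj)) => [|i _ Ri]; last exact: Ww.
rewrite (bigD1 j) //= [X in _ + X = _]big1 ?addr0 // => i /andP[Ri nij].
apply: (sub_comp_orth lenn lf sW' W'W TW' (idx i Ri) (idx j Rj) _ (hw' i Ri) (hw' j Rj)).
by rewrite (inj_eq row_mnm_inj) (inj_eq inj_bt).
Qed.

End Decomposition.

End Components.

(** * The dimension identities *)

Section Determinants.

Lemma det_row_scale (R : comNzRingType) q (b : 'I_q -> R) (A : 'M[R]_q) :
  \det (\matrix_(i, j) (b i * A i j)) = (\prod_i b i) * \det A.
Proof.
have -> : \matrix_(i, j) (b i * A i j) = diag_mx (\row_i b i) *m A.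
  by apply/matrixP => i j; rewrite mul_diag_mx !mxE.
by rewrite det_mulmx det_diag; congr (_ * _); apply: eq_bigr => i _; rewrite mxE.
Qed.

Lemma det_sum_rows (R : comNzRingType) q K (Q : 'I_q -> pred 'I_K) (f : 'I_q -> 'I_K -> 'I_q -> R) :
  \det (\matrix_(i, j) \sum_(b | Q i b) f i b j)
  = \sum_(b in family Q) \det (\matrix_(i, j) f i (b i) j).
Proof.
rewrite /determinant exchange_big /=; apply: eq_bigr => s _; rewrite -mulr_sumr; congr (_ * _).
rewrite (eq_bigr (fun i => \sum_(b | Q i b) f i b (s i))); last by move=> i _; rewrite mxE.
rewrite bigA_distr_big_dep; apply: eq_bigr => b _; apply: eq_bigr => i _; by rewrite mxE.
Qed.

Lemma det_unitrig_mul (R : comNzRingType) q (L A : 'M[R]_q) : is_trig_mx L ->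
  (forall i, L i i = 1) -> \det (L *m A) = \det A.
Proof. by move=> tL dL; rewrite det_mulmx det_trig // big1 ?mul1r // => i _. Qed.

Lemma sum_ord_eq (R : nzRingType) q (a : nat) (f : nat -> R) :
  \sum_(b < q) (b == a :> nat)%:R * f b = if (a < q)%N then f a else 0.
Proof.
case: ifP => [lt|/negbT nlt].
  rewrite (bigD1 (Ordinal lt)) //= eqxx mul1r big1 ?addr0 // => b.
  by rewrite -val_eqE /= => /negbTE ->; rewrite mul0r.
rewrite big1 // => b _; case: eqP => [e|]; last by rewrite mul0r.
by rewrite -e ltn_ord in nlt.
Qed.

(** All rows change simultaneously, through multiplication by an upper unitriangular matrix; for
    [det_sub_prev] the matrix is lower unitriangular. *)
Lemma det_sub_next (R : comNzRingType) q (f : nat -> nat -> R) :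
  \det (\matrix_(i < q, j < q) (f i j - (if (i.+1 < q)%N then f i.+1 j else 0)))
  = \det (\matrix_(i < q, j < q) f i j).
Proof.
pose L : 'M[R]_q := \matrix_(i, j) ((j == i :> nat)%:R - (j == i.+1 :> nat)%:R).
have -> : \matrix_(i < q, j < q) (f i j - (if (i.+1 < q)%N then f i.+1 j else 0))
    = L *m (\matrix_(i < q, j < q) f i j).
  apply/matrixP => i j; rewrite !mxE; under [RHS]eq_bigr do rewrite !mxE mulrBl.
  rewrite sumrB (sum_ord_eq q i (fun b => f b j)) ltn_ord.
  by rewrite (sum_ord_eq q i.+1 (fun b => f b j)).
rewrite det_mulmx -(det_tr L) det_trig; last first.
  apply/is_trig_mxP => i j lt; rewrite !mxE (_ : i == j :> nat = false); last by apply/eqP; lia.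
  by rewrite (_ : i == j.+1 :> nat = false) ?subrr //; apply/eqP; lia.
rewrite big1 ?mul1r // => i _; rewrite !mxE eqxx (_ : i == i.+1 :> nat = false) ?subr0 //.
by apply/eqP; lia.
Qed.

Lemma det_sub_prev (R : comNzRingType) q (c : nat -> R) (f : nat -> nat -> R) :
  \det (\matrix_(i < q, j < q) (f i j - (if (0 < i)%N then c i * f i.-1 j else 0)))
  = \det (\matrix_(i < q, j < q) f i j).
Proof.
pose L : 'M[R]_q := \matrix_(i, j) ((j == i :> nat)%:R - (j.+1 == i :> nat)%:R * c i).
have -> : \matrix_(i < q, j < q) (f i j - (if (0 < i)%N then c i * f i.-1 j else 0))
    = L *m (\matrix_(i < q, j < q) f i j).
  apply/matrixP => i j; rewrite !mxE; under [RHS]eq_bigr do rewrite !mxE mulrBl.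
  rewrite sumrB (sum_ord_eq q i (fun b => f b j)) ltn_ord; congr (_ - _).
  case: ltnP => hi; last first.
    by rewrite big1 // => b _; rewrite (_ : b.+1 == i = false) ?mul0r //; apply/eqP; lia.
  have lt : (i.-1 < q)%N by have := ltn_ord i; lia.
  rewrite [LHS](_ : _ = if (i.-1 < q)%N then c i * f i.-1 j else 0); last by rewrite lt.
  rewrite -(sum_ord_eq q i.-1 (fun b => c i * f b j)).
  by apply: eq_bigr => b _; rewrite mulrA (_ : (b.+1 == i) = (b == i.-1 :> nat)) //; lia.
rewrite det_unitrig_mul //.
  apply/is_trig_mxP => i j lt; rewrite !mxE (_ : j == i :> nat = false); last by apply/eqP; lia.
  by rewrite (_ : j.+1 == i :> nat = false) ?mul0r ?subrr //; apply/eqP; lia.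
move=> i; rewrite !mxE eqxx (_ : i.+1 == i :> nat = false) ?mul0r ?subr0 //.
by apply/eqP; lia.
Qed.

End Determinants.

(** * Weyl's product as a determinant of binomial coefficients *)

Section Numerics.

(* The sign turns the difference products for decreasing sequences into determinants. *)
Definition sbin (j z : nat) : rat := (-1) ^+ j * 'C(z, j)%:R.

(** The monic polynomial X (X + 1) ... (X + j - 1). Its values at -z are signed falling factorials,
    which links binomial matrices to Vandermonde matrices. *)
Definition rising (j : nat) : {poly rat} := \prod_(0 <= t < j) ('X - (- t%:R)%:P).

Lemma size_rising j : size (rising j) = j.+1.
Proof. by rewrite /rising size_prod_XsubC size_iota subn0. Qed.

Lemma rising_horner j z : (rising j).[- z%:R] = j`!%:R * sbin j z.
Proof.
have -> : (rising j).[- z%:R] = (-1) ^+ j * (z ^_ j)%:R.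
  rewrite /rising; elim: j => [|j ih]; first by rewrite big_geq // hornerC expr0 mul1r.
  rewrite big_nat_recr //= hornerM ih hornerXsubC ffactnSr natrM.
  case: (leqP j z) => h; last by rewrite ffact_small // !(mul0r, mulr0).
  by rewrite natrB // exprS; ring.
by rewrite /sbin -bin_ffact natrM; ring.
Qed.

Lemma prod_gap q : \prod_(i < q) \prod_(j < q | (i < j)%N) ((j - i)%N%:R : rat)
  = \prod_(j < q) j`!%:R.
Proof.
rewrite (exchange_big_dep xpredT) //=; apply: eq_bigr => j _.
have lej : (j <= q)%N by apply: ltnW.
rewrite -(big_ord_widen q (fun i => (j - i)%N%:R) lej).
elim: (nat_of_ord j) => [|p ih]; first by rewrite big_ord0.
by rewrite big_ord_recl subn0 factS natrM -ih.
Qed.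

(** The coefficients of the monic polynomials [rising i] form a unitriangular matrix that takes the
    Vandermonde matrix of the -z_i to the binomial matrix, up to factorials. The product of these
    factorials is the product of the denominators j - i. *)
Lemma det_sbin q (z : 'I_q -> nat) : \det (\matrix_(i, j) sbin j (z i))
  = \prod_(i < q) \prod_(j < q | (i < j)%N) (((z i)%:R - (z j)%:R) / (j - i)%N%:R).
Proof.
pose a : 'rV[rat]_q := \row_j (- (z j)%:R).
pose L : 'M[rat]_q := \matrix_(i, l) (rising i)`_l.
have LV : L *m Vandermonde q a
    = diag_mx (\row_(i < q) (i`!%:R : rat)) *m (\matrix_(i, j) sbin j (z i))^T.
  apply/matrixP => i j; rewrite mul_diag_mx !mxE -rising_horner.
  rewrite (horner_coef_wide _ (n := q)); last by rewrite size_rising.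
  by apply: eq_bigr => l _; rewrite !mxE.
have := congr1 determinant LV; rewrite det_unitrig_mul.
- rewrite det_mulmx det_diag det_tr det_Vandermonde => e.
  have -> : \prod_(i < q) \prod_(j < q | (i < j)%N) (((z i)%:R - (z j)%:R) / (j - i)%N%:R)
     = (\prod_(i < q) \prod_(j < q | (i < j)%N) (a 0 j - a 0 i)) / \prod_(j < q) (j`!%:R : rat).
    rewrite -prod_gap -prodf_div; apply: eq_bigr => i _; rewrite -prodf_div.
    by apply: eq_bigr => j _; rewrite !mxE opprK addrC.
  rewrite e; have -> : \prod_i (\row_(i0 < q) (i0`!%:R : rat)) 0 i = \prod_(j < q) (j`!%:R : rat).
    by apply: eq_bigr => i _; rewrite mxE.
  rewrite mulrC mulKf //; apply/prodf_neq0 => i _; by rewrite pnatr_eq0 -lt0n fact_gt0.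
- apply/is_trig_mxP => i l lt; rewrite mxE nth_default // size_rising //.
move=> i; rewrite mxE; have := monic_prod_XsubC (index_iota 0 i) xpredT (fun t : nat => - t%:R : rat).
by move/monicP; rewrite /lead_coef -/(rising i) size_rising.
Qed.

(** [z] lists the coordinates of the weight shifted by half the sum of the positive roots; the
    numerators of Weyl's product telescope to its differences. *)
Lemma weyl_det m (l : nat -> int) (z : nat -> nat) :
  (forall i, (i < m)%N -> l i.+1 + 1 = (z i)%:Z - (z i.+1)%:Z) ->
  d m l = \det (\matrix_(i < m.+1, j < m.+1) sbin j (z i)).
Proof.
move=> h; have tele i t : (i + t < m.+1)%N ->
    \sum_(i.+1 <= r < (i + t).+1) l r = (z i)%:Z - (z (i + t)%N)%:Z - t%:Z.
  elim: t => [|t ih] lt; first by rewrite addn0 big_geq // subrr.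
  rewrite addnS big_nat_recr /=; last by lia.
  rewrite ih; last by lia.
  by have := h (i + t)%N; lia.
rewrite det_sbin /d big_add1 big_mkord; apply: eq_bigr => i _.
rewrite big_add1 /= (big_nat_widenl _ 0%N) //= big_mkord; apply: eq_bigr => j lt.
have lti := ltn_ord i; have ltj := ltn_ord j.
rewrite subSS; congr (_ / _).
have := tele i (j - i)%N; rewrite subnKC; last exact: ltnW.
move=> ->; last by lia.
by rewrite !rmorphB /= !pmulrn subrK.
Qed.

Lemma sbinD j u b : sbin j (u + b) = \sum_(l < j.+1) sbin l u * sbin (j - l) b.
Proof.
rewrite /sbin -binomial.Vandermonde natr_sum mulr_sumr; apply: eq_bigr => l _.
rewrite natrM (_ : (-1) ^+ j = (-1) ^+ l * (-1) ^+ (j - l) :> rat); first by ring.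
by rewrite -exprD subnKC // -ltnS.
Qed.

Lemma sum_sbin j y p : \sum_(b < p) sbin j (y + b) = sbin j.+1 y - sbin j.+1 (y + p).
Proof.
elim: p => [|p ih]; first by rewrite big_ord0 addn0 subrr.
by rewrite big_ord_recr /= ih addnS /sbin binS natrD exprS; ring.
Qed.

Variables (m : nat) (k : nat -> nat).
Local Notation n := m.+1.

(** The shifted coordinates of lambda for sl(n+1). Those from index 1 on are the shifted coordinates
    of the highest weight of M for sl(n). *)
Definition stair i : nat := \sum_(i <= r < n) (k r.+1).+1.

Lemma stair_last : stair n = 0%N. Proof. exact: big_geq. Qed.

Lemma stairS i : (i < n)%N -> stair i = ((k i.+1).+1 + stair i.+1)%N.
Proof. by move=> lt; rewrite /stair big_ltn. Qed.

Lemma stair_le i : (stair i <= stair 0)%N.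
Proof.
case: (leqP i n) => h; last by rewrite /stair big_geq // ltnW.
by rewrite /stair [X in (_ <= X)%N](big_cat_nat _ (n := i)) //= leq_addl.
Qed.

Definition ffdet K (b : {ffun 'I_n -> 'I_K}) : rat :=
  \det (\matrix_(i < n, j < n) sbin j (stair i.+1 + b i)).

(** Row i minus row i + 1 of the larger matrix telescopes to minus a sum over the exponent b_i. The
    last row, at [stair n = 0], is a unit vector; expanding along it leaves n rows whose signs
    cancel that of the cofactor. [K] only makes the index family finite. *)
Lemma branching_sum K : (forall i, (i < n)%N -> k i.+1 < K)%N ->
  \sum_(b in family (fun (i : 'I_n) (c : 'I_K) => (c < (k i.+1).+1)%N)) ffdet b
  = \det (\matrix_(i < n.+1, j < n.+1) sbin j (stair i)).
Proof.
move=> hK; rewrite /ffdet.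
rewrite -(det_sum_rows (fun (i : 'I_n) (c : 'I_K) => (c < (k i.+1).+1)%N) (fun i c j => sbin j (stair i.+1 + c))).
rewrite -(det_sub_next n.+1 (fun i j => sbin j (stair i))) [RHS](expand_det_row _ ord_max).
have nlt : ((ord_max : 'I_n.+1).+1 < n.+1)%N = false by apply/negbTE; rewrite -leqNgt.
rewrite [RHS]big_ord_recl [X in _ = _ + X]big1 ?addr0 => [|j _].
  rewrite mxE nlt subr0 /= stair_last /sbin expr0 bin0 !mul1r /cofactor /= addn0.
  rewrite (_ : row' _ _ = - (\matrix_(i, j) \sum_(c < K | (c < (k i.+1).+1)%N) sbin j (stair i.+1 + c))).
    by rewrite -scaleN1r detZ mulrA -exprD addnn -signr_odd odd_double mul1r.
  apply/matrixP => i j; rewrite !mxE lift_max lift0 ltnS ltn_ord.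
  rewrite -(big_ord_widen K (fun c => sbin j (stair i.+1 + c))) ?hK // sum_sbin.
  by rewrite opprB [in RHS]addnC -stairS.
by rewrite mxE nlt subr0 lift0 stair_last /sbin bin0n mulr0 mul0r.
Qed.

Section Pieri.
Variable r : nat.
Local Notation K := (stair 0 + r).+1.
Local Notation fsum b := (\sum_(i < n) (b i : nat))%N.

(** The polynomial variable records the exponents, so that prescribing their sum becomes the
    extraction of a coefficient. *)
Let entry (i c j : nat) : {poly rat} := 'X^c * (sbin j (stair i.+1 + c))%:P.

Lemma coef_det_sum (a : nat -> nat) :
  (\det (\matrix_(i < n, j < n) \sum_(c < K | (c < a i)%N) entry i c j))`_r
  = \sum_(b : {ffun 'I_n -> 'I_K} | (fsum b == r) && [forall i : 'I_n, b i < a i]%N) ffdet b.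
Proof.
rewrite (det_sum_rows (fun (i : 'I_n) (c : 'I_K) => (c < a i)%N) (fun i c j => entry i c j)).
rewrite coef_sum [RHS]big_mkcond [LHS]big_mkcond; apply: eq_bigr => b _.
have -> : (b \in family (fun (i : 'I_n) (c : 'I_K) => (c < a i)%N)) = [forall i : 'I_n, b i < a i]%N.
  by [].
rewrite andbC; case: [forall _, _] => //=.
have -> : \matrix_(i, j) entry i (b i) j = \matrix_(i, j) ('X^(b i) * (map_mx polyC
    (\matrix_(i < n, j < n) sbin j (stair i.+1 + b i))) i j).
  by apply/matrixP => i j; rewrite !mxE.
rewrite det_row_scale det_map_mx /= -/(ffdet b).
have -> : \prod_(i < n) 'X^(b i) = 'X^(fsum b) :> {poly rat}.
  by elim/big_ind2: _ => // p s p' s' -> ->; rewrite exprD.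
rewrite mulrC coefCM coefXn eq_sym; case: eqP => _; by rewrite ?mulr1 ?mulr0.
Qed.

(** Below degree K' the truncation is invisible, and the coefficient counts the monomials of degree
    s in q + 1 variables. *)
Lemma coef_geom (K' q s : nat) : (s < K')%N ->
  ((\sum_(c < K') 'X^c : {poly rat}) ^+ q.+1)`_s = 'C(q + s, q)%:R.
Proof.
elim: q s => [|q ih] s lt.
  rewrite expr1 coef_sum (bigD1 (Ordinal lt)) //= coefXn eqxx big1 ?addr0 ?bin0 // => c.
  by rewrite -val_eqE /= coefXn eq_sym => /negbTE ->.
rewrite exprS mulrC coefM.
rewrite (eq_bigr (fun t : 'I_s.+1 => 'C(q + t, q)%:R)) => [|t _]; last first.
  rewrite ih; last by have := ltn_ord t; lia.
  have lt' : (s - t < K')%N by lia.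
  rewrite coef_sum (bigD1 (Ordinal lt')) //= coefXn eqxx big1 ?addr0 ?mulr1 // => c.
  by rewrite -val_eqE /= coefXn eq_sym => /negbTE ->.
rewrite -natr_sum; congr (_%:R); elim: s {lt} => [|s ihs].
  by rewrite big_ord_recl big_ord0 !addn0 !binn.
by rewrite big_ord_recr /= ihs ?addSn [RHS]binS !addnS ?addSn.
Qed.

(** Since [stair i] is [stair i.+1] plus k_{i+1} + 1, the tail of row i beyond its bound is a power
    of the variable times row i - 1, so row operations remove the bounds. The convolution then
    factors the matrix, with a triangular factor whose diagonal entries are truncated geometric
    series. *)
Lemma pieri_sum :
  \sum_(b : {ffun 'I_n -> 'I_K} | (fsum b == r) &&
      [forall i : 'I_n, (0 < i) ==> (b i < (k i.+1).+1)]%N) ffdet b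
  = 'C(m + r, m)%:R * \det (\matrix_(i < n, j < n) sbin j (stair i.+1)).
Proof.
have bound (b : {ffun 'I_n -> 'I_K}) (i : 'I_n) : fsum b == r -> (b i <= r)%N.
  by move/eqP => e; apply: (@leq_trans (fsum b)); [rewrite (bigD1 i) //= leq_addr | rewrite e].
(* In [a2] the cut-offs keep [stair i.+1 + c] below [K], which makes the tails of consecutive rows
   match exactly. In row 0 the cut-off exceeds r and imposes nothing in degree r. *)
pose a1 i := if i is 0 then (K - stair 1)%N else (k i.+1).+1.
pose a2 i := (K - stair i.+1)%N.
transitivity (\det (\matrix_(i < n, j < n) \sum_(c < K | (c < a1 i)%N) entry i c j))`_r.
  rewrite coef_det_sum; apply: eq_bigl => b; case: eqP => //= e.
  apply: eq_forallb => -[i lti]; rewrite /a1; case: i lti => [|i] lti //=.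
  have := bound b (Ordinal lti); rewrite e eqxx => /(_ isT) /=; have := stair_le 1.
  by move=> h1 h2; apply/esym; lia.
have a1E i : (i < n)%N -> (a1 i <= K)%N.
  move=> lt; rewrite /a1; case: i lt => [|i] lt; first by lia.
  by have := stairS lt; have := stair_le i.+1; lia.
have -> : \matrix_(i < n, j < n) \sum_(c < K | (c < a1 i)%N) entry i c j
  = \matrix_(i < n, j < n) ((\sum_(c < a2 i) entry i c j)
      - (if (0 < i)%N then 'X^((k i.+1).+1) * \sum_(c < a2 i.-1) entry i.-1 c j else 0)).
  apply/matrixP => i j; rewrite !mxE -(big_ord_widen K (fun c => entry i c j)) ?a1E //.
  case: i => -[|i] lti /=; first by rewrite subr0.
  have := stairS lti; have := stair_le i.+1 => h1 h2.
  have e : a2 i.+1 = ((k i.+2).+1 + a2 i)%N by rewrite /a2; lia.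
  rewrite e big_split_ord /= mulr_sumr [X in _ = _ + X - _](_ : _ = \sum_(c < a2 i) 'X^((k i.+2).+1) * entry i c j) ?addrK //.
  by apply: eq_bigr => c _; rewrite /entry exprD mulrA h2 -[in RHS]addnA addnCA.
rewrite (det_sub_prev n (fun i => 'X^((k i.+1).+1)) (fun i j => \sum_(c < a2 i) entry i c j)).
have -> : \matrix_(i < n, j < n) \sum_(c < a2 i) entry i c j
    = \matrix_(i < n, j < n) \sum_(c < K | (c < a2 i)%N) entry i c j.
  by apply/matrixP => i j; rewrite !mxE -(big_ord_widen K (fun c => entry i c j)) // leq_subr.
rewrite coef_det_sum.
(* No exponent above r contributes to the coefficient of degree r, so the cut-offs may all be
   replaced by [K]. *)
transitivity (\det (\matrix_(i < n, j < n) \sum_(c < K | (c < K)%N) entry i c j))`_r.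
  rewrite (coef_det_sum (fun=> K)); apply: eq_bigl => b; case: eqP => //= e.
  apply: eq_forallb => i; rewrite ltn_ord; have := bound b i; rewrite e eqxx => /(_ isT).
  by have := stair_le i.+1; rewrite /a2; lia.
have -> : \matrix_(i < n, j < n) \sum_(c < K | (c < K)%N) entry i c j
  = map_mx polyC (\matrix_(i < n, j < n) sbin j (stair i.+1)) *m
    \matrix_(l < n, j < n) (if (l <= j)%N then \sum_(c < K) 'X^c * (sbin (j - l) c)%:P else 0).
  apply/matrixP => i j; rewrite !mxE.
  rewrite (eq_bigl xpredT) => [|c]; last by rewrite ltn_ord.
  under [RHS]eq_bigr do rewrite !mxE.
  have lej : (j.+1 <= n)%N by [].
  rewrite (eq_bigr (fun l : 'I_n => if (l < j.+1)%N then (sbin l (stair i.+1))%:P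
     * \sum_(c < K) 'X^c * (sbin (j - l) c)%:P else 0)); last first.
    by move=> l _; rewrite ltnS; case: ifP => _; rewrite ?mulr0.
  rewrite -big_mkcond -(big_ord_widen n (fun l => (sbin l (stair i.+1))%:P
     * \sum_(c < K) 'X^c * (sbin (j - l) c)%:P)) //.
  under [RHS]eq_bigr do rewrite mulr_sumr.
  rewrite exchange_big; apply: eq_bigr => c _; rewrite /entry sbinD rmorph_sum mulr_sumr /=.
  by apply: eq_bigr => l _; rewrite polyCM; ring.
rewrite det_mulmx det_map_mx coefCM mulrC; congr (_ * _).
rewrite -det_tr det_trig; last first.
  by apply/is_trig_mxP => i j lt; rewrite !mxE leqNgt lt.
rewrite (eq_bigr (fun=> \sum_(c < K) 'X^c)) => [|i _]; last first.
  rewrite !mxE leqnn subnn; apply: eq_bigr => c _.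
  by rewrite /sbin expr0 bin0 mul1r mulr1.
by rewrite prodr_const card_ord coef_geom // ltnS leq_addl.
Qed.

End Pieri.

End Numerics.

(** * The index sets, and the dimension identities as determinant identities *)

Section Omega.
Variables (m' : nat) (k : nat -> nat).
Local Notation n := m'.+1.

Lemma Omega_hatP r (b : 'X_{1..n}) : Omega_hat n k r b <->
  mdeg b = r /\ forall i : 'I_n, (n <= m' + i)%N -> (b i <= k i.+1)%N.
Proof.
split=> [/andP[/eqP e /forallP h]|[e h]].
  by split=> // i hi; apply: (implyP (h i)); move: hi; lia.
by apply/andP; split; [apply/eqP | apply/forallP => i; apply/implyP => hi; apply: h; move: hi; lia].
Qed.

Lemma Omega_rP r (b : 'X_{1..n}) : Omega_r n k r b <->
  mdeg b = r /\ forall i : 'I_n, (n <= n + i)%N -> (b i <= k i.+1)%N.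
Proof.
split=> [/andP[/eqP e /forallP h]|[e h]]; first by split=> // i _; apply: h.
by apply/andP; split; [apply/eqP | apply/forallP => i; apply: h; apply: leq_addr].
Qed.

Lemma OmegaP (b : 'X_{1..n}) : Omega n k b = [forall i : 'I_n, b i <= k i.+1]%N.
Proof.
apply/existsP/forallP => [[r /andP[_ /forallP]] //|h].
have lt : (mdeg b < (abs_lambda n k).+1)%N.
  by rewrite ltnS mdegE /abs_lambda big_add1 big_mkord; apply: leq_sum.
by exists (Ordinal lt); rewrite /Omega_r eqxx; apply/forallP.
Qed.

Lemma Omega_mdeg (b : 'X_{1..n}) : Omega n k b -> (mdeg b <= abs_lambda n k)%N.
Proof.
by rewrite OmegaP => /forallP h; rewrite mdegE /abs_lambda big_add1 big_mkord; apply: leq_sum.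
Qed.

Definition ffun_mnm K (f : {ffun 'I_n -> 'I_K}) : 'X_{1..n} := [multinom (f i : nat) | i < n].

(** A function of degree above [D] is sent by [insubd] to the default 0; the condition that [h']
    undoes [h] excludes it from the reindexed sum. *)
Lemma sum_bmnm D K (Q : pred 'X_{1..n}) (G : 'X_{1..n} -> rat) :
  (forall b, Q b -> (mdeg b <= D)%N) -> (forall b i, Q b -> (b i < K.+1)%N) ->
  \sum_(b : 'X_{1..n < D.+1} | Q b) G b
  = \sum_(f : {ffun 'I_n -> 'I_K.+1} | Q (ffun_mnm f)) G (ffun_mnm f).
Proof.
move=> hD hK; have d0 : (mdeg (0%MM : 'X_{1..n}) < D.+1)%N by rewrite mdeg0.
pose h (f : {ffun 'I_n -> 'I_K.+1}) : 'X_{1..n < D.+1} := insubd (BMultinom d0) (ffun_mnm f).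
pose h' (b : 'X_{1..n < D.+1}) : {ffun 'I_n -> 'I_K.+1} := [ffun i => inord (b i)].
have hE f : (h f : 'X_{1..n}) = if (mdeg (ffun_mnm f) < D.+1)%N then ffun_mnm f else 0%MM.
  exact: val_insubd.
have h'K f : (mdeg (ffun_mnm f) < D.+1)%N -> h' (h f) = f.
  by move=> lt; apply/ffunP => i; rewrite ffunE hE lt mnmE inord_val.
have small f : h' (h f) = f -> (mdeg (ffun_mnm f) < D.+1)%N.
  move=> e; apply: contraT => nlt; have z : ffun_mnm f = 0%MM.
    by apply/mnmP => i; rewrite mnmE -e ffunE hE ifN // mnm0E inordK.
  by rewrite z d0 in nlt.
rewrite (reindex_onto h h') => [|b Qb].
  apply: eq_big => [f|f /andP[_ /eqP /small lt]]; last by rewrite hE lt.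
  apply/andP/idP => [[Qf /eqP /small lt]|Qf]; first by rewrite hE lt in Qf.
  have lt : (mdeg (ffun_mnm f) < D.+1)%N by rewrite ltnS hD.
  by rewrite hE lt h'K.
have eb : ffun_mnm (h' b) = b.
  by apply/mnmP => i; rewrite mnmE ffunE inordK // hK.
by apply/val_inj; rewrite /= hE eb ltnS hD.
Qed.

Lemma lambda_det (b : 'X_{1..n}) : d m' (lambda_of n k b)
  = \det (\matrix_(i < n, j < n) sbin j (stair m' k i.+1 + b i)).
Proof.
rewrite (@weyl_det m' _ (fun i => stair m' k i.+1 + nth 0%N b i)%N) => [|i lt].
  by congr (\det _); apply/matrixP => i j; rewrite !mxE -tnth_nth.
by rewrite /lambda_of /= (@stairS m' k i.+1) //; lia.
Qed.

Lemma mdeg_ffun_mnm K (f : {ffun 'I_n -> 'I_K}) : mdeg (ffun_mnm f) = (\sum_(i < n) f i)%N.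
Proof. by rewrite mdegE; apply: eq_bigr => i _; rewrite mnmE. Qed.

Lemma ffdet_lambda K (f : {ffun 'I_n -> 'I_K}) : d m' (lambda_of n k (ffun_mnm f)) = ffdet k f.
Proof.
by rewrite lambda_det; congr (\det _); apply/matrixP => i j; rewrite !mxE mnmE.
Qed.

Lemma dim_pieri r : \sum_(b : 'X_{1..n < r.+1} | Omega_hat n k r b) d m' (lambda_of n k b)
  = 'C(m' + r, m')%:R * d m' (fun i => (k i.+1)%:Z).
Proof.
rewrite (@sum_bmnm r (stair m' k 0 + r) (Omega_hat n k r) (fun b => d m' (lambda_of n k b))) => [|b /andP[/eqP -> _] //|b i /andP[/eqP <- _]]; last first.
  by rewrite ltnS mdegE (bigD1 i) //= addnCA leq_addr.
under eq_bigr do rewrite ffdet_lambda.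
rewrite (eq_bigl (fun f : {ffun 'I_n -> 'I_(stair m' k 0 + r).+1} => ((\sum_(i < n) f i)%N == r) &&
      [forall i : 'I_n, (0 < i) ==> (f i < (k i.+1).+1)]%N)); last first.
  move=> f; rewrite /Omega_hat mdeg_ffun_mnm; congr (_ && _); apply: eq_forallb => i.
  by rewrite mnmE !ltnS.
rewrite pieri_sum; congr (_ * _); rewrite (@weyl_det m' _ (fun i => stair m' k i.+1)) // => i lt.
by rewrite (@stairS m' k i.+1) //; lia.
Qed.

Lemma dim_branching :
  \sum_(b : 'X_{1..n < (abs_lambda n k).+1} | Omega n k b) d m' (lambda_of n k b)
  = d n (fun i => (k i)%:Z).
Proof.
have hK i : (i < n)%N -> (k i.+1 < (stair m' k 0).+1)%N.
  by move=> lt; have := stair_le m' k i; rewrite (@stairS m' k i) //; lia.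
rewrite (@sum_bmnm _ (stair m' k 0) (Omega n k) (fun b => d m' (lambda_of n k b))) => [|b /Omega_mdeg //|b i]; last first.
  by rewrite OmegaP => /forallP/(_ i) h; apply: leq_ltn_trans h (hK _ (ltn_ord i)).
under eq_bigr do rewrite ffdet_lambda.
rewrite (eq_bigl (fun f => f \in family (fun (i : 'I_n) (c : 'I_(stair m' k 0).+1) => (c < (k i.+1).+1)%N))); last first.
  by move=> f; rewrite OmegaP; apply: eq_forallb => i; rewrite mnmE -ltnS.
rewrite branching_sum // (@weyl_det n _ (stair m' k)) // => i lt.
by rewrite (@stairS m' k i) //; lia.
Qed.

End Omega.

(** * The tensor product and the irreducible module *)

Section Main.
Variables (F : numClosedFieldType) (m' : nat) (k : nat -> nat).
Local Notation n := m'.+1.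
Local Notation P := {mpoly F['C(n.+1, 2)]}.
Local Notation euler := (@euler F n).
Local Notation row_kernel := (@row_kernel F n k).
Local Notation hwv := (@hwv F n n).
Hypothesis m0 : (0 < m')%N.

Let lenn : (n <= n)%N. Proof. exact: leqnn. Qed.
Let W1 r (f : P) := row_kernel m' f /\ euler n f = r%:R *: f.

Lemma MhatE' r f : Mhat F n k r f <-> W1 r f.
Proof. exact: (@MhatE F n k r f). Qed.

Lemma MbarE' f : Mbar F n k f <-> row_kernel n f.
Proof. exact: MbarE. Qed.

Lemma Mbar_rE r f : Mbar_r F n k r f <-> row_kernel n f /\ euler n f = r%:R *: f.
Proof.
rewrite /Mbar_r MbarE' MhatE'; split=> [[h1 [_ h2]] //|[h1 h2]].
by split=> //; split=> //; apply: row_kernel_le h1.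
Qed.

Lemma Mhat_singular r v : Mhat F n k r v /\ singular F n k v <->
  exists b : 'X_{1..n}, Omega_hat n k r b /\ exists2 a : F, a != 0 & v = a *: xi F n b.
Proof.
rewrite MhatE' (@singularE F m' k m' r v); last by rewrite leqnn leqnSn.
by split=> -[b [/Omega_hatP hb e]]; exists b.
Qed.

Lemma Mbar_singular r v : Mbar_r F n k r v /\ singular F n k v <->
  exists b : 'X_{1..n}, Omega_r n k r b /\ exists2 a : F, a != 0 & v = a *: xi F n b.
Proof.
rewrite Mbar_rE (@singularE F m' k n r v); last by rewrite leqnSn leqnn.
by split=> -[b [/Omega_rP hb e]]; exists b.
Qed.

Lemma hwv_row_kernel M b : (M <= n)%N -> row_kernel M (hwv (row_mnm b)) <->
  forall i : 'I_n, (n <= M + i)%N -> (b i <= k i.+1)%N.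
Proof.
move=> leM; rewrite (@row_kernel_hwvE F n k m' lenn M _ leM (high_row_mnm b)).
exact: row_mnm_bound.
Qed.

Lemma hwv_row_euler r b : euler n (hwv (row_mnm b)) = r%:R *: hwv (row_mnm b) <-> mdeg b = r.
Proof.
rewrite (hwv_euler F k lenn (high_row_mnm b)) -/(row_deg m' _) row_deg_row_mnm.
split=> [/eqP|-> //]; rewrite -subr_eq0 -scalerBl scaler_eq0 (negbTE (hwv_n0 F (high_row_mnm b))) orbF.
by rewrite subr_eq0 eqr_nat => /eqP.
Qed.

Let sR M := @row_kernel_subspace F n k M.

Lemma tact_euler i j u : (1 <= i <= n)%N -> (1 <= j <= n)%N ->
  euler n (tact k n i j u) = tact k n i j (euler n u).
Proof.
move=> hi hj; have li : (i.-1 < n)%N by lia.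
have lj : (j.-1 < n)%N by lia.
have := @tactI_euler F n k m' lenn (Ordinal li) (Ordinal lj) u.
by rewrite /tactI /= !prednK //; lia.
Qed.

Let W1W r u : W1 r u -> row_kernel m' u. Proof. by case. Qed.

Let sW1 r : subspace (W1 r).
Proof.
split; first by split; [case: (sR m') | rewrite linear0 scaler0].
move=> a u v [hu hu'] [hv hv']; split; first exact: (subspaceL _ (sR m')).
by rewrite linearP /= hu' hv' scalerDr !scalerA mulrC.
Qed.

Let TW1 r i j u : (1 <= i <= n)%N -> (1 <= j <= n)%N -> W1 r u -> W1 r (tact k n i j u).
Proof.
move=> hi hj [hu hu']; have [B lf] := @level_form_exists F n k m' (leqnSn _).
split; first by apply: (row_kernel_tactM lenn lf) => //; rewrite leqnn leqnSn.
by rewrite tact_euler // hu' linearZ.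
Qed.

Let hW1 r f mu : W1 r f -> gl_invariant k n f -> f@_mu != 0 -> high n mu -> W1 r (hwv mu).
Proof.
move=> [hf ef] invf fmu hmu; split; first exact: (row_kernel_hwv lenn (leqnSn _) hf invf fmu hmu).
rewrite (hwv_euler F k lenn hmu); congr (_ *: _).
have := @mcoeff_euler F n m' f mu; rewrite ef mcoeffZ -(mulr_natr f@_mu) mulrC.
by move=> /(mulfI fmu) ->.
Qed.

Theorem Mhat_components r : generate_components F n k
   (fun beta : 'X_{1..n < r.+1} => Omega_hat n k r beta)
   (fun beta : 'X_{1..n < r.+1} => xi F n beta) (Mhat F n k r).
Proof.
have [B lf] := @level_form_exists F n k m' (leqnSn _).
apply: (components lf (sW1 r) (@W1W r) (@TW1 r) (@hW1 r)
  (bt := fun b : 'X_{1..n < r.+1} => (b : 'X_{1..n}))) => [|v|b].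
- exact: val_inj.
- exact: MhatE'.
split=> [[/hwv_row_kernel h /hwv_row_euler e]|[j /Omega_hatP[e h] ->]].
  have lt : (mdeg b < r.+1)%N by rewrite e.
  by exists (BMultinom lt) => //; apply/Omega_hatP; split=> //; apply: h; apply: leqnSn.
by split; [apply/hwv_row_kernel; first exact: leqnSn | apply/hwv_row_euler].
Qed.

Theorem Mbar_components : generate_components F n k
   (fun beta : 'X_{1..n < (abs_lambda n k).+1} => Omega n k beta)
   (fun beta : 'X_{1..n < (abs_lambda n k).+1} => xi F n beta) (Mbar F n k).
Proof.
have [B lf] := @level_form_exists F n k m' (leqnSn _).
have RW u : row_kernel n u -> row_kernel m' u by apply: row_kernel_le.
have TR i j u : (1 <= i <= n)%N -> (1 <= j <= n)%N -> row_kernel n u -> row_kernel n (tact k n i j u).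
  by apply: (row_kernel_tactM lenn lf); rewrite leqnSn leqnn.
have hR f mu := @row_kernel_hwv F n k m' lenn n f mu lenn.
apply: (components lf (sR n) RW TR hR
  (bt := fun b : 'X_{1..n < (abs_lambda n k).+1} => (b : 'X_{1..n}))) => [|v|b].
- exact: val_inj.
- exact: MbarE'.
split=> [/hwv_row_kernel h|[j]].
  have Ob : Omega n k b.
    by rewrite OmegaP; apply/forallP => i; apply: h; [apply: lenn | apply: leq_addr].
  have lt : (mdeg b < (abs_lambda n k).+1)%N by rewrite ltnS Omega_mdeg.
  by exists (BMultinom lt).
by rewrite OmegaP => /forallP h ->; apply/hwv_row_kernel => // i _; apply: h.
Qed.

Lemma Omega_small r (b : 'X_{1..n}) : (r <= k 1)%N -> Omega_hat n k r b = Omega_r n k r b.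
Proof.
move=> ler; rewrite /Omega_hat /Omega_r; case: eqP => //= e; apply: eq_forallb => i.
case: (posnP i) => [i0|ipos]; last by rewrite ltnS ipos.
rewrite i0 ltnn implyFb; apply/esym; apply: leq_trans ler.
by rewrite -e mdegE (bigD1 i) //= leq_addr.
Qed.

(** The degree already bounds beta_1 by r, hence by k_1, so every highest weight vector of the
    tensor product in degree r satisfies the condition on row n; its component follows by stability
    under gl(n). *)
Theorem Mbar_r_small r v : (r <= k 1)%N -> Mbar_r F n k r v <-> Mhat F n k r v.
Proof.
move=> ler; split=> [[]//|hv]; split=> //; apply/MbarE'; move/MhatE': hv => hv.
have [B lf] := @level_form_exists F n k m' (leqnSn _).
have TR i j u : (1 <= i <= n)%N -> (1 <= j <= n)%N -> row_kernel n u -> row_kernel n (tact k n i j u).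
  by apply: (row_kernel_tactM lenn lf); rewrite leqnSn leqnn.
have := sub_decomposition lenn lf (sW1 r) (@W1W r) (@TW1 r) (@hW1 r) hv.
apply: (lspan_min (sR n)) => u [mu [hmu W1mu] hu].
have [b eb] := row_mnmK hmu; rewrite eb in hmu W1mu hu.
apply: (sub_comp_sub (sR n) TR (mu := row_mnm b)) hu; split=> //.
case: W1mu => /hwv_row_kernel h /hwv_row_euler e; apply/hwv_row_kernel => // i hi.
have : Omega_r n k r b by rewrite -Omega_small //; apply/Omega_hatP; split=> //; apply: h.
by case/Omega_rP => _; apply.
Qed.

End Main.

Theorem theorem3p3 (R : realType) (n : nat) (k : nat -> nat) (hn : (2 <= n)%N) :
  (forall r : nat,
     [/\ forall v : {mpoly R[i][ 'C(n.+1, 2)]},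
           Mhat R[i] n k r v /\ singular R[i] n k v <->
           exists beta : 'X_{1..n}, Omega_hat n k r beta /\
             exists2 a : R[i], a != 0 & v = a *: xi R[i] n beta,
         generate_components R[i] n k
           (fun beta : 'X_{1..n < r.+1} => Omega_hat n k r beta)
           (fun beta : 'X_{1..n < r.+1} => xi R[i] n beta)
           (Mhat R[i] n k r)
       & \sum_(beta : 'X_{1..n < r.+1} | Omega_hat n k r beta)
            d n.-1 (lambda_of n k beta)
         = 'C(n + r - 1, n - 1)%:R * d n.-1 (fun i => (k i.+1)%:Z)])
  /\
  [/\ forall r : nat, (r <= abs_lambda n k)%N ->
        forall v : {mpoly R[i][ 'C(n.+1, 2)]},
          Mbar_r R[i] n k r v /\ singular R[i] n k v <->
          exists beta : 'X_{1..n}, Omega_r n k r beta /\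
            exists2 a : R[i], a != 0 & v = a *: xi R[i] n beta,
      generate_components R[i] n k
        (fun beta : 'X_{1..n < (abs_lambda n k).+1} => Omega n k beta)
        (fun beta : 'X_{1..n < (abs_lambda n k).+1} => xi R[i] n beta)
        (Mbar R[i] n k)
    & \sum_(beta : 'X_{1..n < (abs_lambda n k).+1} | Omega n k beta)
         d n.-1 (lambda_of n k beta)
      = d n (fun i => (k i)%:Z)]
  /\
  (forall r : nat, (r <= k 1%N)%N ->
     (forall beta : 'X_{1..n}, Omega_hat n k r beta = Omega_r n k r beta) /\
     (forall v : {mpoly R[i][ 'C(n.+1, 2)]}, Mbar_r R[i] n k r v <-> Mhat R[i] n k r v)).
Proof.
case: n hn => [|[|m']] // hn; have m0 : (0 < m'.+1)%N by [].
split=> [r|].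
  split.
  - move=> v; exact: (@Mhat_singular R[i] m'.+1 k m0 r v).
  - exact: (@Mhat_components R[i] m'.+1 k m0 r).
  by rewrite addSn !subn1 /=; apply: (@dim_pieri m'.+1 k r).
split; last first.
  move=> r ler; split=> [b|v]; first exact: Omega_small.
  exact: (@Mbar_r_small R[i] m'.+1 k m0 r v ler).
split.
- move=> r _ v; exact: (@Mbar_singular R[i] m'.+1 k m0 r v).
- exact: (@Mbar_components R[i] m'.+1 k).
exact: (@dim_branching m'.+1 k).
Qed.
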